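(* (Weak Harnack inequality.) Let $2\le q\le p<\infty$. Then there exist $\sigma\in(0,1)$ and $\bar C_1>0$ such that for every $R>0$ the following holds: if $u\in\widetilde W^{s_1,p}(B_{R/3})\cap\widetilde W^{s_2,q}(B_{R/3})$ satisfies $$(-\Delta)^{s_1}_p u+\beta(-\Delta)^{s_2}_q u\ge -K\ \text{ weakly in }B_{R/3},\qquad u\ge0\ \text{ in }\mathbb R^n,$$ for some $K>0$, then $$\inf_{B_{R/4}}u\ \ge\ \sigma\left(\frac{1}{|B_R\setminus B_{R/2}|}\int_{B_R\setminus B_{R/2}}u^{q-1}\,dx\right)^{\frac1{q-1}}-\bar C_1\,(KR^{ps_1})^{\frac1{p-1}}.$$
   Context: Standing assumptions: $0<s_2<s_1<1$, $n>ps_1$, $\beta>0$ is a fixed parameter. $B_\rho$ is the open ball in $\mathbb R^n$ of radius $\rho$ centered at $0$; inf is the essential infimum. For a bounded set $\Omega\subset\mathbb R^n$, $0<s<1$, $1<m<\infty$, $$\widetilde W^{s,m}(\Omega)=\Big\{u\in L^m_{loc}(\mathbb R^n):\ \exists\,U\Supset\Omega\ \text{ such that }\ \|u\|_{W^{s,m}(U)}+\int_{\mathbb R^n}\frac{|u(x)|^{m-1}}{(1+|x|)^{n+sm}}dx<\infty\Big\},$$ where $\|u\|_{W^{s,m}(U)}=\|u\|_{L^m(U)}+\big(\int_U\int_U\frac{|u(x)-u(y)|^m}{|x-y|^{n+sm}}dxdy\big)^{1/m}$. For a ball $B$, $W^{s,m}_0(B)$ denotes the closure of $C_c^\infty(B)$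 (functions extended by $0$) in $W^{s,m}(\mathbb R^n)$. The inequality $(-\Delta)^{s_1}_pu+\beta(-\Delta)^{s_2}_qu\ge -K$ weakly in $B$ means: for all $\phi\in W^{s_1,p}_0(B)\cap W^{s_2,q}_0(B)$ with $\phi\ge0$ a.e. in $B$, $$\iint_{\mathbb R^{2n}}\frac{|u(x)-u(y)|^{p-2}(u(x)-u(y))(\phi(x)-\phi(y))}{|x-y|^{n+ps_1}}dxdy+\beta\iint_{\mathbb R^{2n}}\frac{|u(x)-u(y)|^{q-2}(u(x)-u(y))(\phi(x)-\phi(y))}{|x-y|^{n+qs_2}}dxdy\ \ge\ -K\int_B\phi\,dx.$$ *)

(* Defs.v *)
From HB Require Import structures.
From mathcomp Require Import all_boot all_order all_algebra.
From mathcomp Require Import all_classical all_reals all_analysis.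
From mathcomp Require Import measurable_realfun ess_sup_inf.
Set Implicit Arguments.
Unset Strict Implicit.
Unset Printing Implicit Defensive.
Import Order.TTheory GRing.Theory Num.Theory.
Import numFieldNormedType.Exports.
Local Open Scope classical_set_scope.
Local Open Scope ring_scope.

(* R^n is 'rV[R]_n.  Its sigma-algebra is the product of the Borel
   sigma-algebras of the coordinates (as the library does for n.-tuple R). *)

Fact rV_display : measure_display. Proof. exact: default_measure_display. Qed.

Section measurable_rV.
Variables (R : realType) (n : nat).

Definition rV_coord (i : 'I_n) (x : 'rV[R]_n) : measurableTypeR R := x ord0 i.

Let rV_set0 : g_sigma_preimage rV_coord set0.
Proof. exact: sigma_algebra0. Qed.

Let rV_setC A : g_sigma_preimage rV_coord A -> g_sigma_preimage rV_coord (~` A).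
Proof. exact: sigma_algebraC. Qed.

Let rV_bigcup (F : (set 'rV[R]_n)^nat) :
  (forall i, g_sigma_preimage rV_coord (F i)) ->
  g_sigma_preimage rV_coord (\bigcup_i (F i)).
Proof. exact: sigma_algebra_bigcup. Qed.

HB.instance Definition _ := @isMeasurable.Build rV_display
  'rV[R]_n (g_sigma_preimage rV_coord) rV_set0 rV_setC rV_bigcup.

End measurable_rV.

Lemma measurable_rV_coord (R : realType) n (i : 'I_n) :
  measurable_fun [set: 'rV[R]_n] (@rV_coord R n i).
Proof.
move=> _ Y mY; rewrite setTI; apply: sub_sigma_algebra => /=.
rewrite -bigcup_seq/=; exists i => /=; first by rewrite mem_index_enum.
by exists Y => //; rewrite setTI.
Qed.

Lemma measurable_fun_rV (R : realType) n d (T : measurableType d)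
    (f : T -> 'rV[R]_n) :
  (forall i, measurable_fun [set: T] (@rV_coord R n i \o f)) ->
  measurable_fun [set: T] f.
Proof.
move=> mf _ Y; rewrite setTI.
have : g_sigma_preimage (@rV_coord R n) `<=` [set A | measurable (f @^-1` A)].
  apply: smallest_sub.
    split => /=.
    - by rewrite preimage_set0.
    - by move=> A mA; rewrite setTD preimage_setC; exact: measurableC.
    - by move=> F mF; rewrite preimage_bigcup; exact: bigcup_measurable.
  move=> A; rewrite -bigcup_seq/= => -[i _ [B mB <-]]/=.
  by rewrite setTI -comp_preimage -[X in measurable X]setTI; exact: mf.
by move=> /(_ Y); apply.
Qed.

Section lebesgue_rV.
Variable R : realType.

Definition rV_cons n (z : measurableTypeR R * 'rV[R]_n) : 'rV[R]_n.+1 :=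
  row_mx (z.1)%:M z.2 : 'rV[R]_(1 + n).

Lemma measurable_rV_cons n : measurable_fun setT (@rV_cons n).
Proof.
apply: measurable_fun_rV => i.
have [j ->|j ->] := @split_ordP 1 n i.
  rewrite (_ : _ \o _ = fst); first exact: measurable_fst.
  by apply/funext => -[x y]; rewrite /= /rV_coord /rV_cons (@row_mxEl _ 1 1 n) mxE !ord1 mulr1n.
rewrite (_ : _ \o _ = @rV_coord R n j \o snd).
  exact: measurableT_comp (@measurable_rV_coord R n j) measurable_snd.
by apply/funext => -[x y]; rewrite /= /rV_coord /rV_cons (@row_mxEr _ 1 1 n).
Qed.

Definition rV_uncons n (y : 'rV[R]_n.+1) : measurableTypeR R * 'rV[R]_n :=
  (y ord0 ord0, \row_j y ord0 (lift ord0 j)).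

Lemma rV_cons0 n x (y : 'rV[R]_n) : rV_cons (x, y) ord0 ord0 = x.
Proof.
have -> : (ord0 : 'I_n.+1) = @lshift 1 n ord0 by exact/val_inj.
by rewrite /rV_cons (@row_mxEl _ 1 1 n) mxE mulr1n.
Qed.

Lemma rV_consS n x (y : 'rV[R]_n) i :
  rV_cons (x, y) ord0 (lift ord0 i) = y ord0 i.
Proof.
have -> : lift ord0 i = @rshift 1 n i by exact/val_inj.
by rewrite /rV_cons (@row_mxEr _ 1 1 n).
Qed.

Lemma rV_consK n : cancel (@rV_cons n) (@rV_uncons n).
Proof.
move=> -[x y]; rewrite /rV_uncons rV_cons0; congr (_, _).
by apply/rowP => i; rewrite mxE rV_consS.
Qed.

Lemma measurable_rV_uncons n : measurable_fun setT (@rV_uncons n).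
Proof.
apply: measurable_fun_pair; first exact: measurable_rV_coord.
apply: measurable_fun_rV => i.
rewrite (_ : _ \o _ = @rV_coord R n.+1 (lift ord0 i)).
  exact: measurable_rV_coord.
by apply/funext => y; rewrite /rV_coord/= mxE.
Qed.

Section rV_measure_succ.
Variables (n : nat) (m1 : {sigma_finite_measure set (measurableTypeR R) -> \bar R})
  (mu : {sigma_finite_measure set 'rV[R]_n -> \bar R}).

Definition rV_measure_succ : set 'rV[R]_n.+1 -> \bar R :=
  pushforward (m1 \x mu)%E (@rV_cons n).

Let rV_measure_succ0 : rV_measure_succ set0 = 0%E.
Proof. by rewrite /rV_measure_succ /pushforward preimage_set0 measure0. Qed.

Let rV_measure_succ_ge0 A : (0 <= rV_measure_succ A)%E.
Proof. by rewrite /rV_measure_succ /pushforward; apply: measure_ge0. Qed.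

Let rV_measure_succ_sigma_additive : semi_sigma_additive rV_measure_succ.
Proof.
have mc (A : set 'rV[R]_n.+1) : measurable A -> measurable (@rV_cons n @^-1` A).
  by move=> mA; rewrite -[X in measurable X]setTI; exact: measurable_rV_cons.
move=> F mF tF mUF; rewrite /rV_measure_succ /pushforward preimage_bigcup.
apply: measure_semi_sigma_additive.
- by move=> k; exact: mc.
- apply/trivIsetP => /= i j _ _ ij; rewrite -preimage_setI.
  by move/trivIsetP : tF => /(_ _ _ _ _ ij) ->//; rewrite preimage_set0.
- by rewrite -preimage_bigcup; exact: mc.
Qed.

HB.instance Definition _ := isMeasure.Build _ _ _ rV_measure_succ
  rV_measure_succ0 rV_measure_succ_ge0 rV_measure_succ_sigma_additive.

Let rV_measure_succ_sigma_finite : sigma_finite setT rV_measure_succ.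
Proof.
have /sigma_finiteP[F [TF ndF Foo]] := sigma_finiteT m1.
have /sigma_finiteP[G [TG ndG Goo]] := sigma_finiteT mu.
exists (fun k => @rV_uncons n @^-1` (F k `*` G k)).
  apply/esym/seteqP; split => // y _; set z := rV_uncons y.
  have [k _ Fk] : (\bigcup_k F k) z.1 by rewrite -TF.
  have [l _ Gl] : (\bigcup_k G k) z.2 by rewrite -TG.
  exists (maxn k l) => //; split.
    by move: z.1 Fk; exact/subsetPset/ndF/leq_maxl.
  by move: z.2 Gl; exact/subsetPset/ndG/leq_maxr.
move=> k; have [mF Fk] := Foo k; have [mG Gk] := Goo k; split.
  rewrite -[X in measurable X]setTI; apply: measurable_rV_uncons => //.
  exact: measurableX.
rewrite /rV_measure_succ /pushforward -comp_preimage.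
rewrite (_ : _ \o _ = id); last by apply/funext => z; exact: rV_consK.
by rewrite preimage_id product_measure1E// lte_mul_pinfty// ge0_fin_numE.
Qed.

HB.instance Definition _ := Measure_isSigmaFinite.Build _ _ _ rV_measure_succ
  rV_measure_succ_sigma_finite.

End rV_measure_succ.

(* Lebesgue measure on R^n (on Borel sets): the n-fold product of the
   one-dimensional one, transported along R * R^n -> R^(n+1). *)
Fixpoint lebesgue_rV (n : nat) : {sigma_finite_measure set 'rV[R]_n -> \bar R} :=
  match n with
  | 0 => \d_ (0 : 'rV[R]_0)
  | n'.+1 => rV_measure_succ lebesgue_measure (lebesgue_rV n')
  end.

Lemma lebesgue_rV_box n (A : 'I_n -> set (measurableTypeR R)) :
  (forall i, measurable (A i)) ->
  lebesgue_rV n [set x | forall i, A i (x ord0 i)] =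
  (\prod_(i < n) lebesgue_measure (A i))%E.
Proof.
elim: n A => [|n IH] A mA.
  by rewrite big_ord0 /= diracE mem_set//= => -[].
rewrite big_ord_recl /= /rV_measure_succ /pushforward.
rewrite -IH//.
have mB : measurable [set x : 'rV[R]_n | forall i, A (lift ord0 i) (x ord0 i)].
  rewrite (_ : [set x | _] =
      \bigcap_(i in [set: 'I_n]) (@rV_coord R n i @^-1` A (lift ord0 i))).
    apply: fin_bigcap_measurable => // i _.
    by rewrite -[X in measurable X]setTI; exact: measurable_rV_coord.
  by apply/seteqP; split => [x Ax i _|x Ax i]; [exact: Ax|exact: (Ax i I)].
rewrite -product_measure1E//.
congr (_ _); apply/seteqP; split => -[x y] /= => [Axy|[Ax Ay] i].
  by split => [|i]; [have := Axy ord0|have := Axy (lift ord0 i)];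
    rewrite ?rV_cons0 ?rV_consS.
by have [j ->|->] := unliftP ord0 i; rewrite ?rV_cons0 ?rV_consS.
Qed.

End lebesgue_rV.

Section fractional.
Variables (R : realType) (n : nat).
Implicit Types (u phi : 'rV[R]_n -> R) (s m r : R) (U B : set 'rV[R]_n).

Local Notation mu := (lebesgue_rV R n).

(* The library norm `|x| on 'rV[R]_n is the sup norm; balls and kernels use the
   Euclidean one. *)
Definition enorm (x : 'rV[R]_n) : R := Num.sqrt (\sum_(i < n) x ord0 i ^+ 2).

Definition eball r : set 'rV[R]_n := [set x | enorm x < r].

Lemma measurable_enorm : measurable_fun setT enorm.
Proof.
rewrite (_ : enorm = Num.sqrt \o (fun x => \sum_(i < n) x ord0 i ^+ 2))//.
apply: measurableT_comp => /=.
  exact: continuous_measurable_fun (@sqrt_continuous R).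
apply: measurable_sum => i; apply: measurable_funX.
exact: measurable_rV_coord.
Qed.

Lemma measurable_eball r : measurable (eball r).
Proof.
rewrite -[X in measurable X]setTI.
exact: (measurable_enorm measurableT (measurable_itv `]-oo, r[)).
Qed.

(* Iterated partial derivative along the directions listed in l, last one
   first. *)
Definition iter_partial (l : seq 'I_n) (f : 'rV[R]_n -> R) : 'rV[R]_n -> R :=
  foldr (fun i g x => 'D_(delta_mx ord0 i) g x) f l.

(* C^infty: all iterated partial derivatives exist and are continuous. *)
Definition smooth (f : 'rV[R]_n -> R) : Prop := forall l : seq 'I_n,
  continuous (iter_partial l f) /\
  forall i x, derivable (iter_partial l f) x (delta_mx ord0 i).

Definition Cc_infty B (f : 'rV[R]_n -> R) : Prop := smooth f /\
  exists C, [/\ compact C, C `<=` B & forall x, ~ C x -> f x = 0].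

Local Open Scope ereal_scope.

(* On the diagonal of the double integrals the quotient is 0, since division
   by 0 is 0 here; the diagonal is a null set. *)
Definition gagliardo s m U u : \bar R :=
  (\int[mu \x mu]_(z in U `*` U)
    (`|u z.1 - u z.2| `^ m / enorm (z.1 - z.2) `^ (n%:R + s * m))%:E) `^ m^-1.

Definition sobolev_norm s m U u : \bar R :=
  (\int[mu]_(x in U) (`|u x| `^ m)%:E) `^ m^-1 + gagliardo s m U u.

Definition Lm_loc m u : Prop := measurable_fun setT u /\
  forall C, compact C -> \int[mu]_(x in C) (`|u x| `^ m)%:E < +oo.

(* U \Supset Omega: U is open and closure Omega is a compact subset of U. *)
Definition tildeW s m (Omega : set 'rV[R]_n) u : Prop := Lm_loc m u /\
  exists U, [/\ open U, compact (closure Omega), closure Omega `<=` U &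
    sobolev_norm s m U u +
    \int[mu]_x (`|u x| `^ (m - 1) / (1 + enorm x) `^ (n%:R + s * m))%:E < +oo].

(* Closure of C_c^infty(B) in W^{s,m}(R^n). *)
Definition W0 s m B phi : Prop := measurable_fun setT phi /\
  exists f : nat -> 'rV[R]_n -> R, (forall k, Cc_infty B (f k)) /\
    sobolev_norm s m setT (fun x => f k x - phi x)%R @[k --> \oo] --> 0.

Definition frac_form s m u phi : \bar R :=
  \int[mu \x mu]_z
    (`|u z.1 - u z.2| `^ (m - 2) * (u z.1 - u z.2) * (phi z.1 - phi z.2) /
     enorm (z.1 - z.2) `^ (n%:R + m * s))%:E.

(* Weak form of (-Delta)^{s1}_p u + beta (-Delta)^{s2}_q u >= -K in B. *)
Definition weak_supersol s1 p s2 q (beta K : R) B u : Prop :=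
  forall phi, W0 s1 p B phi -> W0 s2 q B phi ->
    {ae mu, forall x, B x -> (0 <= phi x)%R} ->
    (- K)%:E * \int[mu]_(x in B) (phi x)%:E <=
    frac_form s1 p u phi + beta%:E * frac_form s2 q u phi.

End fractional.

(* Main.v *)
From HB Require Import structures.
Require Import Defs.
From mathcomp Require Import all_boot all_order all_algebra.
From mathcomp Require Import all_classical all_reals all_analysis.
From mathcomp Require Import measurable_realfun ess_sup_inf ring lra.
Set Implicit Arguments.
Unset Strict Implicit.
Unset Printing Implicit Defensive.
Import Order.TTheory GRing.Theory Num.Theory.
Import numFieldNormedType.Exports.
Local Open Scope classical_set_scope.
Local Open Scope ring_scope.

(** The inequality is tested with one function.  Let L be the average on the
    right-hand side and let the barrier be the truncated paraboloid
    b(x) = max(0, 1 - 10 (|x| / r)^2), which is supported well inside the ball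
    of radius r / 3 and is at least 3 / 8 on the ball of radius r / 4.  With
    M = tau L, tau small, the test function is phi = (M b - u)^+, called
    [excess].  If its integral vanishes then u >= M b >= (3 / 8) tau L almost
    everywhere in the small ball, which is the claim.

    For each of the two forms, of order s and exponent m, two facts bound the
    form of u tested with phi.
    - The signed power |t|^(m-2) t is monotone, so replacing u by M b in the
      first argument only increases the form.  Symmetrising in the increment h,
      the form of M b becomes an integral of phi times second differences of
      the barrier: where phi > 0 the barrier coincides with its paraboloid, and
      it lies above it elsewhere, so the linear parts cancel and, as m >= 2,
      what is left is at most a multiple of M^(m-1) min(|h| / r, 1)^m.  As
      0 < s < 1, this is integrable against |h|^(-n-sm), and the form is at most
      C M^(m-1) r^(-sm) times the integral of phi ([form_barrier_le]).
    - In that comparison something is lost: at points y of the annulus between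
      r / 2 and r both b and phi vanish, while u does not.  These points
      contribute the further term - c r^(-n-sm) (int_annulus u^(m-1)) (int phi)
      ([form_density_excess_le]), which by the definition of L is at most
      - c' L^(m-1) r^(-sm) (int phi), also when m = p > q ([moment_lower]).

    For tau small the gain wins over the barrier term ([frac_form_gain]), and
    the form of order s1 is at most - k L^(p-1) r^(-s1 p) (int phi) while the
    other one is nonpositive.  Since u is a supersolution their combination is
    at least - K (int phi).  Hence either int phi = 0, or
    k L^(p-1) r^(-s1 p) <= K; in the latter case the right-hand side of the
    inequality to be proved is nonpositive for a suitable constant.

    The remaining point is that phi is an admissible test function, a limit of
    functions of class C_c^infty.  It is bounded, supported in a smaller ball
    and of finite energy ([energy_excess]); for such functions mollification
    converges in W^{s,m} ([W0_bounded]) because the energy itself provides the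
    rates.  The mollifier at scale e is dominated by e^(sm) |h|^(-n-sm), so the
    error in L^m is at most C e^(sm) times the energy; the energy of the error
    is cut at a distance d, where the short range is controlled by the energy
    of phi near the diagonal, which tends to 0 with d, and the long range by
    d^(-sm) times the error in L^m.  The choice d = e^(1/2) makes both vanish. *)

(** * Translation invariance of Lebesgue measure *)

Section translation.
Context {R : realType}.

Lemma lebesgue_measure_translate (a : R) (A : set R) : measurable A ->
  pushforward lebesgue_measure (+%R^~ a : _ -> measurableTypeR R) A =
  lebesgue_measure A.
Proof.
move=> mA; apply/esym/lebesgue_measure_unique => //=.
  by apply: measurable_funD.
move=> _ _ [[b c]] _ <-.
rewrite /pushforward [X in _ = lebesgue_measure X](_ : _ =
    `](b - a), (c - a)]%classic); last first.
  by apply/seteqP; split => x /=; rewrite !in_itv /=; lra.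
rewrite !lebesgue_measure_itv /= !lte_fin ltrD2r; case: ifPn => // _.
by rewrite -!EFinD; congr EFin; ring.
Qed.

Lemma measurable_rV_add n (a : 'rV[R]_n) :
  measurable_fun setT (fun x : 'rV[R]_n => x + a).
Proof.
apply: measurable_fun_rV => i.
rewrite (_ : _ \o _ = (fun x => rV_coord i x + a ord0 i)).
  by apply: measurable_funD => //; exact: measurable_rV_coord.
by apply/funext => x; rewrite /rV_coord /= mxE.
Qed.

(** Induction on the dimension: the measure of a translated set is a measure
    which agrees with the product measure on rectangles, the first side being
    handled by the one-dimensional case and the second by induction. *)
Lemma lebesgue_rV_translate n (a : 'rV[R]_n) (A : set 'rV[R]_n) :
  measurable A -> lebesgue_rV R n (+%R^~ a @^-1` A) = lebesgue_rV R n A.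
Proof.
elim: n a A => [a A mA|n IH a A mA].
  congr (lebesgue_rV R 0 _); apply/seteqP; split=> x /=;
    by rewrite (_ : x + a = x) //; apply/rowP => -[].
rewrite /= /rV_measure_succ /pushforward.
pose sh (z : measurableTypeR R * 'rV[R]_n) : measurableTypeR R * 'rV[R]_n :=
  (z.1 + a ord0 ord0, z.2 + \row_j a ord0 (lift ord0 j)).
have msh : measurable_fun setT sh.
  apply: measurable_fun_pair; first by apply: measurable_funD.
  exact: (measurableT_comp (@measurable_rV_add n _) measurable_snd).
have mc : measurable (@rV_cons R n @^-1` A).
  by rewrite -[X in measurable X]setTI; exact: measurable_rV_cons.
rewrite [X in product_measure1 _ _ X](_ : _ = sh @^-1` (@rV_cons R n @^-1` A)); last first.
  apply/seteqP; split => -[x y] /=; rewrite (_ : _ + a = rV_cons (sh (x, y))) //;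
  by apply/rowP => i; rewrite mxE; have [j ->|->] := unliftP ord0 i;
     rewrite ?rV_cons0 ?rV_consS ?mxE.
pose sh' : {mfun _ >-> _} := HB.pack sh (isMeasurableFun.Build _ _ _ _ _ msh).
have := @product_measure_unique _ _ _ _ R lebesgue_measure (lebesgue_rV R n)
  (pushforward (lebesgue_measure \x lebesgue_rV R n)%E sh') _ _ mc.
move=> H; symmetry; apply: H => B C mB mC.
transitivity ((lebesgue_measure \x lebesgue_rV R n)%E
  (((+%R^~ (a ord0 ord0) : measurableTypeR R -> measurableTypeR R) @^-1` B) `*`
   (+%R^~ (\row_j a ord0 (lift ord0 j)) @^-1` C))); first by [].
rewrite product_measure1E /= ?IH //.
- by congr (_ * _)%E; exact: lebesgue_measure_translate.
- rewrite -[X in measurable X]setTI.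
  have : measurable_fun setT (fun x : measurableTypeR R => (x + a ord0 ord0 : measurableTypeR R)).
    exact: measurable_funD.
  exact.
- by rewrite -[X in measurable X]setTI; exact: measurable_rV_add.
Qed.

End translation.

Section translation_integral.
Context {R : realType} {n : nat}.
Local Notation mu := (lebesgue_rV R n).
Local Open Scope ereal_scope.

Lemma integral_rV_translate (a : 'rV[R]_n) (f : 'rV[R]_n -> \bar R) :
  measurable_fun setT f -> (forall x, 0 <= f x) ->
  \int[mu]_x f (x + a)%R = \int[mu]_x f x.
Proof.
move=> mf f0.
have mt := measurable_rV_add a.
transitivity (\int[mu]_(x in (fun x => x + a)%R @^-1` setT)
  (f \o (fun x => x + a)%R) x); first by rewrite preimage_setT.
rewrite -ge0_integral_pushforward //.
apply: eq_measure_integral => A mA _.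
exact: lebesgue_rV_translate.
Qed.

Lemma integral_rV_translate_signed (a : 'rV[R]_n) (f : 'rV[R]_n -> \bar R) :
  measurable_fun setT f -> \int[mu]_x f (x + a)%R = \int[mu]_x f x.
Proof.
move=> mf; rewrite integralE [RHS]integralE.
have -> : (fun x => f (x + a)%R)^\+ = (fun x => f^\+ (x + a)%R).
  by apply/funext => x; rewrite !funeposE.
have -> : (fun x => f (x + a)%R)^\- = (fun x => f^\- (x + a)%R).
  by apply/funext => x; rewrite !funenegE.
rewrite !integral_rV_translate //.
- exact: measurable_funeneg.
- exact: measurable_funepos.
Qed.

End translation_integral.

Section translation_integral2.
Context {R : realType} {n : nat}.
Local Notation mu := (lebesgue_rV R n).
Local Notation V := 'rV[R]_n.
Local Open Scope ereal_scope.

Lemma measurable_rV_fun_add d (T : measurableType d) (f g : T -> V) :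
  measurable_fun setT f -> measurable_fun setT g ->
  measurable_fun setT (fun x => (f x + g x)%R).
Proof.
move=> mf mg; apply: measurable_fun_rV => i.
rewrite (_ : _ \o _ = (fun x => rV_coord i (f x) + rV_coord i (g x))%R).
  apply: measurable_funD;
    by apply: (measurableT_comp (@measurable_rV_coord R n i)).
by apply/funext => x; rewrite /rV_coord /= mxE.
Qed.

Lemma measurable_rV_fun_opp d (T : measurableType d) (f : T -> V) :
  measurable_fun setT f -> measurable_fun setT (fun x => (- f x)%R).
Proof.
move=> mf; apply: measurable_fun_rV => i.
rewrite (_ : _ \o _ = (fun x => - (rV_coord i (f x)))%R).
  apply: measurableT_comp => //.
  by apply: (measurableT_comp (@measurable_rV_coord R n i)).
by apply/funext => x; rewrite /rV_coord /= mxE.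
Qed.

Lemma measurable_rV_fun_sub d (T : measurableType d) (f g : T -> V) :
  measurable_fun setT f -> measurable_fun setT g ->
  measurable_fun setT (fun x => (f x - g x)%R).
Proof.
by move=> mf mg; apply: measurable_rV_fun_add => //; apply: measurable_rV_fun_opp.
Qed.

Let msh : measurable_fun setT (fun z : V * V => (z.1, z.1 + z.2)%R).
Proof.
by apply: measurable_fun_pair => //; apply: measurable_rV_fun_add.
Qed.

(** The passage from a pair (x, y) to (x, y - x): by Tonelli it is a translation
    in each slice, so that no Jacobian is involved. *)
Lemma integral_diff_variable (f : V * V -> \bar R) :
  measurable_fun setT f -> (forall z, 0 <= f z) ->
  \int[mu \x mu]_z f (z.1, z.1 + z.2)%R = \int[mu \x mu]_z f z.
Proof.
move=> mf f0.
rewrite (fubini_tonelli1 (fun z : V * V => f (z.1, z.1 + z.2)%R)) //; last first.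
  exact: measurableT_comp.
rewrite fubini_tonelli1 //; apply: eq_integral => x _.
rewrite /fubini_F /= -(@integral_rV_translate _ _ x (fun y => f (x, y))) //.
- by apply: eq_integral => h _; rewrite addrC.
- by apply: measurableT_comp => //; exact: measurable_pair1.
Qed.

Lemma integral_diff_variable_signed (f : V * V -> \bar R) :
  measurable_fun setT f ->
  \int[mu \x mu]_z f (z.1, z.1 + z.2)%R = \int[mu \x mu]_z f z.
Proof.
move=> mf; rewrite integralE [RHS]integralE.
rewrite (funepos_comp f (fun z => (z.1, z.1 + z.2)%R)).
rewrite (funeneg_comp f (fun z => (z.1, z.1 + z.2)%R)) /=.
rewrite !integral_diff_variable //.
- exact: measurable_funeneg.
- exact: measurable_funepos.
Qed.

Lemma integral_diag_translate (a : V) (f : V * V -> \bar R) :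
  measurable_fun setT f -> (forall z, 0 <= f z) ->
  \int[mu \x mu]_z f (z.1 + a, z.2 + a)%R = \int[mu \x mu]_z f z.
Proof.
move=> mf f0.
rewrite (fubini_tonelli1 (fun z : V * V => f (z.1 + a, z.2 + a)%R)) //; last first.
  apply: measurableT_comp => //; apply: measurable_fun_pair;
  exact: measurable_rV_fun_add.
rewrite fubini_tonelli1 // /fubini_F /=.
rewrite -(@integral_rV_translate _ _ a (fun x => \int[mu]_y f (x, y))) //.
- apply: eq_integral => x _.
  rewrite -(@integral_rV_translate _ _ a (fun y => f (x + a, y)%R)) //.
  by apply: measurableT_comp => //; exact: measurable_pair1.
- exact: measurable_fun_fubini_tonelli_F.
- by move=> x; exact: integral_ge0.
Qed.

End translation_integral2.

(** * The Euclidean norm *)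

Section enorm.
Context {R : realType} {n : nat}.
Local Notation V := 'rV[R]_n.
Implicit Types x y : V.

Lemma enorm_ge0 x : 0 <= enorm x.
Proof. exact: sqrtr_ge0. Qed.

Lemma sqr_enorm x : enorm x ^+ 2 = \sum_(i < n) x ord0 i ^+ 2.
Proof. by rewrite sqr_sqrtr // sumr_ge0 // => i _; exact: sqr_ge0. Qed.

Lemma enormN x : enorm (- x) = enorm x.
Proof. by congr Num.sqrt; apply: eq_bigr => i _; rewrite mxE sqrrN. Qed.

Lemma enorm_coord x i : `|x ord0 i| <= enorm x.
Proof.
rewrite -sqrtr_sqr ler_sqrt; last by apply: sumr_ge0 => j _; exact: sqr_ge0.
by rewrite (bigD1 i) //= lerDl sumr_ge0 // => j _; exact: sqr_ge0.
Qed.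

Lemma enorm0 : enorm (0 : V) = 0.
Proof.
rewrite /enorm big1 ?sqrtr0 // => i _; by rewrite mxE expr0n.
Qed.

Lemma enorm_eq0 x : enorm x = 0 -> x = 0.
Proof.
move=> x0; apply/rowP => i; rewrite mxE; apply/eqP.
by rewrite -normr_eq0 eq_le normr_ge0 andbT -x0 enorm_coord.
Qed.

Lemma enorm_dot x y : \sum_(i < n) x ord0 i * y ord0 i <= enorm x * enorm y.
Proof.
have [/enorm_eq0 ->|x0] := eqVneq (enorm x) 0.
  by rewrite enorm0 mul0r big1 // => i _; rewrite mxE mul0r.
have [/enorm_eq0 ->|y0] := eqVneq (enorm y) 0.
  by rewrite enorm0 mulr0 big1 // => i _; rewrite mxE mulr0.
have x1 : 0 < enorm x by rewrite lt_def x0 enorm_ge0.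
have y1 : 0 < enorm y by rewrite lt_def y0 enorm_ge0.
set A := enorm x in x1 *; set B := enorm y in y1 *.
have : 0 <= \sum_(i < n) (B * x ord0 i - A * y ord0 i) ^+ 2.
  by apply: sumr_ge0 => i _; exact: sqr_ge0.
have -> : \sum_(i < n) (B * x ord0 i - A * y ord0 i) ^+ 2 =
  B ^+ 2 * A ^+ 2 + A ^+ 2 * B ^+ 2 - 2 * (A * B) * \sum_(i < n) x ord0 i * y ord0 i.
  rewrite [X in _ = B ^+ 2 * X + _ - _](sqr_enorm x).
  rewrite [X in _ = _ + A ^+ 2 * X - _](sqr_enorm y).
  rewrite !mulr_sumr -big_split /= -sumrB; apply: eq_bigr => i _; ring.
set S := \sum_(i < n) _ => h.
have AB0 : 0 < A * B by exact: mulr_gt0.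
rewrite -(ler_pM2l AB0); nra.
Qed.

Lemma enormD x y : enorm (x + y) <= enorm x + enorm y.
Proof.
rewrite -(@ler_pXn2r _ 2) ?nnegrE ?addr_ge0 ?enorm_ge0 //.
rewrite sqrrD !sqr_enorm.
have -> : \sum_(i < n) (x + y) ord0 i ^+ 2 = \sum_(i < n) x ord0 i ^+ 2 +
  (\sum_(i < n) x ord0 i * y ord0 i) *+ 2 + \sum_(i < n) y ord0 i ^+ 2.
  by rewrite -mulr_natl mulr_sumr -!big_split; apply: eq_bigr => i _; rewrite mxE /=; ring.
rewrite lerD2r lerD2l -mulr_natl -[leRHS]mulr_natl ler_pM2l //.
exact: enorm_dot.
Qed.

Lemma enormB x y : enorm (x - y) <= enorm x + enorm y.
Proof. by rewrite -(enormN y) enormD. Qed.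

Lemma enorm_triangle x y : enorm x - enorm y <= enorm (x - y).
Proof. by rewrite lerBlDr -{1}(subrK y x) enormD. Qed.

Lemma enorm_triangleC x y : enorm y - enorm x <= enorm (x - y).
Proof. by rewrite -(enormN (x - y)) opprB enorm_triangle. Qed.

Lemma enorm_le_max x (c : R) : 0 <= c -> (forall i, `|x ord0 i| <= c) ->
  enorm x <= Num.sqrt n%:R * c.
Proof.
move=> c0 xc.
rewrite -{1}(ger0_norm c0) -sqrtr_sqr -sqrtrM //.
rewrite ler_sqrt; last by rewrite mulr_ge0 ?sqr_ge0.
rewrite -[n in leRHS]card_ord -sum1_card natr_sum mulr_suml.
apply: ler_sum => i _; rewrite mul1r -real_normK ?num_real //.
by rewrite ler_pXn2r ?nnegrE.
Qed.

Lemma coord_le_norm x i : `|x ord0 i| <= `|x|.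
Proof.
rewrite [leRHS]/Num.norm /= mx_normrE.
by apply: (le_bigmax _ (fun ij : 'I_1 * 'I_n => `|x ij.1 ij.2|) (ord0, i)).
Qed.

Lemma norm_le_enorm x : `|x| <= enorm x.
Proof.
rewrite [leLHS]/Num.norm /= mx_normrE; apply/bigmax_leP; split; first exact: enorm_ge0.
by move=> [i j] _ /=; rewrite ord1; exact: enorm_coord.
Qed.

Lemma enorm_le_norm x : enorm x <= Num.sqrt n%:R * `|x|.
Proof.
by apply: enorm_le_max => // i; exact: coord_le_norm.
Qed.

Lemma enorm_continuous : continuous (@enorm R n).
Proof.
move=> x; apply/(@cvgrPdist_le _ _ _ _ (@nbhs_filter V x)) => e e0.
have c0 : 0 < Num.sqrt n%:R + 1 :> R by rewrite ltr_wpDl ?sqrtr_ge0.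
apply/(@nbhs_normP R V x); exists (e / (Num.sqrt n%:R + 1)); first exact: divr_gt0.
move=> y /= xy; apply: (@le_trans _ _ (enorm (x - y))).
  by rewrite ler_norml; have := enorm_triangle x y; have := enorm_triangleC x y; lra.
apply: (le_trans (enorm_le_norm _)).
rewrite ltr_pdivlMr // in xy; apply: le_trans (ltW xy).
by rewrite mulrC ler_wpM2l // lerDl.
Qed.

End enorm.

(** * Balls, shells and the singular kernel *)

Section kernel.
Context {R : realType} {n : nat}.
Local Notation V := 'rV[R]_n.
Local Notation mu := (lebesgue_rV R n).
Local Open Scope ereal_scope.

Lemma measurable_enorm_fun d (T : measurableType d) (D : set T) (f : T -> V) :
  measurable_fun D f -> measurable_fun D (fun x => enorm (f x)).
Proof. by move=> mf; exact: (measurableT_comp (@measurable_enorm R n)). Qed.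

Lemma lebesgue_rV_cube (r : R) : (0 <= r)%R ->
  mu [set x | forall i : 'I_n, `](- r)%R, r[%classic (x ord0 i)] = ((2 * r) ^+ n)%R%:E.
Proof.
move=> r0; rewrite (@lebesgue_rV_box R n (fun=> `](- r)%R, r[%classic)) //.
rewrite (eq_bigr (fun=> (2 * r)%R%:E)) => [|i _].
  rewrite prodEFin; congr EFin; by rewrite prodr_const card_ord.
rewrite lebesgue_measure_itv /= lte_fin; case: ifPn => [_|].
  by rewrite -EFinD; congr EFin; ring.
rewrite -leNgt => h; congr EFin; lra.
Qed.

Lemma measurable_rV_box (A : set (measurableTypeR R)) : measurable A ->
  measurable [set x : V | forall i : 'I_n, A (x ord0 i)].
Proof.
move=> mA.
rewrite (_ : [set x | _] = \bigcap_(i in [set: 'I_n]) (@rV_coord R n i @^-1` A)).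
  apply: fin_bigcap_measurable => // i _.
  by rewrite -[X in measurable X]setTI; exact: measurable_rV_coord.
by apply/seteqP; split => [x Ax i _|x Ax i]; [exact: Ax|exact: (Ax i I)].
Qed.

Lemma lebesgue_rV_eball (r : R) : (0 <= r)%R ->
  mu (@eball R n r) <= ((2 * r) ^+ n)%R%:E.
Proof.
move=> r0; rewrite -lebesgue_rV_cube //; apply: le_measure.
- by rewrite inE; exact: measurable_eball.
- by rewrite inE; exact: (measurable_rV_box (measurable_itv `](- r)%R, r[)).
move=> x /= xr i; rewrite in_itv /= -ltr_norml.
exact: le_lt_trans (enorm_coord x i) xr.
Qed.

Definition shell (a b : R) : set V := [set x | (a <= enorm x < b)%R].

Lemma measurable_shell a b : measurable (shell a b).
Proof.
rewrite (_ : shell a b = @enorm R n @^-1` `[a, b[%classic).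
  by rewrite -[X in measurable X]setTI; exact: measurable_enorm.
by apply/seteqP; split => x /=; rewrite in_itv.
Qed.

(** The kernel with a positive exponent.  At 0 it vanishes rather than being
    infinite, like the quotients in the double integrals. *)
Definition ker (e : R) (h : V) : R := enorm h `^ (- e).

Lemma ker_ge0 e h : (0 <= ker e h)%R. Proof. exact: powR_ge0. Qed.

Lemma measurable_ker e d (T : measurableType d) (f : T -> V) :
  measurable_fun setT f -> measurable_fun setT (fun x => ker e (f x)).
Proof.
move=> mf; apply: (measurableT_comp (@measurable_powR R (- e))).
exact: measurable_enorm_fun.
Qed.

Lemma kerE e (h : V) : ((enorm h `^ e)^-1 = ker e h)%R.
Proof. by rewrite /ker powRN. Qed.

Lemma kerN e (h : V) : ker e (- h) = ker e h.
Proof. by rewrite /ker enormN. Qed.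

Lemma ker_le e a (h : V) : (0 <= e)%R -> (0 < a)%R -> (a <= enorm h)%R ->
  (ker e h <= a `^ (- e))%R.
Proof.
move=> e0 a0 ah; rewrite /ker !powRN lef_pV2 ?posrE ?powR_gt0 //.
  by apply: ge0_ler_powR; rewrite ?nnegrE ?enorm_ge0 // ltW.
exact: lt_le_trans ah.
Qed.

Lemma ker_ge e a (h : V) : (0 <= e)%R -> (0 < enorm h)%R -> (enorm h <= a)%R ->
  (a `^ (- e) <= ker e h)%R.
Proof.
move=> e0 a0 ah; rewrite /ker !powRN lef_pV2 ?posrE ?powR_gt0 //.
  by apply: ge0_ler_powR; rewrite ?nnegrE ?enorm_ge0 // (le_trans _ ah) // ltW.
exact: lt_le_trans ah.
Qed.

Lemma integral_shell_le (f : V -> R) (a b c : R) :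
  measurable_fun setT f -> (0 <= b)%R -> (0 <= c)%R ->
  (forall x, 0 <= f x)%R -> (forall x, shell a b x -> f x <= c)%R ->
  \int[mu]_(x in shell a b) (f x)%:E <= (c * (2 * b) ^+ n)%R%:E.
Proof.
move=> mf b0 c0 f0 fc.
apply: (@le_trans _ _ (\int[mu]_(x in shell a b) c%:E)).
  apply: ge0_le_integral => //.
  - exact: measurable_shell.
  - by move=> x _; rewrite lee_fin.
  - by apply/measurable_EFinP; exact: measurable_funTS.
rewrite integral_cst; last exact: measurable_shell.
rewrite EFinM lee_wpmul2l ?lee_fin //.
apply: le_trans (lebesgue_rV_eball b0); apply: le_measure.
- by rewrite inE; exact: measurable_shell.
- by rewrite inE; exact: measurable_eball.
by move=> x /= /andP[].
Qed.

End kernel.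

(** * Summation over dyadic shells *)

Section powR_extra.
Context {R : realType}.
Implicit Types a b c e r : R.

Lemma powR_add a b c : 0 < a -> a `^ (b + c) = a `^ b * a `^ c.
Proof. by move=> a0; rewrite powRD // (gt_eqF a0) implybT. Qed.

Lemma powR_expn_cancel k a e : 0 < a -> a `^ (- (k%:R + e)) * a ^+ k = a `^ (- e).
Proof.
move=> a0; rewrite -powR_mulrn ?(ltW a0) // -powR_add //; congr powR; ring.
Qed.

Lemma powR_lt1 a e : 1 < a -> e < 0 -> a `^ e < 1.
Proof.
move=> a1 e0; have a0 : 0 < a by lra.
by rewrite /powR gt_eqF // expR_lt1 nmulr_rlt0 // ln_gt0.
Qed.

Lemma expr2_unbounded r : exists k, r < 2 ^+ k.
Proof.
exists (Num.truncn `|r|).+1.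
apply: (le_lt_trans (ler_norm r)).
apply: (lt_le_trans (real_truncnS_gt (num_real _))).
by rewrite -natrX ler_nat ltnW // ltn_expl.
Qed.

End powR_extra.

Section dyadic.
Context {R : realType} {n : nat}.
Local Notation V := 'rV[R]_n.
Local Notation mu := (lebesgue_rV R n).
Local Open Scope ereal_scope.

Variables (f : V -> R) (A e : R).
Hypotheses (mf : measurable_fun setT f) (f0 : forall x, (0 <= f x)%R).
Hypothesis fA : forall r : R, (0 < r)%R ->
  \int[mu]_(x in @shell R n r (2 * r)%R) (f x)%:E <= (A * r `^ e)%:E.
Hypothesis A0 : (0 <= A)%R.

Let mEf D : measurable_fun D (EFin \o f).
Proof. by apply/measurable_EFinP; exact: measurable_funTS. Qed.

Let shellU (a b c : R) : (a <= b <= c)%R ->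
  \int[mu]_(x in shell a c) (f x)%:E =
  \int[mu]_(x in shell a b) (f x)%:E + \int[mu]_(x in shell b c) (f x)%:E.
Proof.
move=> /andP[ab bc].
have -> : @shell R n a c = shell a b `|` shell b c.
  apply/seteqP; split => x; rewrite /shell /=.
    move=> /andP[ax xc]; case: (ltP (enorm x) b) => h; [left|right]; apply/andP; split => //.
  case=> /andP[h1 h2]; apply/andP; split => //.
  - exact: lt_le_trans bc.
  - exact: le_trans h1.
rewrite ge0_integral_setU //.
- exact: measurable_shell.
- exact: measurable_shell.
- by move=> x _; rewrite lee_fin.
- apply/eqP; rewrite -subset0 => x [] /= /andP[_ h] /andP[h' _].
  by move: (lt_le_trans h h'); rewrite ltxx.
Qed.

Let bigcup_le (F : (set V)^nat) (B : \bar R) :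
  (forall k, measurable (F k)) -> nondecreasing_seq F ->
  (forall k, \int[mu]_(x in F k) (f x)%:E <= B) ->
  \int[mu]_(x in \bigcup_k F k) (f x)%:E <= B.
Proof.
move=> mF ndF FB.
have h := @ge0_nondecreasing_set_cvg_integral _ _ R F (EFin \o f) mu ndF mF
   (fun=> @mEf _) (fun i x _ => (f0 x : 0 <= (f x)%:E)).
rewrite -(cvg_lim _ h) //; apply: lime_le.
  by apply/cvg_ex; eexists; exact: h.
by apply: nearW => k; exact: FB.
Qed.

(** The bounds on the shells between r 2^k and r 2^(k+1) form a geometric
    series.  The induction on the number of shells carries the sum of the whole
    series, which is why r varies in it. *)
Lemma dyadic_far (r : R) : (e < 0)%R -> (0 < r)%R ->
  \int[mu]_(x in [set x | (r <= enorm x)%R]) (f x)%:E <=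
    (A / (1 - 2 `^ e) * r `^ e)%:E.
Proof.
move=> e0 r0.
have q1 : (0 < 1 - 2 `^ e :> R)%R by rewrite subr_gt0 powR_lt1 // ltr1n.
have -> : [set x : V | (r <= enorm x)%R] = \bigcup_k shell r (2 ^+ k * r)%R.
  apply/seteqP; split => x /= => [rx|[k _ /andP[]//]].
  have [k hk] := expr2_unbounded (enorm x / r).
  by exists k => //=; rewrite /shell /= rx /= -ltr_pdivrMr.
apply: bigcup_le => [k||k].
- exact: measurable_shell.
- move=> a b ab; apply/subsetPset => x /=; rewrite /shell /= => /andP[-> /= h].
  apply: (lt_le_trans h); rewrite ler_pM2r // ler_eXn2l ?ltr1n //.
elim: k r r0 => [|k IH] r r0.
  rewrite (_ : shell _ _ = set0) ?integral_set0.
    by rewrite lee_fin mulr_ge0 ?powR_ge0 // divr_ge0 // ltW.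
  apply/seteqP; split => // x; rewrite /shell /= => /andP[h1 h2].
  by move: (le_lt_trans h1 h2); rewrite expr0 mul1r ltxx.
rewrite (@shellU _ (2 * r)%R); last first.
  apply/andP; split; first by lra.
  by rewrite ler_pM2r // exprS ler_pMr // exprn_ege1 // ler1n.
have -> : (2 ^+ k.+1 * r = 2 ^+ k * (2 * r))%R by rewrite exprSr mulrA.
apply: (le_trans (leeD (fA r0) (IH _ _))); first by rewrite mulr_gt0.
rewrite -EFinD lee_fin (powRM _ (ler0n _ 2) (ltW r0)).
rewrite le_eqVlt; apply/orP; left; apply/eqP.
by field; rewrite gt_eqF.
Qed.

Lemma dyadic_near (r : R) : (0 < e)%R -> (0 < r)%R ->
  \int[mu]_(x in [set x | (0 < enorm x < r)%R]) (f x)%:E <=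
    (A / (1 - 2 `^ (- e)) * r `^ e)%:E.
Proof.
move=> e0 r0.
have q1 : (0 < 1 - 2 `^ (- e) :> R)%R.
  by rewrite subr_gt0 powR_lt1 ?ltr1n // oppr_lt0.
have -> : [set x : V | (0 < enorm x < r)%R] = \bigcup_k shell (r / 2 ^+ k)%R r.
  apply/seteqP; split => x /= => [/andP[x0 xr]|[k _ /andP[h ->]]]; last first.
    by rewrite andbT; apply: lt_le_trans h; rewrite divr_gt0 // exprn_gt0.
  have [k hk] := expr2_unbounded (r / enorm x).
  exists k => //=; rewrite /shell /= xr andbT ler_pdivrMr ?exprn_gt0 //.
  by rewrite mulrC -ler_pdivrMr // ltW.
apply: bigcup_le => [k||k].
- exact: measurable_shell.
- move=> a b ab; apply/subsetPset => x /=; rewrite /shell /= => /andP[h ->].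
  rewrite andbT; apply: le_trans h; rewrite ler_pM2l //.
  rewrite lef_pV2 ?posrE ?exprn_gt0 //; rewrite ler_eXn2l ?ltr1n //.
elim: k r r0 => [|k IH] r r0.
  rewrite (_ : shell _ _ = set0) ?integral_set0.
    by rewrite lee_fin mulr_ge0 ?powR_ge0 // divr_ge0 // ltW.
  apply/seteqP; split => // x; rewrite /shell /= => /andP[h1 h2].
  by move: (le_lt_trans h1 h2); rewrite expr0 divr1 ltxx.
have r20 : (0 < r / 2)%R by rewrite divr_gt0.
rewrite (@shellU _ (r / 2)%R); last first.
  apply/andP; split; last by lra.
  rewrite ler_pM2l // lef_pV2 ?posrE ?exprn_gt0 // exprS ler_pMr //.
  by rewrite exprn_ege1 // ler1n.
have -> : (r / 2 ^+ k.+1 = r / 2 / 2 ^+ k)%R.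
  by rewrite exprS invfM mulrA.
apply: (le_trans (leeD (IH _ r20) (le_trans _ (fA r20)))).
  by rewrite (_ : 2 * (r / 2) = r)%R //; lra.
have h2 : (2 `^ (- e) * (2 `^ e) = 1 :> R)%R.
  by rewrite -powR_add // addNr powRr0.
rewrite -EFinD lee_fin.
have -> : (r `^ e = 2 `^ e * (r / 2) `^ e)%R.
  by rewrite -powRM ?(ltW r20) //; congr powR; lra.
have : (0 <= (r / 2) `^ e)%R by exact: powR_ge0.
set X := ((r / 2) `^ e)%R => X0.
have E : (2 `^ e = (2 `^ (- e))^-1 :> R)%R by rewrite powRN invrK.
have Q0 : (0 < 2 `^ (- e) :> R)%R by rewrite powR_gt0.
rewrite E; set Q := (2 `^ (- e))%R in q1 Q0 *.
rewrite (_ : A / (1 - Q) * (Q^-1 * X) = A / (1 - Q) * X * Q^-1)%R; last by ring.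
rewrite ler_pdivlMr //.
rewrite (_ : (_ + _) * Q = A * X * ((2 - Q) * Q / (1 - Q)))%R; last first.
  by field; rewrite gt_eqF.
rewrite (_ : A / (1 - Q) * X = A * X * (1 / (1 - Q)))%R; last first.
  by field; rewrite gt_eqF.
apply: ler_wpM2l; first exact: mulr_ge0.
rewrite ler_pM2r ?invr_gt0 //; nra.
Qed.
End dyadic.

(** * Integrals of the truncated kernel *)

Section kernel_integral.
Context {R : realType} {n : nat}.
Local Notation V := 'rV[R]_n.
Local Notation mu := (lebesgue_rV R n).
Local Open Scope ereal_scope.

(** On a dyadic shell the kernel is comparable to a constant, and the volume of
    the shell is at most that of a cube of side 4 r. *)
Lemma shell_ker (t r : R) : (0 < t)%R -> (0 < r)%R ->
  \int[mu]_(x in shell r (2 * r)%R) (ker (n%:R + t) x)%:E <=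
  (4 ^+ n * r `^ (- t))%:E.
Proof.
move=> t0 r0; have e0 : (0 <= n%:R + t)%R by rewrite addr_ge0 // ltW.
apply: (le_trans (@integral_shell_le R n _ r (2 * r)%R (r `^ (- (n%:R + t))) _ _ _ _ _)).
- exact: measurable_ker.
- by rewrite mulr_ge0 // ltW.
- exact: powR_ge0.
- by move=> x; exact: ker_ge0.
- by move=> x /= /andP[rx _]; exact: ker_le.
rewrite lee_fin mulrA exprMn mulrCA -(powR_expn_cancel n t r0).
by rewrite (_ : 2 * 2 = 4)%R //; ring.
Qed.

Lemma shell_ker_near (m t r : R) : (0 <= m)%R -> (0 < t)%R -> (0 < r)%R ->
  \int[mu]_(x in shell r (2 * r)%R) (enorm x `^ m * ker (n%:R + t) x)%:E <=
  (2 `^ m * 4 ^+ n * r `^ (m - t))%:E.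
Proof.
move=> m0 t0 r0; have e0 : (0 <= n%:R + t)%R by rewrite addr_ge0 // ltW.
apply: (le_trans (@integral_shell_le R n _ r (2 * r)%R
   ((2 * r) `^ m * r `^ (- (n%:R + t)))%R _ _ _ _ _)).
- apply: measurable_funM; last exact: measurable_ker.
  apply: (measurableT_comp (@measurable_powR R m)); exact: measurable_enorm.
- by rewrite mulr_ge0 // ltW.
- by rewrite mulr_ge0 // powR_ge0.
- by move=> x; rewrite mulr_ge0 ?powR_ge0 ?ker_ge0.
- move=> x /= /andP[rx xr]; apply: ler_pM; rewrite ?powR_ge0 ?ker_ge0 //.
    apply: ge0_ler_powR => //; rewrite ?nnegrE ?enorm_ge0 //; last exact: ltW.
    by rewrite mulr_ge0 // ltW.
  exact: ker_le.
rewrite lee_fin (powRM _ (ler0n _ 2) (ltW r0)) powR_add // -(powR_expn_cancel n t r0).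
rewrite !exprMn (_ : 4 ^+ n = 2 ^+ n * 2 ^+ n :> R)%R; last first.
  by rewrite -exprMn -natrM.
by rewrite le_eqVlt; apply/orP; left; apply/eqP; ring.
Qed.

(** Up to a constant, a bound for the m-th power of the increment, over the
    distance |h|, of a function that is bounded by 1 and varies at scale r. *)
Definition kmin (m r : R) (h : V) : R := (Num.min ((enorm h / r) `^ m) 1)%R.

Lemma kmin_ge0 m r h : (0 <= kmin m r h)%R.
Proof. by rewrite /kmin le_min powR_ge0 ler01. Qed.

Lemma measurable_kmin m r d (T : measurableType d) (f : T -> V) :
  measurable_fun setT f -> measurable_fun setT (fun x => kmin m r (f x)).
Proof.
move=> mf; apply: measurable_minr => //.
apply: (measurableT_comp (@measurable_powR R m)).
apply: measurable_funM => //; exact: measurable_enorm_fun.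
Qed.

(** Near 0 the integrand is of order |h|^(m-n-t) and at infinity of order
    |h|^(-n-t): dyadic summation applies to both since 0 < t < m. *)
Lemma ker_integral (m t : R) : (0 < t)%R -> (t < m)%R ->
  exists C : R, (0 < C)%R /\ forall r : R, (0 < r)%R ->
    \int[mu]_h (kmin m r h * ker (n%:R + t) h)%:E <= (C * r `^ (- t))%:E.
Proof.
move=> t0 tm.
have m0 : (0 < m)%R by exact: lt_trans tm.
pose C1 := (4 ^+ n / (1 - 2 `^ (- t)) : R)%R.
pose C2 := (2 `^ m * 4 ^+ n / (1 - 2 `^ (- (m - t))) : R)%R.
have C10 : (0 < C1)%R.
  by rewrite divr_gt0 ?exprn_gt0 // subr_gt0 powR_lt1 ?ltr1n // oppr_lt0.
have C20 : (0 < C2)%R.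
  rewrite divr_gt0 ?mulr_gt0 ?powR_gt0 ?exprn_gt0 // subr_gt0 powR_lt1 ?ltr1n //.
  by rewrite oppr_lt0 subr_gt0.
exists (C1 + C2)%R; split; first exact: addr_gt0.
move=> r r0.
pose g h : R := (kmin m r h * ker (n%:R + t) h)%R.
have g0 h : (0 <= g h)%R by rewrite mulr_ge0 ?kmin_ge0 ?ker_ge0.
have mg : measurable_fun setT g.
  by apply: measurable_funM; [exact: measurable_kmin|exact: measurable_ker].
have mEg D : measurable_fun D (EFin \o g).
  by apply/measurable_EFinP; exact: measurable_funTS.
have mN : measurable [set x : V | (r <= enorm x)%R].
  rewrite (_ : [set x | _] = @enorm R n @^-1` `[r, +oo[%classic).
    by rewrite -[X in measurable X]setTI; exact: measurable_enorm.
  by apply/seteqP; split => x /=; rewrite in_itv /= andbT.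
have mO : measurable [set x : V | (0 < enorm x < r)%R].
  rewrite (_ : [set x | _] = @enorm R n @^-1` `]0%R, r[%classic).
    by rewrite -[X in measurable X]setTI; exact: measurable_enorm.
  by apply/seteqP; split => x /=; rewrite in_itv.
have -> : [set: V] = @eball R n r `|` [set x | (r <= enorm x)%R].
  by apply/seteqP; split => x // _; case: (ltP (enorm x) r) => h; [left|right].
rewrite (ge0_integral_setU _ (measurable_eball r) mN) //=; last 2 first.
- by move=> x _; rewrite lee_fin; exact: g0.
- apply/eqP; rewrite -subset0 => x [] /=; rewrite /eball /= => h1 h2.
  by move: (lt_le_trans h1 h2); rewrite ltxx.
rewrite mulrDl EFinD addeC; apply: leeD; last first.
  apply: (@le_trans _ _ (\int[mu]_(x in [set x | (r <= enorm x)%R]) (ker (n%:R + t) x)%:E)).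
    apply: ge0_le_integral => //.
    - by move=> x _; rewrite lee_fin; exact: g0.
    - by apply/measurable_EFinP; apply: measurable_funTS; exact: measurable_ker.
    - move=> x _; rewrite lee_fin -[leRHS]mul1r ler_wpM2r ?ker_ge0 //.
      by rewrite /kmin ge_min lexx orbT.
  rewrite -/C1; apply: dyadic_far => //.
  - exact: measurable_ker.
  - by move=> x; exact: ker_ge0.
  - by move=> ? ?; exact: shell_ker.
  - by rewrite oppr_lt0.
have -> : \int[mu]_(x in eball r) (g x)%:E =
          \int[mu]_(x in [set x | (0 < enorm x < r)%R]) (g x)%:E.
  rewrite integral_mkcond [RHS]integral_mkcond; apply: eq_integral => x _.
  rewrite !patchE; case: (eqVneq (enorm x) 0%R) => [x0|x0].
    rewrite (_ : g x = 0%R); first by case: ifP; case: ifP.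
    rewrite /g /ker x0 powR0 ?mulr0 //.
    by rewrite oppr_eq0 gt_eqF // ltr_wpDl.
  have xp : (0 < enorm x)%R by rewrite lt_def x0 enorm_ge0.
  by congr (if _ then _ else _); apply/idP/idP; rewrite !inE /eball /= xp.
apply: (@le_trans _ _ (\int[mu]_(x in [set x | (0 < enorm x < r)%R])
   ((r `^ (- m))%:E * (enorm x `^ m * ker (n%:R + t) x)%:E))).
  apply: ge0_le_integral => //.
  - by move=> x _; rewrite lee_fin; exact: g0.
  - apply/measurable_EFinP; apply: measurable_funTS; apply: measurable_funM => //.
    apply: measurable_funM; last exact: measurable_ker.
    apply: (measurableT_comp (@measurable_powR R m)); exact: measurable_enorm.
  - move=> x _; rewrite -EFinM lee_fin mulrA ler_wpM2r ?ker_ge0 //.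
    rewrite /kmin ge_min powRM ?enorm_ge0 ?invr_ge0 ?(ltW r0) //.
    by rewrite -powR_inv1 ?(ltW r0) // -powRrM mulN1r mulrC lexx.
rewrite ge0_integralZl_EFin ?powR_ge0 //.
  rewrite (_ : C2 * _ = r `^ (- m) * (C2 * r `^ (m - t)))%R; last first.
    by rewrite mulrCA -powR_add //; congr (_ * powR _ _)%R; ring.
  rewrite EFinM lee_wpmul2l ?lee_fin ?powR_ge0 //.
  apply: dyadic_near => //.
  - apply: measurable_funM; last exact: measurable_ker.
    apply: (measurableT_comp (@measurable_powR R m)); exact: measurable_enorm.
  - by move=> x; rewrite mulr_ge0 ?powR_ge0 ?ker_ge0.
  - by move=> ? ?; apply: shell_ker_near => //; exact: ltW.
  - by rewrite subr_gt0.
- by move=> x _; rewrite lee_fin mulr_ge0 ?powR_ge0 ?ker_ge0.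
- apply/measurable_EFinP; apply: measurable_funTS.
  apply: measurable_funM; last exact: measurable_ker.
  apply: (measurableT_comp (@measurable_powR R m)); exact: measurable_enorm.
Qed.

End kernel_integral.

(** * Inequalities for signed powers *)

Section signed_power.
Context {R : realType}.
Implicit Types a b c m : R.

Definition spow m a : R := `|a| `^ (m - 2) * a.

Lemma ler_powR2 e a b : 0 <= e -> 0 <= a -> a <= b -> a `^ e <= b `^ e.
Proof.
by move=> e0 a0 ab; apply: ge0_ler_powR => //; rewrite nnegrE // (le_trans a0).
Qed.

Lemma spow_ge0E m a : 2 <= m -> 0 <= a -> spow m a = a `^ (m - 1).
Proof.
move=> m2 a0; rewrite /spow ger0_norm //.
have [->|an0] := eqVneq a 0; first by rewrite mulr0 powR0 // gt_eqF //; lra.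
rewrite -[X in _ * X](powRr1 a0) -powR_add ?lt_def ?an0 //.
by congr powR; ring.
Qed.

Lemma spowN m a : spow m (- a) = - spow m a.
Proof. by rewrite /spow normrN mulrN. Qed.

Lemma spow_le0E m a : 2 <= m -> a <= 0 -> spow m a = - (- a) `^ (m - 1).
Proof.
by move=> m2 a0; rewrite -[in LHS](opprK a) spowN spow_ge0E // oppr_ge0.
Qed.

Lemma spow_mono m a b : 2 <= m -> a <= b -> spow m a <= spow m b.
Proof.
move=> m2 ab; have m1 : 0 <= m - 1 by lra.
have [a0|a0] := leP 0 a; have [b0|b0] := leP 0 b.
- by rewrite !spow_ge0E //; apply: ler_powR2.
- by lra.
- rewrite spow_le0E ?(ltW a0) // spow_ge0E //.
  by apply: (@le_trans _ _ 0); rewrite ?oppr_le0 powR_ge0.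
- rewrite !spow_le0E ?(ltW a0) ?(ltW b0) // lerN2.
  by apply: ler_powR2 => //; lra.
Qed.

Lemma spow_norm m a : 2 <= m -> `|spow m a| = `|a| `^ (m - 1).
Proof.
move=> m2; have [a0|a0] := leP 0 a.
  by rewrite spow_ge0E // (ger0_norm a0) ger0_norm ?powR_ge0.
have a1 := ltW a0.
by rewrite spow_le0E // normrN (ltr0_norm a0) ger0_norm ?powR_ge0.
Qed.

(** If b / 2 <= a, both (a - b / 2)^(m-1) and (b / 2)^(m-1) fit into a^(m-1) by
    superadditivity; otherwise a - b <= - b / 2 and the negative part alone
    suffices. *)
Lemma spow_sub m a b : 2 <= m -> 0 <= a -> 0 <= b ->
  spow m (a - b) <= spow m a - (b / 2) `^ (m - 1).
Proof.
move=> m2 a0 b0; have m1 : 0 <= m - 1 by lra.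
have [h|h] := leP (b / 2) a.
  rewrite lerBrDr; apply: (@le_trans _ _ (spow m (a - b / 2) + (b / 2) `^ (m - 1))).
    by rewrite lerD2r; apply: spow_mono => //; lra.
  rewrite (spow_ge0E m2 a0) spow_ge0E ?subr_ge0 //.
  have a1 : forall x, 0 <= x -> x `^ (m - 1) = x * x `^ (m - 2).
    by move=> x x0; rewrite -(spow_ge0E m2 x0) /spow ger0_norm // mulrC.
  rewrite !a1 ?subr_ge0 //; last lra.
  have h1 : (a - b / 2) `^ (m - 2) <= a `^ (m - 2).
    by apply: ler_powR2; lra.
  have h2 : (b / 2) `^ (m - 2) <= a `^ (m - 2).
    by apply: ler_powR2; lra.
  apply: (@le_trans _ _ ((a - b / 2) * a `^ (m - 2) + b / 2 * a `^ (m - 2))); last first.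
    by rewrite -mulrDl subrK.
  by apply: lerD; apply: ler_wpM2l => //; lra.
rewrite [leLHS]spow_le0E //; last lra.
have := @ler_powR2 (m - 1) (b / 2) (- (a - b)) m1 _ _.
rewrite spow_ge0E //; have := powR_ge0 a (m - 1).
move=> p0 /(_ _ _) H; have : (b / 2) `^ (m - 1) <= (- (a - b)) `^ (m - 1) by apply: H; lra.
lra.
Qed.

(** From expR x >= 1 + x and - ln t <= 1 / t - 1 <= 2 (1 - t). *)
Lemma bernoulli_half (t r : R) : 1 / 2 <= t -> t <= 1 -> 0 <= r ->
  1 - t `^ r <= 2 * r * (1 - t).
Proof.
move=> t2 t1 r0; have t0 : 0 < t by lra.
rewrite /powR gt_eqF //.
have := expR_ge1Dx (r * ln t).
suff : - (2 * (1 - t)) <= ln t by move=> h; nra.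
have ti : 0 < t^-1 by rewrite invr_gt0.
have : ln (t^-1) <= t^-1 - 1.
  have := @le_ln1Dx R (t^-1 - 1); rewrite (_ : 1 + (t^-1 - 1) = t^-1); last by ring.
  by apply; lra.
rewrite lnV ?posrE // => h.
have h2 : t^-1 - 1 <= 2 * (1 - t).
  rewrite (_ : t^-1 - 1 = t^-1 * (1 - t)); last by field; rewrite gt_eqF.
  apply: ler_wpM2r; first lra.
  by rewrite -[leRHS]invrK lef_pV2 ?posrE ?invr_gt0 //; lra.
lra.
Qed.

(** A form of the mean value inequality: after scaling to b = 1 it is
    [bernoulli_half] when a >= 1 / 2, and trivial when a is smaller. *)
Lemma powR_diff m a b : 2 <= m -> 0 <= a -> a <= b ->
  b `^ (m - 1) - a `^ (m - 1) <= 2 * m * (b - a) * b `^ (m - 2).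
Proof.
move=> m2 a0 ab.
have [b0|b0] := eqVneq b 0.
  have -> : a = b by lra.
  by rewrite !subrr mulr0 mul0r.
have bp : 0 < b by rewrite lt_def b0 (le_trans a0).
have Eb : b `^ (m - 1) = b * b `^ (m - 2).
  by rewrite -(spow_ge0E m2 (ltW bp)) /spow gtr0_norm // mulrC.
have Ea : a `^ (m - 1) = (a / b) `^ (m - 1) * b `^ (m - 1).
  by rewrite -powRM ?divr_ge0 ?(ltW bp) // divfK.
rewrite Ea Eb.
have B0 : 0 <= b `^ (m - 2) by exact: powR_ge0.
rewrite (_ : _ - _ = (b * (1 - (a / b) `^ (m - 1))) * b `^ (m - 2)); last by ring.
apply: ler_wpM2r => //.
rewrite (_ : 2 * m * (b - a) = b * (2 * m * (1 - a / b))); last by field.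
apply: ler_wpM2l; first exact: ltW.
have t0 : 0 <= a / b by rewrite divr_ge0 // ltW.
have t1 : a / b <= 1 by rewrite ler_pdivrMr // mul1r.
have [h|h] := leP (1 / 2) (a / b).
  apply: (le_trans (bernoulli_half h t1 _)); first lra.
  by apply: ler_wpM2r; lra.
have := powR_ge0 (a / b) (m - 1); nra.
Qed.

Lemma spow_diff m a b c : 2 <= m -> a <= b -> `|a| <= c -> `|b| <= c ->
  spow m b - spow m a <= 2 * m * (b - a) * c `^ (m - 2).
Proof.
move=> m2 ab; rewrite !ler_norml => /andP[ac1 ac2] /andP[bc1 bc2].
have c0 : 0 <= c by lra.
have P x y : 0 <= x -> x <= y -> y <= c ->
  y `^ (m - 1) - x `^ (m - 1) <= 2 * m * (y - x) * c `^ (m - 2).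
  move=> x0 xy yc; apply: (le_trans (powR_diff m2 x0 xy)).
  apply: ler_wpM2l; first by apply: mulr_ge0; lra.
  by apply: ler_powR2; lra.
have [a0|a0] := leP 0 a.
  by rewrite !spow_ge0E //; [exact: P|lra].
have [b0|b0] := leP b 0.
  rewrite !spow_le0E ?(ltW a0) //.
  have := P (- b) (- a); rewrite !opprK.
  rewrite (_ : - a + b = b - a); last by ring.
  by rewrite addrC => -> //; lra.
rewrite spow_ge0E ?(ltW b0) // spow_le0E ?(ltW a0) //.
have := P 0 b (lexx 0) (ltW b0) bc2; have := P 0 (- a) (lexx 0).
rewrite !subr0 powR0 ?subr0; last by rewrite gt_eqF //; lra.
move=> /(_ _ _) h1 h2.
have h3 : (- a) `^ (m - 1) <= 2 * m * (- a) * c `^ (m - 2) by apply: h1; lra.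
rewrite opprK mulrDr mulrDl; exact: lerD.
Qed.

Lemma spow_prod_le m a b : 2 <= m -> 
  `|spow m a * b| <= `|a| `^ m + `|b| `^ m.
Proof.
move=> m2; rewrite normrM spow_norm //.
have E x : 0 <= x -> x `^ m = x `^ (m - 1) * x.
  by move=> x0; rewrite -[in LHS](mulr_powRB1 x0) 1?mulrC //; lra.
have [ab|ab] := leP `|a| `|b|.
  apply: (@le_trans _ _ (`|b| `^ m)); last by rewrite lerDr powR_ge0.
  rewrite E // ler_wpM2r //; apply: ler_powR2 => //; lra.
apply: (@le_trans _ _ (`|a| `^ m)); last by rewrite lerDl powR_ge0.
by rewrite [leRHS]E // ler_wpM2l ?powR_ge0 // ltW.
Qed.

Lemma powR_sum_le m a b : 0 <= m -> 
  `|a + b| `^ m <= 2 `^ m * (`|a| `^ m + `|b| `^ m).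
Proof.
move=> m0; have [ab|ab] := leP `|a| `|b|.
  apply: (@le_trans _ _ ((2 * `|b|) `^ m)).
    apply: ler_powR2 => //; apply: (le_trans (ler_normD _ _)); lra.
  by rewrite powRM // ler_wpM2l ?powR_ge0 // lerDr powR_ge0.
apply: (@le_trans _ _ ((2 * `|a|) `^ m)).
  apply: ler_powR2 => //; apply: (le_trans (ler_normD _ _)); lra.
by rewrite powRM // ler_wpM2l ?powR_ge0 // lerDl powR_ge0.
Qed.

(** Integrated against a probability density with l half of the average A of a,
    this bounds a fixed fraction of A^(r+1) by the average of a^(r+1): below the
    level l the left-hand side is nonpositive, and above it a^r >= l^r. *)
Lemma powR_cut (r a l : R) : 0 <= r -> 0 <= a -> 0 <= l -> 
  l `^ r * a - l `^ (r + 1) <= a `^ (r + 1).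
Proof.
move=> r0 a0 l0.
have E x : 0 <= x -> x `^ (r + 1) = x `^ r * x.
  by move=> x0; rewrite -[in LHS](mulr_powRB1 x0) ?addrK 1?mulrC //; lra.
rewrite !E // -mulrBr.
have [la|la] := leP l a; last first.
  apply: (@le_trans _ _ 0); last by rewrite mulr_ge0 // powR_ge0.
  by apply: mulr_ge0_le0; rewrite ?powR_ge0 //; lra.
apply: (@le_trans _ _ (l `^ r * a)).
  by apply: ler_wpM2l; [exact: powR_ge0|lra].
by apply: ler_wpM2r => //; exact: ler_powR2.
Qed.

End signed_power.

(** * Integrals against a kernel of the difference *)

Section integral_helpers.
Local Open Scope ereal_scope.
Context d (T : measurableType d) (R : realType) (mu : {measure set T -> \bar R}).

Lemma le_integral_signed (f g : T -> \bar R) :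
  measurable_fun setT f -> measurable_fun setT g -> (forall x, f x <= g x) ->
  \int[mu]_x f x <= \int[mu]_x g x.
Proof.
move=> mf mg fg; rewrite integralE [leRHS]integralE; apply: leeB.
- apply: ge0_le_integral => //.
  + exact: measurable_funepos.
  + exact: measurable_funepos.
  + by move=> x _; rewrite !funeposE ge_max !le_max fg lexx orbT.
- apply: ge0_le_integral => //.
  + exact: measurable_funeneg.
  + exact: measurable_funeneg.
  + by move=> x _; rewrite !funenegE ge_max !le_max leeN2 fg lexx orbT.
Qed.

End integral_helpers.

Section convolution_kernels.
Context {R : realType} {n : nat}.
Local Notation V := 'rV[R]_n.
Local Notation mu := (lebesgue_rV R n).
Local Open Scope ereal_scope.
Variables (w k : V -> R).
Hypotheses (mw : measurable_fun setT w) (mk : measurable_fun setT k).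
Hypotheses (w0 : forall x, (0 <= w x)%R) (k0 : forall x, (0 <= k x)%R).

Lemma measurable_fun_diff (f : V -> R) : measurable_fun setT f ->
  measurable_fun setT (fun z : V * V => f (z.1 - z.2)%R).
Proof.
by move=> mf; apply: (measurableT_comp mf); exact: measurable_rV_fun_sub.
Qed.

Lemma integral_kernel_snd :
  \int[mu \x mu]_z (w z.2 * k (z.1 - z.2))%:E =
  (\int[mu]_x (k x)%:E) * \int[mu]_x (w x)%:E.
Proof.
have mwk : measurable_fun setT (fun z : V * V => (w z.2 * k (z.1 - z.2))%R).
  by apply: measurable_funM; [exact: measurableT_comp|exact: measurable_fun_diff].
rewrite (fubini_tonelli2 (fun z : V * V => (w z.2 * k (z.1 - z.2))%:E)) /=.
- rewrite -ge0_integralZl //.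
  + apply: eq_integral => y _; rewrite /fubini_G /=.
    under eq_integral do rewrite EFinM.
    rewrite ge0_integralZl_EFin //.
    * rewrite muleC; congr (_ * _).
      apply: (@integral_rV_translate _ _ (- y)%R (EFin \o k)) => //.
      - exact/measurable_EFinP.
      - by move=> x; rewrite lee_fin.
    * apply/measurable_EFinP; apply: (measurableT_comp mk).
      exact: measurable_rV_fun_sub.
  + exact/measurable_EFinP.
  + by move=> x _; rewrite lee_fin.
  + by apply: integral_ge0 => x _; rewrite lee_fin.
- exact/measurable_EFinP.
- by move=> z; rewrite lee_fin mulr_ge0.
Qed.

Hypothesis kN : forall x, k (- x)%R = k x.

Lemma integral_kernel_fst :
  \int[mu \x mu]_z (w z.1 * k (z.1 - z.2))%:E =
  (\int[mu]_x (k x)%:E) * \int[mu]_x (w x)%:E.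
Proof.
have mwk : measurable_fun setT (fun z : V * V => (w z.1 * k (z.1 - z.2))%R).
  by apply: measurable_funM; [exact: measurableT_comp|exact: measurable_fun_diff].
rewrite (fubini_tonelli1 (fun z : V * V => (w z.1 * k (z.1 - z.2))%:E)) /=.
- rewrite -ge0_integralZl //.
  + apply: eq_integral => y _; rewrite /fubini_F /=.
    under eq_integral do rewrite EFinM -kN opprB.
    rewrite ge0_integralZl_EFin //.
    * rewrite muleC; congr (_ * _).
      apply: (@integral_rV_translate _ _ (- y)%R (EFin \o k)) => //.
      - exact/measurable_EFinP.
      - by move=> x; rewrite lee_fin.
    * apply/measurable_EFinP; apply: (measurableT_comp mk).
      exact: measurable_rV_fun_sub.
  + exact/measurable_EFinP.
  + by move=> x _; rewrite lee_fin.
  + by apply: integral_ge0 => x _; rewrite lee_fin.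
- exact/measurable_EFinP.
- by move=> z; rewrite lee_fin mulr_ge0.
Qed.

End convolution_kernels.

(** * The barrier *)

Section barrier.
Context {R : realType} {n : nat}.
Local Notation V := 'rV[R]_n.
Local Notation mu := (lebesgue_rV R n).
Variable (r : R).
Hypothesis r0 : 0 < r.

(** With the factor 10 the barrier vanishes from the radius 8 r / 25 on, which
    is less than r / 3, and is at least 3 / 8 inside the radius r / 4. *)
Definition barrier (x : V) : R := Num.max 0 (1 - 10 * (enorm x / r) ^+ 2).

Lemma barrier_ge0 x : 0 <= barrier x.
Proof. by rewrite /barrier le_max lexx. Qed.

Lemma barrier_le1 x : barrier x <= 1.
Proof.
rewrite /barrier ge_max ler01 /= lerBlDr lerDl mulr_ge0 //; exact: sqr_ge0.
Qed.

Lemma measurable_barrier : measurable_fun setT barrier.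
Proof.
apply: measurable_maxr => //; apply: measurable_funB => //.
apply: measurable_funM => //; apply: measurable_funX; apply: measurable_funM => //.
exact: measurable_enorm.
Qed.

Lemma barrier_eq0 x : 8 / 25 * r <= enorm x -> barrier x = 0.
Proof.
move=> h; have t : 8 / 25 <= enorm x / r by rewrite ler_pdivlMr.
by rewrite /barrier; apply/max_idPl; nra.
Qed.

Lemma barrier_lower x : enorm x < r / 4 -> 3 / 8 <= barrier x.
Proof.
move=> h; have t : enorm x / r < 1 / 4.
  by rewrite ltr_pdivrMr //; lra.
have t0 : 0 <= enorm x / r by rewrite divr_ge0 ?enorm_ge0 // ltW.
by rewrite /barrier le_max; apply/orP; right; nra.
Qed.

(** The positive part of 1 - 10 t^2 is Lipschitz on the half line although the
    parabola is not: the slope is 20 t, and the truncation occurs before 1. *)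
Lemma barrier_lipschitz x y : `|barrier x - barrier y| <= 20 * (enorm (x - y) / r).
Proof.
wlog le_xy : x y / enorm x <= enorm y.
  move=> H; case: (leP (enorm x) (enorm y)) => [|/ltW] h; first exact: H.
  by rewrite distrC -[enorm (x - y)]enormN opprB; exact: H.
have hxy := enorm_triangleC x y.
have : (enorm y - enorm x) / r <= enorm (x - y) / r.
  by rewrite ler_pM2r ?invr_gt0.
rewrite mulrBl.
have : enorm x / r <= enorm y / r by rewrite ler_pM2r ?invr_gt0.
have : 0 <= enorm x / r by rewrite divr_ge0 ?enorm_ge0 // ltW.
rewrite /barrier; set s := enorm x / r; set t := enorm y / r.
move: (enorm (x - y) / r) => D s0 st tD.
apply: (@le_trans _ _ (20 * (t - s))); last lra.
rewrite ger0_norm; last first.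
  by rewrite subr_ge0 ge_max !le_max lexx /=; apply/orP; right; nra.
rewrite lerBlDr ge_max; apply/andP; split.
  by rewrite addr_ge0 ?le_max ?lexx // mulr_ge0 // subr_ge0.
case: (leP t 1) => t1.
  apply: (@le_trans _ _ (20 * (t - s) + (1 - 10 * t ^+ 2))); first nra.
  by rewrite lerD2l le_max lexx orbT.
apply: (@le_trans _ _ (20 * (t - s) + 0)); last by rewrite lerD2l le_max lexx.
by case: (leP s (1 / 2)) => s2; nra.
Qed.

Lemma barrier_kmin (m : R) x y : 0 < m ->
  `|barrier x - barrier y| `^ m <= 20 `^ m * kmin m r (x - y).
Proof.
move=> m0; rewrite /kmin minr_pMr ?powR_ge0 // le_min; apply/andP; split.
  rewrite -powRM // ?divr_ge0 ?enorm_ge0 ?(ltW r0) //.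
  by apply: ler_powR2 => //; [exact: ltW|exact: barrier_lipschitz].
rewrite mulr1; apply: ler_powR2 => //; first exact: ltW.
have := barrier_ge0 x; have := barrier_ge0 y; have := barrier_le1 x.
have := barrier_le1 y; rewrite ler_norml; lra.
Qed.

(** At x the barrier equals the paraboloid and elsewhere it lies above it, so the
    increments of M times the barrier are at most al + ga and - al + ga, where
    al is linear in h and ga quadratic.  As the signed power is odd, the sum is
    at most the increment of the signed power between al - ga and al + ga, which
    is of order ga |h|^(m-2).  For |h| > r boundedness is enough. *)
Lemma barrier_second_difference (m M : R) x h : 2 <= m -> 0 <= M ->
  0 < barrier x ->
  spow m (M * barrier x - M * barrier (x + h)) +
  spow m (M * barrier x - M * barrier (x - h)) <=
  40 * m * 17 `^ m * M `^ (m - 1) * kmin m r h.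
Proof.
move=> m2 M0 bx.
have m1 : 0 <= m - 1 by lra.
have E : barrier x = 1 - 10 * (enorm x / r) ^+ 2.
  move: bx; rewrite /barrier; case: (leP 0 (1 - 10 * (enorm x / r) ^+ 2)) => // _.
  by rewrite ltxx.
have q17 : 1 <= 17 `^ m :> R.
  by rewrite -[leLHS](powRr0 17); apply: ler_powR; lra.
have [hr|hr] := leP (enorm h) r; last first.
  have -> : kmin m r h = 1.
    rewrite /kmin; apply/min_idPr; rewrite -[leLHS](powRr0 (enorm h / r)).
    by apply: ler_powR; [rewrite ler_pdivlMr // mul1r ltW|lra].
  have H y : spow m (M * barrier x - M * barrier y) <= M `^ (m - 1).
    rewrite -spow_ge0E //; apply: spow_mono => //.
    have := barrier_le1 x; have := barrier_ge0 y; nra.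
  apply: (le_trans (lerD (H _) (H _))).
  have := powR_ge0 M (m - 1); set P := M `^ (m - 1) => P0.
  rewrite mulr1; apply: (@le_trans _ _ (2 * P)); first by lra.
  apply: ler_wpM2r => //; nra.
have km : kmin m r h = (enorm h / r) `^ m.
  rewrite /kmin; apply/min_idPl; have p1 : 1 `^ m = 1 :> R by rewrite powR1.
  rewrite -[leRHS]p1.
  apply: ler_powR2; [lra| by rewrite divr_ge0 ?enorm_ge0 // ltW|].
  by rewrite ler_pdivrMr // mul1r.
pose d := \sum_(i < n) x ord0 i * h ord0 i.
have sqD : enorm (x + h) ^+ 2 = enorm x ^+ 2 + 2 * d + enorm h ^+ 2.
  rewrite !sqr_enorm /d mulr_sumr -!big_split; apply: eq_bigr => i _.
  by rewrite mxE /=; ring.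
have sqB : enorm (x - h) ^+ 2 = enorm x ^+ 2 - 2 * d + enorm h ^+ 2.
  rewrite !sqr_enorm /d mulr_sumr -sumrB -!big_split; apply: eq_bigr => i _.
  by rewrite !mxE /=; ring.
have dle : `|d| <= enorm x * enorm h.
  rewrite ler_norml enorm_dot andbT lerNl -sumrN.
  rewrite (eq_bigr (fun i => x ord0 i * (- h) ord0 i)) => [|i _].
    by rewrite -(enormN h) enorm_dot.
  by rewrite mxE mulrN.
have xr : enorm x / r <= 1 / 3.
  have : 0 <= enorm x / r by rewrite divr_ge0 ?enorm_ge0 // ltW.
  move: bx; rewrite E; nra.
set H := enorm h / r in km *.
have H0 : 0 <= H by rewrite divr_ge0 ?enorm_ge0 // ltW.
have H1 : H <= 1 by rewrite ler_pdivrMr // mul1r.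
pose al := 20 * M * (d / r ^+ 2).
pose ga := 10 * M * H ^+ 2.
have rr : r != 0 by rewrite gt_eqF.
have bD : M * barrier x - M * barrier (x + h) <= al + ga.
  have : 1 - 10 * (enorm (x + h) / r) ^+ 2 <= barrier (x + h).
    by rewrite /barrier le_max lexx orbT.
  rewrite E !expr_div_n sqD => hb.
  rewrite -mulrBr (_ : al + ga = M * (20 * (d / r ^+ 2) + 10 * H ^+ 2)); last by rewrite /al /ga; ring.
  apply: ler_wpM2l => //; rewrite /H expr_div_n; move: hb.
  rewrite !mulrDl; lra.
have bB : M * barrier x - M * barrier (x - h) <= - (al - ga).
  have : 1 - 10 * (enorm (x - h) / r) ^+ 2 <= barrier (x - h).
    by rewrite /barrier le_max lexx orbT.
  rewrite E !expr_div_n sqB => hb.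
  rewrite -mulrBr (_ : - (al - ga) = M * (- (20 * (d / r ^+ 2)) + 10 * H ^+ 2)); last by rewrite /al /ga; ring.
  apply: ler_wpM2l => //; rewrite /H expr_div_n; move: hb.
  rewrite !mulrDl mulNr; lra.
have al_le : `|al| <= 7 * M * H.
  rewrite /al normrM (ger0_norm (_ : 0 <= 20 * M)); last by rewrite mulr_ge0.
  have : `|d / r ^+ 2| <= 1 / 3 * H.
    rewrite normrM (ger0_norm (_ : 0 <= (r ^+ 2)^-1)) ?invr_ge0 ?sqr_ge0 //.
    apply: (@le_trans _ _ (enorm x * enorm h * (r ^+ 2)^-1)).
      by apply: ler_wpM2r => //; rewrite invr_ge0 sqr_ge0.
    rewrite (_ : enorm x * enorm h * (r ^+ 2)^-1 = enorm x / r * H); last by rewrite /H; field.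
    exact: ler_wpM2r.
  have : 0 <= M * H by exact: mulr_ge0.
  have := normr_ge0 (d / r ^+ 2); nra.
have ga_le : ga <= 10 * M * H.
  by rewrite /ga; apply: ler_wpM2l; [exact: mulr_ge0|nra].
have ga0 : 0 <= ga by rewrite /ga mulr_ge0 ?sqr_ge0 ?mulr_ge0.
apply: (le_trans (lerD (spow_mono m2 bD) (spow_mono m2 bB))).
rewrite spowN.
have c1 : `|al - ga| <= 17 * M * H.
  apply: (le_trans (ler_normB _ _)); rewrite (ger0_norm ga0); lra.
have c2 : `|al + ga| <= 17 * M * H.
  apply: (le_trans (ler_normD _ _)); rewrite (ger0_norm ga0); lra.
apply: (le_trans (spow_diff m2 _ c1 c2)); first lra.
rewrite (_ : al + ga - (al - ga) = 2 * ga); last by ring.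
clearbody H; rewrite km /ga !powRM ?mulr_ge0 //.
have Ep (a : R) : 0 <= a -> a `^ (m - 1) = a * a `^ (m - 2).
  by move=> a0; rewrite -(spow_ge0E m2 a0) /spow ger0_norm // mulrC.
have EH : H `^ m = H ^+ 2 * H `^ (m - 2).
  rewrite expr2 -mulrA -Ep // -[LHS]mulr_powRB1 //; lra.
rewrite EH Ep //.
rewrite (_ : 2 * m * _ * _ = 40 * m * 17 `^ (m - 2) *
   (M * M `^ (m - 2)) * (H ^+ 2 * H `^ (m - 2))); last by ring.
apply: ler_wpM2r; first by rewrite mulr_ge0 ?sqr_ge0 ?powR_ge0.
apply: ler_wpM2r; first by rewrite mulr_ge0 ?powR_ge0.
apply: ler_wpM2l; first by lra.
by apply: ler_powR; lra.
Qed.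

End barrier.

(** * Fractional energy *)

Section energy.
Context {R : realType} {n : nat}.
Local Notation V := 'rV[R]_n.
Local Notation mu := (lebesgue_rV R n).
Local Open Scope ereal_scope.
Implicit Types (s m : R) (f : V -> R).

Definition energy_density s m f (z : V * V) : R :=
  (`|f z.1 - f z.2| `^ m * ker (n%:R + s * m) (z.1 - z.2))%R.

Definition energy s m f : \bar R := \int[mu \x mu]_z (energy_density s m f z)%:E.

Lemma energy_density_ge0 s m f z : (0 <= energy_density s m f z)%R.
Proof. by rewrite mulr_ge0 ?powR_ge0 ?ker_ge0. Qed.

Lemma measurable_increment f : measurable_fun setT f ->
  measurable_fun setT (fun z : V * V => (f z.1 - f z.2)%R).
Proof. by move=> mf; apply: measurable_funB; exact: measurableT_comp. Qed.

Lemma measurable_ker_diff e :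
  measurable_fun setT (fun z : V * V => ker e (z.1 - z.2)%R).
Proof. by apply: measurable_ker; exact: measurable_rV_fun_sub. Qed.

Lemma measurable_energy_density s m f : measurable_fun setT f ->
  measurable_fun setT (energy_density s m f).
Proof.
move=> mf; apply: measurable_funM; last exact: measurable_ker_diff.
apply: (measurableT_comp (@measurable_powR R m)); apply: measurableT_comp => //.
exact: measurable_increment.
Qed.

Lemma kminN m r (h : V) : kmin m r (- h)%R = kmin m r h.
Proof. by rewrite /kmin enormN. Qed.

(** The variables separate: each of the two terms is the integral of w times the
    integral of the truncated kernel. *)
Lemma integral_kmin_ball s m r a (w : V -> R) :
  (0 < s)%R -> (s < 1)%R -> (0 < m)%R -> (0 < r)%R ->
  measurable_fun setT w -> (forall x, 0 <= w x)%R ->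
  (forall x, a <= enorm x -> w x = 0)%R -> (forall x, w x <= 1)%R ->
  \int[mu \x mu]_z ((w z.1 + w z.2) *
     (kmin m r (z.1 - z.2) * ker (n%:R + s * m) (z.1 - z.2)))%:E < +oo.
Proof.
move=> s0 s1 m0 r0 mw w0 wa w1.
pose k (h : V) := (kmin m r h * ker (n%:R + s * m) h)%R : R.
have k0 h : (0 <= k h)%R by rewrite mulr_ge0 ?kmin_ge0 ?ker_ge0.
have mk : measurable_fun setT k.
  by apply: measurable_funM; [exact: measurable_kmin|exact: measurable_ker].
have kN h : k (- h)%R = k h by rewrite /k kminN kerN.
have [C [C0 /(_ _ r0) HC]] := @ker_integral R n m (s * m) (mulr_gt0 s0 m0)
   (ltac:(by rewrite gtr_pMl)).
have wfin : \int[mu]_x (w x)%:E < +oo.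
  apply: (@le_lt_trans _ _ (\int[mu]_(x in @eball R n `|a|) 1)).
    rewrite [leRHS]integral_mkcond; apply: ge0_le_integral => //.
    - by move=> x _; rewrite lee_fin.
    - exact/measurable_EFinP.
    - by apply/(measurable_restrictT _ (measurable_eball _)).
    - move=> x _; rewrite patchE; case: ifPn => xa; rewrite lee_fin //.
      rewrite wa //; move: xa; rewrite notin_setE /eball /= => /negP.
      by rewrite -leNgt; apply: le_trans; exact: ler_norm.
  rewrite integral_cst ?mul1e; last exact: measurable_eball.
  by apply: (le_lt_trans (lebesgue_rV_eball _)); rewrite ?ltry.
have Kfin : \int[mu]_h (k h)%:E < +oo by apply: (le_lt_trans HC); rewrite ltry.
have mA (g : V * V -> V) : measurable_fun setT g ->
    measurable_fun setT (fun z : V * V => (w (g z) * k (z.1 - z.2))%R).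
  move=> mg; apply: measurable_funM; first exact: measurableT_comp.
  exact: measurable_fun_diff.
under eq_integral do rewrite mulrDl EFinD.
rewrite ge0_integralD //.
- rewrite (integral_kernel_fst mw mk w0 k0 kN) (integral_kernel_snd mw mk w0 k0).
  have F : (\int[mu]_x (k x)%:E) * (\int[mu]_x (w x)%:E) < +oo.
    rewrite lte_mul_pinfty // ?integral_ge0 ?ge0_fin_numE //.
    + by move=> x _; rewrite lee_fin.
    + by apply: integral_ge0 => x _; rewrite lee_fin.
  by rewrite lte_add_pinfty.
- by move=> z _; rewrite lee_fin; apply: mulr_ge0; [exact: w0|exact: k0].
- by apply/measurable_EFinP; exact: (mA fst).
- by move=> z _; rewrite lee_fin; apply: mulr_ge0; [exact: w0|exact: k0].
- by apply/measurable_EFinP; exact: (mA snd).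
Qed.

Definition ballind a (x : V) : R := if (enorm x < a)%R then 1%R else 0%R.

Lemma ballind_ge0 a x : (0 <= ballind a x)%R.
Proof. by rewrite /ballind; case: ifP. Qed.

Lemma ballind_le1 a x : (ballind a x <= 1)%R.
Proof. by rewrite /ballind; case: ifP. Qed.

Lemma ballind_out a x : (a <= enorm x)%R -> ballind a x = 0%R.
Proof. by rewrite /ballind ltNge => ->. Qed.

Lemma ballind_in a x : (enorm x < a)%R -> ballind a x = 1%R.
Proof. by rewrite /ballind => ->. Qed.

Lemma measurable_ballind a : measurable_fun setT (ballind a).
Proof.
apply: measurable_fun_if => //; try exact: measurable_cst.
apply: measurable_fun_ltr => //; exact: measurable_enorm.
Qed.

(** The barrier is bounded, Lipschitz and supported in a ball, so the m-th
    powers of its increments are at most multiples of [kmin], and vanish when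
    both points are outside the ball. *)
Lemma energy_barrier s m r M : (0 < s)%R -> (s < 1)%R -> (0 < m)%R ->
  (0 < r)%R -> (0 <= M)%R -> energy s m (fun x => M * barrier r x)%R < +oo.
Proof.
move=> s0 s1 m0 r0 M0.
have mb : measurable_fun setT (fun x : V => M * barrier r x)%R.
  by apply: measurable_funM => //; exact: measurable_barrier.
apply: (@le_lt_trans _ _ (\int[mu \x mu]_z (((M * 20) `^ m)%:E *
  ((ballind r z.1 + ballind r z.2) *
     (kmin m r (z.1 - z.2) * ker (n%:R + s * m) (z.1 - z.2)))%:E))).
  apply: ge0_le_integral => //.
  - by move=> z _; rewrite lee_fin energy_density_ge0.
  - by apply/measurable_EFinP; exact: measurable_energy_density.
  - apply/measurable_EFinP; apply: measurable_funM => //.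
    apply: measurable_funM.
      by apply: measurable_funD; apply: measurableT_comp => //; exact: measurable_ballind.
    apply: measurable_funM; last exact: measurable_ker_diff.
    by apply: measurable_kmin; exact: measurable_rV_fun_sub.
  - move=> [x y] _; rewrite -EFinM lee_fin /energy_density /=.
    rewrite !mulrA; apply: ler_wpM2r; first exact: ker_ge0.
    rewrite -mulrBr normrM (ger0_norm M0).
    rewrite (powRM _ M0 (normr_ge0 _)) (powRM _ M0 (ler0n _ 20)).
    have H := barrier_kmin r0 x y m0.
    rewrite -!mulrA; apply: ler_wpM2l; first exact: powR_ge0.
    have [hx|hx] := ltP (enorm x) r.
      rewrite (ballind_in hx) mulrA; apply: (le_trans H).
      apply: ler_wpM2r; first exact: kmin_ge0.
      by rewrite ler_peMr ?powR_ge0 // lerDl ballind_ge0.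
    have [hy|hy] := ltP (enorm y) r.
      rewrite (ballind_in hy) mulrA; apply: (le_trans H).
      apply: ler_wpM2r; first exact: kmin_ge0.
      by rewrite ler_peMr ?powR_ge0 // lerDr ballind_ge0.
    have E (y' : V) : (r <= enorm y')%R -> barrier r y' = 0%R.
      by move=> h; apply: (barrier_eq0 r0); lra.
    rewrite (E x hx) (E y hy) subrr normr0 powR0 ?gt_eqF //.
    by rewrite !mulr_ge0 ?addr_ge0 ?ballind_ge0 ?powR_ge0 ?kmin_ge0.
rewrite ge0_integralZl_EFin ?powR_ge0 //.
- rewrite lte_mul_pinfty ?lee_fin ?powR_ge0 //.
  apply: (@integral_kmin_ball _ _ _ r) => //.
  + exact: measurable_ballind.
  + exact: ballind_ge0.
  + exact: ballind_out.
  + exact: ballind_le1.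
- move=> z _; rewrite lee_fin.
  by rewrite !mulr_ge0 ?addr_ge0 ?ballind_ge0 ?kmin_ge0 ?ker_ge0.
- apply/measurable_EFinP; apply: measurable_funM.
    by apply: measurable_funD; apply: measurableT_comp => //; exact: measurable_ballind.
  apply: measurable_funM; last exact: measurable_ker_diff.
  by apply: measurable_kmin; exact: measurable_rV_fun_sub.
Qed.

End energy.

(** * The form of the barrier *)

Section form_barrier.
Context {R : realType} {n : nat}.
Local Notation V := 'rV[R]_n.
Local Notation mu := (lebesgue_rV R n).
Local Open Scope ereal_scope.
Implicit Types (s m : R) (f : V -> R).

Definition form_density s m (u phi : V -> R) (z : V * V) : R :=
  (spow m (u z.1 - u z.2) * (phi z.1 - phi z.2) * ker (n%:R + s * m) (z.1 - z.2))%R.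

Lemma measurable_spow m d (T : measurableType d) (f : T -> R) :
  measurable_fun setT f -> measurable_fun setT (fun x => spow m (f x)).
Proof.
move=> mf; apply: measurable_funM => //.
by apply: (measurableT_comp (@measurable_powR R (m - 2))); apply: measurableT_comp.
Qed.

Lemma measurable_form_density s m (u phi : V -> R) : measurable_fun setT u ->
  measurable_fun setT phi -> measurable_fun setT (form_density s m u phi).
Proof.
move=> mu_ mp; apply: measurable_funM; last exact: measurable_ker_diff.
by apply: measurable_funM; [apply: measurable_spow|]; exact: measurable_increment.
Qed.

Lemma frac_formE s m (u phi : V -> R) :
  frac_form s m u phi = \int[mu \x mu]_z (form_density s m u phi z)%:E.
Proof.
apply: eq_integral => z _; rewrite /form_density /spow /= kerE.
by rewrite [(m * s)%R]mulrC.
Qed.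

Lemma integrable_form_density s m (u phi : V -> R) : (2 <= m)%R ->
  measurable_fun setT u -> measurable_fun setT phi ->
  energy s m u < +oo -> energy s m phi < +oo ->
  (mu \x mu).-integrable setT (EFin \o form_density s m u phi).
Proof.
move=> m2 mu_ mp eu ep; apply/integrableP; split.
  by apply/measurable_EFinP; exact: measurable_form_density.
apply: (@le_lt_trans _ _ (energy s m u + energy s m phi)); last first.
  exact: (lte_add_pinfty eu ep).
rewrite -ge0_integralD //; last 4 first.
- by move=> z _; rewrite lee_fin energy_density_ge0.
- by apply/measurable_EFinP; exact: measurable_energy_density.
- by move=> z _; rewrite lee_fin energy_density_ge0.
- by apply/measurable_EFinP; exact: measurable_energy_density.
apply: ge0_le_integral => //.
- apply: measurableT_comp => //; apply/measurable_EFinP.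
  exact: measurable_form_density.
- apply/measurable_EFinP.
  by apply: measurable_funD; exact: measurable_energy_density.
- move=> z _; rewrite lee_fin /form_density /energy_density -mulrDl normrM.
  rewrite (ger0_norm (ker_ge0 _ _)); apply: ler_wpM2r; first exact: ker_ge0.
  exact: spow_prod_le.
Qed.

Lemma integrable_bounded (phi : V -> R) B a : measurable_fun setT phi ->
  (forall x, 0 <= phi x)%R -> (forall x, phi x <= B)%R ->
  (forall x, a <= enorm x -> phi x = 0)%R ->
  mu.-integrable setT (EFin \o phi).
Proof.
move=> mp p0 pB pa; apply/integrableP; split; first exact/measurable_EFinP.
apply: (@le_lt_trans _ _ (\int[mu]_(x in @eball R n `|a|) B%:E)).
  rewrite [leRHS]integral_mkcond; apply: ge0_le_integral => //.
  - by apply: measurableT_comp => //; exact/measurable_EFinP.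
  - by apply/(measurable_restrictT _ (measurable_eball _)).
  - move=> x _; rewrite patchE /=; case: ifPn => xa; rewrite lee_fin ger0_norm //.
    rewrite pa //; move: xa; rewrite notin_setE /eball /= => /negP.
    by rewrite -leNgt; apply: le_trans; exact: ler_norm.
rewrite integral_cst; last exact: measurable_eball.
have B0 : (0 <= B)%R by apply: le_trans (p0 0%R) (pB _).
apply: (@le_lt_trans _ _ (B%:E * ((2 * `|a|) ^+ n)%:E)); last by rewrite -EFinM ltry.
by rewrite lee_wpmul2l ?lee_fin //; exact: lebesgue_rV_eball.
Qed.

Lemma integrable_bounded_mul (phi a : V -> R) B : measurable_fun setT a ->
  (forall x, `|a x| <= B)%R -> mu.-integrable setT (EFin \o phi) ->
  mu.-integrable setT (fun x : V => (a x * phi x)%:E).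
Proof.
move=> ma aB iphi.
have /measurable_EFinP mp := measurable_int _ iphi.
have iB := integrableZl measurableT B iphi.
apply: (le_integrable measurableT _ _ iB).
  by apply/measurable_EFinP; exact: measurable_funM.
move=> x _; rewrite -EFinM !abse_EFin lee_fin !normrM; apply: ler_wpM2r => //.
by apply: (le_trans (aB x)); exact: ler_norm.
Qed.

(** For a fixed increment h the translation x -> x - h turns the term carrying
    phi (x + h) into a term carrying phi x.  The two terms together are the
    second difference of the barrier at points where phi is positive. *)
Lemma increment_shift_le s m r M (phi : V -> R) B h :
  (2 <= m)%R -> (0 < r)%R -> (0 <= M)%R ->
  measurable_fun setT phi -> (forall x, 0 <= phi x)%R ->
  (forall x, phi x <= B)%R -> (forall x, 0 < phi x -> 0 < barrier r x)%R ->
  \int[mu]_x (form_density s m (fun x => M * barrier r x)%R phi (x, x + h)%R)%:E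
  <= (40 * m * 17 `^ m * M `^ (m - 1) * (kmin m r h * ker (n%:R + s * m) h))%:E *
     \int[mu]_x (phi x)%:E.
Proof.
move=> m2 r0 M0 mp p0 pB pb.
pose v (x : V) := (M * barrier r x)%R.
have mv : measurable_fun setT v.
  by apply: measurable_funM => //; exact: measurable_barrier.
have ip : mu.-integrable setT (EFin \o phi).
  apply: (@integrable_bounded _ B (8 / 25 * r)%R) => // x xr.
  apply/eqP; rewrite eq_le p0 andbT leNgt; apply/negP => /pb.
  by rewrite barrier_eq0 // ltxx.
have vM x : (0 <= v x <= M)%R.
  rewrite /v; apply/andP; split; first by rewrite mulr_ge0 ?barrier_ge0.
  apply: ler_piMr => //; exact: barrier_le1.
have mvh (h' : V) : measurable_fun setT (fun x : V => v (x + h')%R).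
  by apply: (measurableT_comp mv); exact: measurable_rV_add.
have mph (h' : V) : measurable_fun setT (fun x : V => phi (x + h')%R).
  by apply: (measurableT_comp mp); exact: measurable_rV_add.
have sb x y : (`|spow m (v x - v y)| <= M `^ (m - 1))%R.
  rewrite spow_norm //; apply: ler_powR2 => //; first lra.
  by have := vM x; have := vM y; rewrite ler_norml; lra.
pose a (x : V) := spow m (v x - v (x + h)%R).
have ma : measurable_fun setT a by apply: measurable_spow; apply: measurable_funB.
pose b (x : V) := spow m (v x - v (x - h)%R).
have mb : measurable_fun setT b by apply: measurable_spow; apply: measurable_funB.
have iph : mu.-integrable setT (fun x : V => (phi (x + h)%R)%:E).
  move/integrableP : ip => [_ ip]; apply/integrableP; split.
    exact/measurable_EFinP.
  rewrite (@integral_rV_translate _ _ h (fun x => `|(phi x)%:E|)) //.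
  by apply: measurableT_comp => //; exact/measurable_EFinP.
have i1 := integrable_bounded_mul ma (fun x => sb x (x + h)%R) ip.
have i2 := integrable_bounded_mul ma (fun x => sb x (x + h)%R) iph.
have i3 := integrable_bounded_mul mb (fun x => sb x (x - h)%R) ip.
set kh := ker (n%:R + s * m) h.
have E x : form_density s m v phi (x, x + h)%R =
  (kh * (a x * phi x - a x * phi (x + h)))%R.
  rewrite /form_density /= (_ : x - (x + h) = - h)%R; last first.
    by rewrite opprD addrA subrr add0r.
  by rewrite kerN /a -/kh; ring.
under eq_integral do rewrite E EFinM.
rewrite integralZl //; last first.
  by under eq_fun do rewrite EFinB; exact: integrableB.
under eq_integral do rewrite EFinB.
rewrite integralB //.
have -> : \int[mu]_x (a x * phi (x + h))%:E = - \int[mu]_x (b x * phi x)%:E.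
  rewrite -(@integral_rV_translate_signed _ _ (- h)%R (fun x => (a x * phi (x + h)%R)%:E)); last first.
    by apply/measurable_EFinP; exact: measurable_funM.
  rewrite -integralN /=; last first.
    by apply: integrable_add_def.
  apply: eq_integral => x _; rewrite subrK /=; congr EFin.
  by rewrite /a /b subrK -[in LHS]opprB spowN mulNr.
rewrite oppeK -integralD //.
apply: (@le_trans _ _ (kh%:E * \int[mu]_x ((40 * m * 17 `^ m * M `^ (m - 1) * kmin m r h)%:E * (phi x)%:E))).
  rewrite lee_wpmul2l ?lee_fin ?ker_ge0 //.
  apply: le_integral_signed.
  - by apply: emeasurable_funD; apply/measurable_EFinP; exact: measurable_funM.
  - apply: emeasurable_funM => //; exact/measurable_EFinP.
  - move=> x; rewrite -EFinD -EFinM lee_fin -mulrDl.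
    have [px|px] := eqVneq (phi x) 0%R; first by rewrite px !mulr0.
    apply: ler_wpM2r => //.
    apply: barrier_second_difference => //; apply: pb.
    by rewrite lt_def px p0.
rewrite integralZl // muleA -EFinM; apply: lee_wpmul2r.
  by apply: integral_ge0 => x _; rewrite lee_fin.
by rewrite lee_fin le_eqVlt; apply/orP; left; apply/eqP; rewrite /kh; ring.
Qed.

(** Fubini in the variables x and h = y - x, [increment_shift_le] for each h, and
    the integral of the truncated kernel.  The finite energies make the form
    absolutely convergent, so that Fubini applies although the integrand has no
    sign. *)
Lemma form_barrier_le s m : (2 <= m)%R -> (0 < s)%R -> (s < 1)%R ->
  exists C : R, (0 < C)%R /\ forall r M (phi : V -> R) B,
  (0 < r)%R -> (0 <= M)%R ->
  measurable_fun setT phi -> (forall x, 0 <= phi x)%R ->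
  (forall x, phi x <= B)%R -> (forall x, 0 < phi x -> 0 < barrier r x)%R ->
  energy s m phi < +oo ->
  \int[mu \x mu]_z (form_density s m (fun x => M * barrier r x)%R phi z)%:E
  <= (C * M `^ (m - 1) * r `^ (- (s * m)))%:E * \int[mu]_x (phi x)%:E.
Proof.
move=> m2 s0 s1; have m0 : (0 < m)%R by lra.
have [C [C0 HC]] := @ker_integral R n m (s * m) (mulr_gt0 s0 m0)
   (ltac:(by rewrite gtr_pMl)).
exists (40 * m * 17 `^ m * C)%R; split.
  by rewrite !mulr_gt0 ?powR_gt0.
move=> r M phi B r0 M0 mp p0 pB pb ep.
pose v (x : V) := (M * barrier r x)%R.
have mv : measurable_fun setT v.
  by apply: measurable_funM => //; exact: measurable_barrier.
pose G z := (form_density s m v phi z)%:E.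
have iG : (mu \x mu).-integrable setT G.
  exact: (integrable_form_density m2 mv mp (@energy_barrier R n s m r M s0 s1 m0 r0 M0) ep).
have mG := measurable_int _ iG.
pose Gs (z : V * V) := G (z.1, z.1 + z.2)%R.
have mGs : measurable_fun setT Gs.
  apply: measurableT_comp => //; apply: measurable_fun_pair => //.
  exact: measurable_rV_fun_add.
have iGs : (mu \x mu).-integrable setT Gs.
  apply/integrableP; split => //.
  rewrite (@integral_diff_variable _ _ (fun z => `|G z|)) //.
    by move/integrableP : iG => [].
  exact: (measurableT_comp (@abse_measurable R setT) mG).
have Eq : \int[mu \x mu]_z G z = \int[mu]_h fubini_G mu Gs h.
  rewrite (integral21_prod_meas1 iGs).
  exact: (esym (integral_diff_variable_signed mG)).
rewrite [leLHS]Eq {Eq}.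
have I0 : 0 <= \int[mu]_x (phi x)%:E by apply: integral_ge0 => x _; rewrite lee_fin.
have ip : mu.-integrable setT (EFin \o phi).
  apply: (@integrable_bounded _ B (8 / 25 * r)%R) => // x xr.
  apply/eqP; rewrite eq_le p0 andbT leNgt; apply/negP => /pb.
  by rewrite barrier_eq0 // ltxx.
have Ifin : \int[mu]_x (phi x)%:E \is a fin_num by exact: integrable_fin_num.
pose kk (h : V) := (kmin m r h * ker (n%:R + s * m) h)%R.
have mk : measurable_fun setT kk.
  by apply: measurable_funM; [exact: measurable_kmin|exact: measurable_ker].
pose c := (40 * m * 17 `^ m * M `^ (m - 1) : R)%R.
have c0 : (0 <= c)%R by rewrite !mulr_ge0 ?powR_ge0 //; lra.
apply: (@le_trans _ _ (\int[mu]_h ((c * fine (\int[mu]_x (phi x)%:E))%:E * (kk h)%:E))).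
  apply: le_integral_signed.
  - exact: (measurable_fubini_G iGs).
  - by apply: emeasurable_funM => //; exact/measurable_EFinP.
  - move=> h; apply: (le_trans (increment_shift_le s h m2 r0 M0 mp p0 pB pb)).
    by rewrite -[X in _ * X](fineK Ifin) -!EFinM lee_fin /kk -/c; lra.
rewrite ge0_integralZl_EFin //; last 3 first.
- by move=> h _; rewrite lee_fin mulr_ge0 ?kmin_ge0 ?ker_ge0.
- exact/measurable_EFinP.
- by rewrite mulr_ge0 // fine_ge0.
apply: (@le_trans _ _ ((c * fine (\int[mu]_x (phi x)%:E))%:E * (C * r `^ (- (s * m)))%:E)).
  by apply: lee_wpmul2l; [rewrite lee_fin mulr_ge0 // fine_ge0|exact: HC].
rewrite -[X in _ <= _ * X](fineK Ifin) -!EFinM lee_fin.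
by rewrite le_eqVlt; apply/orP; left; apply/eqP; rewrite /c; ring.
Qed.

End form_barrier.

(** * Smooth bumps on the line *)

Section quadratic_remainder.
Context {R : realType} {V : normedModType R}.

(** A quadratic remainder in place of a limit: such a bound passes through an
    integral by linearity, and so lets one differentiate under the integral
    sign. *)
Lemma is_derive_quadratic (f : V -> R) (a v : V) (l C : R) :
  (forall h : R, `|f (h *: v + a) - f a - h * l| <= C * h ^+ 2) ->
  is_derive a v f l.
Proof.
move=> H.
have C0 : 0 <= C.
  by have := H 1; rewrite expr1n mulr1; apply: le_trans.
have cv : (fun h : R => h^-1 *: ((f \o shift a) (h *: v) - f a)) @ 0^' --> l.
  apply/cvgrPdist_le => e e0; near=> h.
  have h0 : h != 0 by near: h; exact: nbhs_dnbhs_neq.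
  have -> : l - h^-1 *: ((f \o shift a) (h *: v) - f a) =
            - (h^-1 * (f (h *: v + a) - f a - h * l)).
    by rewrite /= /GRing.scale /=; field.
  rewrite normrN normrM normfV ler_pdivrMl ?normr_gt0 //.
  apply: (le_trans (H h)); rewrite -normr_id -(real_normK (num_real h)) expr2 mulrA.
  rewrite normr_id mulrC ler_wpM2l //.
  have : `|h| <= e / (C + 1).
    near: h; apply: dnbhs0_le; rewrite divr_gt0 // ltr_wpDl //.
  rewrite ler_pdivlMr ?ltr_wpDl // mulrDr mulr1 mulrC => h1.
  by have := normr_ge0 h; lra.
split; first by apply/cvg_ex; exists l.
exact/cvg_lim.
Unshelve. all: by end_near. Qed.

End quadratic_remainder.

Section smooth_line.
Context {R : realType}.

(** k-fold differentiability, as a chain of explicit derivatives; continuity of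
    all but the last one is implied. *)
Fixpoint Ck (k : nat) (f : R -> R) : Prop :=
  if k is k'.+1 then exists2 g : R -> R, (forall x : R, is_derive x (1 : R) f (g x)) & Ck k' g
  else True.

Lemma CkS k f : Ck k.+1 f -> Ck k f.
Proof.
elim: k f => // k IH f [g fg gk]; exists g => //; exact: IH.
Qed.

Lemma CkD k f g : Ck k f -> Ck k g -> Ck k (fun x => f x + g x).
Proof.
elim: k f g => // k IH f g [f' ff' kf'] [g' gg' kg'].
by exists (fun x => f' x + g' x); [move=> x; exact: is_deriveD|exact: IH].
Qed.

Lemma CkZ k c f : Ck k f -> Ck k (fun x => c * f x).
Proof.
elim: k f => // k IH f [f' ff' kf'].
by exists (fun x => c * f' x); [move=> x; exact: is_deriveZ|exact: IH].
Qed.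

Lemma CkM k f g : Ck k f -> Ck k g -> Ck k (fun x => f x * g x).
Proof.
elim: k f g => // k IH f g /[dup] kf [f' ff' kf'] /[dup] kg [g' gg' kg'].
exists (fun x => f x * g' x + g x * f' x); first by move=> x; exact: is_deriveM.
by apply: CkD; apply: IH => //; exact: CkS.
Qed.

Lemma Ck_affine k c d f : Ck k f -> Ck k (fun x => f (c * x + d)).
Proof.
elim: k f => // k IH f [f' ff' kf'].
exists (fun x => c * f' (c * x + d)); last by apply: CkZ; exact: IH.
move=> x; rewrite mulrC.
apply: (@is_derive1_comp _ f (fun x => c * x + d) x (f' (c * x + d)) c (ff' _)).
have := is_deriveD (is_deriveZ c (@is_derive_id R R x 1)) (is_derive_cst d x 1).
by rewrite addr0 /GRing.scale /= mulr1.
Qed.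

(** The functions exp (- 1 / t) / t^j, extended by 0: differentiation maps this
    family into its linear span, which is what makes all of them smooth. *)
Definition flat (j : nat) (t : R) : R :=
  if 0 < t then t^-1 ^+ j * expR (- t^-1) else 0.

Lemma flat_ge0 j t : 0 <= flat j t.
Proof.
rewrite /flat; case: ifPn => // t0.
by rewrite mulr_ge0 ?expR_ge0 // exprn_ge0 // invr_ge0 ltW.
Qed.

(** This gives the derivative 0 at the origin, by [is_derive_quadratic]. *)
Lemma flat_quadratic j t : flat j t <= (j.+2)`!%:R * t ^+ 2.
Proof.
rewrite /flat; case: ifPn => t0; last by rewrite mulr_ge0 ?sqr_ge0.
have ti : 0 < t^-1 by rewrite invr_gt0.
have := @expR_ge1Dxn R t^-1 j.+1 (ltW ti).
have F0 : (0 : R) < (j.+2)`!%:R by rewrite ltr0n fact_gt0.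
move=> H; have {}H : t^-1 ^+ j.+2 / (j.+2)`!%:R <= expR t^-1 by lra.
rewrite expRN ler_pdivrMr ?expR_gt0 //.
apply: (@le_trans _ _ ((j.+2)`!%:R * t ^+ 2 * (t^-1 ^+ j.+2 / (j.+2)`!%:R))); last first.
  by apply: ler_wpM2l => //; rewrite mulr_ge0 ?sqr_ge0.
rewrite le_eqVlt; apply/orP; left; apply/eqP.
rewrite (exprD _ 2 j) !expr2; field.
by rewrite !gt_eqF.
Qed.

Lemma is_derive_flat j (x : R) : is_derive x (1 : R) (flat j) (flat j.+2 x - j%:R * flat j.+1 x).
Proof.
have [x0|x0|x0] := ltgtP x 0.
- rewrite {2 3}/flat ltNge (ltW x0) /= mulr0 subrr.
  apply: (@near_eq_is_derive _ _ _ (cst 0)).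
  near=> y; rewrite /flat ltNge (_ : y <= 0) //=.
  by apply: ltW; near: y; exact: lt_nbhsl.
- rewrite {2 3}/flat x0.
  have xn0 : x != 0 by rewrite gt_eqF.
  have dV : is_derive x (1 : R) (fun y : R => y^-1) (- x ^- 2).
    by have := @is_deriveV R id x 1 1 xn0 (is_derive_id _ _); rewrite /GRing.scale /= mulr1.
  have dE : is_derive x (1 : R) (fun y : R => expR (- y^-1)) (expR (- x^-1) * x ^- 2).
    apply: (@is_derive1_comp _ expR (fun y => - y^-1)).
    by rewrite -[X in is_derive _ _ _ X]opprK; exact: is_deriveN.
  have dX := is_deriveX j dV.
  have D : is_derive x (1 : R) (fun t => t^-1 ^+ j * expR (- t^-1))
     (x^-1 ^+ j.+2 * expR (- x^-1) - j%:R * (x^-1 ^+ j.+1 * expR (- x^-1))).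
    have := is_deriveM dX dE.
    rewrite exprfctE => H; apply: is_derive_eq.
    rewrite /GRing.scale /=; clear.
    case: j => [|j].
      by rewrite -!exprVn; ring.
    by rewrite -!exprVn /= !exprS; ring.
  apply: (near_eq_is_derive _ D).
  near=> y; rewrite /flat ifT //; near: y; exact: lt_nbhsr.
- rewrite x0 {2 3}/flat ltxx mulr0 subrr.
  apply: (@is_derive_quadratic _ _ _ _ _ _ (j.+2)`!%:R) => h.
  rewrite /GRing.scale /= mulr1 addr0 mulr0 subr0 {2}/flat ltxx subr0.
  by rewrite ger0_norm ?flat_ge0 // flat_quadratic.
Unshelve. all: by end_near. Qed.

Lemma Ck_flat k j : Ck k (flat j).
Proof.
elim: k j => // k IH j.
exists (fun x => flat j.+2 x - j%:R * flat j.+1 x); first exact: is_derive_flat.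
have := CkD (IH j.+2) (CkZ (- j%:R) (IH j.+1)).
by under eq_fun do rewrite mulNr.
Qed.

Lemma Ck_derive1 k f : Ck k.+1 f -> Ck k (f^`()%classic).
Proof.
move=> [g fg kg]; rewrite (_ : f^`()%classic = g) //.
by apply/funext => x; rewrite derive1E; have [_ ->] := fg x.
Qed.

(** The arguments are written as affine functions so that smoothness follows from
    [Ck_affine]. *)
Definition bump (t : R) : R := flat 0 (1 * t + 1) * flat 0 ((- 1) * t + 1).

Definition dbump (k : nat) : R -> R := iter k (fun f : R -> R => f^`()%classic) bump.

Lemma Ck_dbump k j : Ck k (dbump j).
Proof.
elim: j k => [|j IH] k; last by apply: Ck_derive1; exact: IH.
by apply: CkM; apply: Ck_affine; exact: Ck_flat.
Qed.

Lemma is_derive_dbump k (x : R) : is_derive x (1 : R) (dbump k) (dbump k.+1 x).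
Proof.
have [g fg _] := Ck_dbump 1 k.
rewrite /dbump /= derive1E; have [d _] := fg x.
by split.
Qed.

Lemma bump_ge0 t : 0 <= bump t.
Proof. by rewrite mulr_ge0 ?flat_ge0. Qed.

Lemma bumpN t : bump (- t) = bump t.
Proof. by rewrite /bump mulrC; congr (flat 0 _ * flat 0 _); ring. Qed.

Lemma bump0_gt0 : 0 < bump 0.
Proof. by rewrite /bump !mulr0 add0r /flat ltr01 mulr_gt0 // mulr_gt0 ?expR_gt0 // exprn_gt0 // invr_gt0. Qed.

Lemma dbump_out k t : 1 < `|t| -> dbump k t = 0.
Proof.
elim: k t => [|k IH] t t1.
  rewrite /dbump /= /bump /flat; move: t1; rewrite lter_normr => /orP[t1|t1].
    by rewrite [X in _ * (if X then _ else _)](_ : _ = false) ?mulr0 //; apply/negbTE; rewrite -leNgt; lra.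
  by rewrite [X in (if X then _ else _) * _](_ : _ = false) ?mul0r //; apply/negbTE; rewrite -leNgt; lra.
rewrite /dbump /= -/(dbump k) derive1E.
rewrite (@near_eq_derive _ _ _ _ (cst 0)) ?derive_cst //.
near=> y; apply: IH; near: y.
have := cvgr_gt _ (@norm_continuous _ R t).
by move=> /(_ _ 1 t1); apply.
Unshelve. all: by end_near. Qed.

Lemma dbump_continuous k : continuous (dbump k).
Proof.
move=> x; apply/differentiable_continuous/derivable1_diffP.
by have [] := is_derive_dbump k x.
Qed.

Lemma dbump_bounded k : exists2 B, 0 <= B & forall t, `|dbump k t| <= B.
Proof.
have cf : {within `[-1, 1], continuous (fun t => `|dbump k t|)}.
  apply: continuous_subspaceT => x; apply: continuous_comp; first exact: dbump_continuous.
  exact: norm_continuous.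
have le11 : (-1 : R) <= 1 by lra.
have [c _ hc] := EVT_max le11 cf.
exists `|dbump k c| => // t.
have [t1|t1] := leP `|t| 1; last by rewrite dbump_out // normr0.
by apply: hc; rewrite in_itv /= -ler_norml.
Qed.

Lemma mean_value (f df : R -> R) (B a b : R) :
  (forall x : R, is_derive x (1 : R) f (df x)) -> (forall x, `|df x| <= B) ->
  `|f b - f a| <= B * `|b - a|.
Proof.
move=> fd dB; wlog ab : a b / a <= b.
  move=> H; case: (leP a b) => [|/ltW] h; first exact: H.
  by rewrite distrC (distrC b); exact: H.
have cf : {within `[a, b], continuous f}.
  apply: continuous_subspaceT => x; apply/differentiable_continuous/derivable1_diffP.
  by have [] := fd x.
have [c _ ->] := MVT_segment ab (fun x _ => fd x) cf.
by rewrite normrM ler_wpM2r.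
Qed.

Lemma dbump_lipschitz k : exists2 B, 0 <= B &
  forall a b, `|dbump k b - dbump k a| <= B * `|b - a|.
Proof.
have [B B0 HB] := dbump_bounded k.+1; exists B => // a b.
exact: (mean_value a b (is_derive_dbump k) HB).
Qed.

(** The remainder has derivative h times an increment of the next derivative,
    which is Lipschitz. *)
Lemma dbump_taylor k : exists2 B, 0 <= B &
  forall a h, `|dbump k (a + h) - dbump k a - h * dbump k.+1 a| <= B * h ^+ 2.
Proof.
have [B B0 HB] := dbump_lipschitz k.+1; exists B => // a h.
pose g t := dbump k (a + t * h) - t * (h * dbump k.+1 a).
pose dg t := h * (dbump k.+1 (a + t * h) - dbump k.+1 a).
have gd (x : R) : is_derive x (1 : R) g (dg x).
  have D1 : is_derive x (1 : R) (fun t => dbump k (a + t * h)) (dbump k.+1 (a + x * h) * h).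
    apply: (@is_derive1_comp _ (dbump k) (fun t => a + t * h)); first exact: is_derive_dbump.
    have := is_deriveD (is_derive_cst a x 1) (is_deriveZ h (@is_derive_id R R x 1)).
    rewrite add0r /GRing.scale /= mulr1.
    by congr (is_derive _ _ _ _); apply/funext => t /=; rewrite [RHS]/= ?[t * _]mulrC.
  have D2 : is_derive x (1 : R) (fun t => t * (h * dbump k.+1 a)) (h * dbump k.+1 a).
    have := is_deriveZ (h * dbump k.+1 a) (@is_derive_id R R x 1).
    rewrite /GRing.scale /= mulr1.
    by congr (is_derive _ _ _ _); apply/funext => t /=; rewrite [RHS]/= ?[t * _]mulrC.
  have := is_deriveB D1 D2; rewrite (_ : dg x = dbump k.+1 (a + x * h) * h - h * dbump k.+1 a) //.
  by rewrite /dg; ring.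
have cg : {within `[0, 1], continuous g}.
  apply: continuous_subspaceT => x; apply/differentiable_continuous/derivable1_diffP.
  by have [] := gd x.
have [c] := MVT_segment ler01 (fun x _ => gd x) cg.
rewrite in_itv /= => /andP[c0 c1].
rewrite /g !mul0r !mul1r addr0 !subr0 mulr1 addrAC => ->.
rewrite /dg normrM; apply: (@le_trans _ _ (`|h| * (B * `|a + c * h - a|))).
  by rewrite ler_wpM2l.
rewrite addrC addKr normrM (ger0_norm c0) -(real_normK (num_real h)) expr2.
by rewrite mulrCA; apply: ler_wpM2l => //; rewrite mulrCA ler_piMl ?mulr_ge0.
Qed.

End smooth_line.

(** * Smooth convolutions *)

Section product_bump.
Context {R : realType} {n : nat}.
Local Notation V := 'rV[R]_n.
Local Notation mu := (lebesgue_rV R n).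
Implicit Types (k : 'I_n -> nat) (e : R) (x y : V).

(** Up to a power of e, the derivative of order k of the product bump at scale
    e.  Treating all derivatives at once makes the family closed under partial
    differentiation. *)
Definition mol k e x : R := \prod_(i < n) dbump (k i) (x ord0 i / e).

(** Bounded Lipschitz functions are stable under products. *)
Lemma mol_seq_bounds k e (s : seq 'I_n) : 0 < e ->
  exists B C : R, [/\ 0 <= B, 0 <= C,
    forall x, `|\prod_(i <- s) dbump (k i) (x ord0 i / e)| <= B &
    forall x y, `|\prod_(i <- s) dbump (k i) (x ord0 i / e) -
                  \prod_(i <- s) dbump (k i) (y ord0 i / e)| <= C * `|x - y|].
Proof.
move=> e0; elim: s => [|i s [B [C [B0 C0 HB HC]]]].
  exists 1, 0; split => // x; first by rewrite big_nil normr1.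
  by move=> y; rewrite !big_nil subrr normr0 mul0r.
have [b b0 Hb] := @dbump_bounded R (k i).
have [c c0 Hc] := @dbump_lipschitz R (k i).
exists (b * B), (b * C + c * e^-1 * B); split.
- exact: mulr_ge0.
- by rewrite addr_ge0 ?mulr_ge0 // invr_ge0 ltW.
- by move=> x; rewrite big_cons normrM ler_pM.
move=> x y; rewrite !big_cons.
set a := dbump _ _; set a' := dbump _ _; set p := bigop _ _ _; set p' := bigop _ _ _.
have -> : a * p - a' * p' = a * (p - p') + (a - a') * p' by ring.
apply: (le_trans (ler_normD _ _)); rewrite !normrM mulrDl.
apply: lerD.
  by rewrite -mulrA; apply: ler_pM; [exact: normr_ge0|exact: normr_ge0|exact: Hb|exact: HC].
rewrite -[leRHS]mulrA [B * _]mulrC [leRHS]mulrA.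
apply: ler_pM; [exact: normr_ge0|exact: normr_ge0| |exact: HB].
apply: (le_trans (Hc _ _)); rewrite -mulrA ler_wpM2l //.
rewrite -mulrBl normrM mulrC (ger0_norm (_ : 0 <= e^-1)) ?invr_ge0 ?(ltW e0) //.
apply: ler_wpM2l; first by rewrite invr_ge0 ltW.
have -> : x ord0 i - y ord0 i = (x - y) ord0 i by rewrite !mxE.
exact: coord_le_norm.
Qed.

Lemma mol_bounded k e : 0 < e -> exists2 B, 0 <= B & forall x, `|mol k e x| <= B.
Proof.
by move=> e0; have [B [C [B0 _ HB _]]] := mol_seq_bounds k (index_enum 'I_n) e0; exists B.
Qed.

Lemma mol_lipschitz k e : 0 < e ->
  exists2 C, 0 <= C & forall x y, `|mol k e x - mol k e y| <= C * `|x - y|.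
Proof.
by move=> e0; have [B [C [_ C0 _ HC]]] := mol_seq_bounds k (index_enum 'I_n) e0; exists C.
Qed.

Definition incr k (i : 'I_n) : 'I_n -> nat := fun j => if j == i then (k j).+1 else k j.

Lemma mol_taylor k e i : 0 < e -> exists2 C, 0 <= C & forall x (h : R),
  `|mol k e (h *: delta_mx ord0 i + x) - mol k e x - h * (e^-1 * mol (incr k i) e x)|
  <= C * h ^+ 2.
Proof.
move=> e0.
have [B [_ [B0 _ HB _]]] := mol_seq_bounds k [seq j <- index_enum 'I_n | j != i] e0.
have [c c0 Hc] := @dbump_taylor R (k i).
exists (c * e^-1 ^+ 2 * B); first by rewrite !mulr_ge0 // invr_ge0 ltW.
have S k' (y : V) : mol k' e y = dbump (k' i) (y ord0 i / e) *
    \prod_(j < n | j != i) dbump (k' j) (y ord0 j / e).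
  by rewrite /mol (bigD1 i).
move=> x h; rewrite !S /incr eqxx.
have -> : \prod_(j < n | j != i) dbump (k j) ((h *: delta_mx ord0 i + x) ord0 j / e) =
   \prod_(j < n | j != i) dbump (k j) (x ord0 j / e).
  by apply: eq_bigr => j ji; rewrite !mxE (negbTE ji) andbF mulr0 add0r.
have -> : \prod_(j < n | j != i) dbump (if j == i then (k j).+1 else k j) (x ord0 j / e) =
   \prod_(j < n | j != i) dbump (k j) (x ord0 j / e).
  by apply: eq_bigr => j ji; rewrite (negbTE ji).
have := HB x; rewrite big_filter; set P := bigop _ _ _ => PB.
rewrite !mxE !eqxx mulr1 mulrDl [h / e + _]addrC.
have -> : dbump (k i) (x ord0 i / e + h / e) * P - dbump (k i) (x ord0 i / e) * P -
   h * (e^-1 * (dbump (k i).+1 (x ord0 i / e) * P)) =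
  (dbump (k i) (x ord0 i / e + h / e) - dbump (k i) (x ord0 i / e) -
   h / e * dbump (k i).+1 (x ord0 i / e)) * P by ring.
rewrite normrM (_ : c * e^-1 ^+ 2 * B * h ^+ 2 = c * (h / e) ^+ 2 * B); last first.
  by rewrite exprMn; ring.
by apply: ler_pM.
Qed.

Lemma measurable_mol k e : measurable_fun setT (mol k e).
Proof.
apply: measurable_prod => i _.
have mc : measurable_fun setT (dbump (k i) : R -> R).
  by apply: continuous_measurable_fun; exact: dbump_continuous.
apply: (measurableT_comp mc); apply: measurable_funM => //.
exact: measurable_rV_coord.
Qed.

(** The product bump at scale e is supported in a cube, hence in the Euclidean
    ball of radius [spread * e]. *)
Definition spread : R := Num.sqrt n%:R + 1.

Lemma spread_gt0 : 0 < spread.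
Proof. by rewrite /spread ltr_wpDl ?sqrtr_ge0. Qed.

Lemma mol_out k e x : 0 < e -> spread * e <= enorm x -> mol k e x = 0.
Proof.
move=> e0 h.
suff [i hi] : exists i : 'I_n, e < `|x ord0 i|.
  rewrite /mol (bigD1 i) //= dbump_out ?mul0r // normrM (ger0_norm (_ : 0 <= e^-1)).
    by rewrite ltr_pdivlMr // mul1r.
  by rewrite invr_ge0 ltW.
apply: contrapT => /forallNP H.
have : enorm x <= Num.sqrt n%:R * e.
  apply: enorm_le_max; first exact: ltW.
  by move=> i; rewrite leNgt; apply/negP; exact: H.
move: h; rewrite /spread mulrDl mul1r; lra.
Qed.

Lemma mol0_ge0 e x : 0 <= mol (fun=> 0%N) e x.
Proof. by apply: prodr_ge0 => i _; exact: bump_ge0. Qed.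

Lemma mol0N e x : mol (fun=> 0%N) e (- x) = mol (fun=> 0%N) e x.
Proof.
by apply: eq_bigr => i _; rewrite mxE mulNr; exact: bumpN.
Qed.

End product_bump.

Section smooth_convolution.
Context {R : realType} {n : nat}.
Local Notation V := 'rV[R]_n.
Local Notation mu := (lebesgue_rV R n).
Implicit Types (k : 'I_n -> nat) (e : R) (x y : V).
Variables (phi : V -> R) (Bphi a : R).
Hypotheses (mphi : measurable_fun setT phi) (phi0 : forall x, 0 <= phi x).
Hypothesis phiB : forall x, phi x <= Bphi.
Hypothesis phia : forall x, a <= enorm x -> phi x = 0.

Let iphi : mu.-integrable setT (EFin \o phi).
Proof. exact: (integrable_bounded mphi phi0 phiB phia). Qed.

Let Iphi : R := \int[mu]_x phi x.

Let Iphi0 : 0 <= Iphi.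
Proof. by apply: Rintegral_ge0 => x _; exact: phi0. Qed.

Lemma norm_Rintegral_mul_le (g : V -> R) c : measurable_fun setT g ->
  (forall x, `|g x| <= c) -> `|\int[mu]_x (g x * phi x)| <= c * Iphi.
Proof.
move=> mg gc; have ig := integrable_bounded_mul mg gc iphi.
apply: (le_trans (le_normr_Rintegral measurableT ig)).
rewrite /Iphi -RintegralZl //; apply: le_Rintegral => //.
- apply/integrable_norm => //.
- exact: (integrableZl measurableT c iphi).
- by move=> x _; rewrite normrM (ger0_norm (phi0 x)) ler_wpM2r.
Qed.

Definition conv k e x : R := \int[mu]_y (mol k e (x - y) * phi y).

Let mmol k e x : measurable_fun setT (fun y : V => mol k e (x - y)).
Proof.
by apply: (measurableT_comp (measurable_mol k e)); exact: measurable_rV_fun_sub.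
Qed.

Let imol k e x : 0 < e ->
  mu.-integrable setT (fun y : V => (mol k e (x - y) * phi y)%:E).
Proof.
move=> e0; have [B _ HB] := mol_bounded k e0.
by apply: (integrable_bounded_mul (mmol k e x) _ iphi) => y; exact: HB.
Qed.

Lemma conv_continuous k e : 0 < e -> continuous (conv k e).
Proof.
move=> e0; have [C C0 HC] := mol_lipschitz k e0.
have L x y : `|conv k e x - conv k e y| <= C * Iphi * `|x - y|.
  rewrite /conv -RintegralB ?imol //.
  under eq_Rintegral do rewrite -mulrBl.
  rewrite mulrAC; apply: norm_Rintegral_mul_le.
    by apply: measurable_funB; exact: mmol.
  move=> z; apply: (le_trans (HC _ _)).
  by rewrite (_ : x - z - (y - z) = x - y) // opprB addrA subrK.
move=> x; apply/(@cvgrPdist_le _ _ _ _ (@nbhs_filter V x)) => d d0.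
have c0 : 0 < C * Iphi + 1 by rewrite ltr_wpDl // mulr_ge0.
apply/(@nbhs_normP R V x); exists (d / (C * Iphi + 1)); first exact: divr_gt0.
move=> y /= xy; apply: (le_trans (L x y)).
rewrite ltr_pdivlMr // in xy; apply: le_trans (ltW xy).
by rewrite mulrC ler_wpM2l // lerDl.
Qed.

(** The quadratic Taylor remainder of the bump, integrated against phi, is a
    quadratic remainder of the convolution. *)
Lemma is_derive_conv k e i x : 0 < e ->
  is_derive x (delta_mx ord0 i) (conv k e) (e^-1 * conv (incr k i) e x).
Proof.
move=> e0; have [C C0 HC] := mol_taylor k i e0.
apply: (@is_derive_quadratic _ _ _ _ _ _ (C * Iphi)) => h.
rewrite /conv -RintegralB ?imol // -RintegralZl ?imol // -RintegralZl //; last first.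
  exact: (integrableZl measurableT e^-1 (imol (incr k i) x e0)).
rewrite -RintegralB //; last 2 first.
- exact: (integrableB measurableT (imol k (h *: delta_mx ord0 i + x) e0) (imol k x e0)).
- exact: (integrableZl measurableT h
    (integrableZl measurableT e^-1 (imol (incr k i) x e0))).
rewrite mulrAC.
rewrite (_ : (\int[mu]_x0 _) = \int[mu]_y ((mol k e (h *: delta_mx ord0 i + (x - y)) -
   mol k e (x - y) - h * (e^-1 * mol (incr k i) e (x - y))) * phi y)); last first.
  by apply: eq_Rintegral => y _; rewrite addrA; ring.
apply: norm_Rintegral_mul_le; last by move=> y; exact: HC.
apply: measurable_funB; first apply: measurable_funB.
- under eq_fun do rewrite addrA; exact: mmol.
- exact: mmol.
- by apply: measurable_funM => //; apply: measurable_funM => //; exact: mmol.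
Qed.

Lemma iter_partial_conv k e (l : seq 'I_n) : 0 < e -> exists c k',
  iter_partial l (conv k e) = (fun x => c * conv k' e x).
Proof.
move=> e0; elim: l => [|i l [c [k' /= ->]]].
  by exists 1, k; apply/funext => x; rewrite mul1r.
exists (c * e^-1), (incr k' i); apply/funext => x.
have := is_deriveZ c (is_derive_conv k' i x e0).
by move=> [_]; rewrite /GRing.scale /= mulrA.
Qed.

Lemma smooth_conv k e : 0 < e -> smooth (conv k e).
Proof.
move=> e0 l; have [c [k' ->]] := iter_partial_conv k l e0; split.
  by move=> x; apply: (@cvgM _ _ _ (nbhs_filter x) (cst c)); [exact: cvg_cst|exact: conv_continuous].
move=> i x; have [d _] := is_deriveZ c (is_derive_conv k' i x e0).
exact: d.
Qed.

Lemma conv_out k e x : 0 < e -> a + spread (n := n) * e <= enorm x -> conv k e x = 0.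
Proof.
move=> e0 h; rewrite /conv (_ : (fun y => _) = cst 0).
  by rewrite Rintegral_cst // mul0r.
apply/funext => y /=.
have [ya|ya] := leP a (enorm y); first by rewrite phia // mulr0.
rewrite mol_out ?mul0r //.
have := enorm_triangle x y; lra.
Qed.

Lemma Cc_infty_conv k e b : 0 < e -> a + spread (n := n) * e < b ->
  Cc_infty (eball b) (conv k e).
Proof.
move=> e0 ab; split; first exact: smooth_conv.
exists [set x | enorm x <= a + spread (n := n) * e]; split.
- apply: bounded_closed_compact.
    exists `|a + spread (n := n) * e|; split; first exact: num_real.
    move=> M hM x /= hx.
    have := norm_le_enorm x; have := ler_norm (a + spread (n := n) * e); lra.
  rewrite (_ : [set x | _] = @enorm R n @^-1` [set t | t <= a + spread (n := n) * e]) //.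
  apply: preimage_closed; [|exact: closed_le].
  by move=> x _; exact: enorm_continuous.
- by move=> x /= hx; exact: le_lt_trans hx ab.
- move=> x /= /negP; rewrite -ltNge => hx; apply: conv_out => //; exact: ltW.
Qed.

End smooth_convolution.

(** * Averages and mollifiers *)

Section averaging.
Context {R : realType} {n : nat}.
Local Notation V := 'rV[R]_n.
Local Notation mu := (lebesgue_rV R n).
Variables (eta F : V -> R) (B m : R).
Hypotheses (m1 : 1 <= m) (mF : measurable_fun setT F).
Hypotheses (eta0 : forall x, 0 <= eta x) (ieta : mu.-integrable setT (EFin \o eta)).
Hypotheses (eta1 : \int[mu]_x eta x = 1) (FB : forall x, `|F x| <= B).

(** Jensen's inequality up to the constant 2^m.  The inequality [powR_cut] with l
    half of the average A of |F| is integrated against eta. *)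
Lemma average_powR_le :
  ((`|\int[mu]_h (F h * eta h)| `^ m)%:E <=
   (2 `^ m)%:E * \int[mu]_h (eta h * `|F h| `^ m)%:E)%E.
Proof.
have iF := integrable_bounded_mul mF FB ieta.
have mA : measurable_fun setT (fun x => `|F x|) by exact: measurableT_comp.
have AB x : `| `|F x| | <= B by rewrite normr_id.
have iA := integrable_bounded_mul mA AB ieta.
set A := \int[mu]_h (`|F h| * eta h).
have A0 : 0 <= A by apply: Rintegral_ge0 => x _; rewrite mulr_ge0.
have mP : measurable_fun setT (fun x => `|F x| `^ m).
  exact: (measurableT_comp (@measurable_powR R m)).
have PB x : `| `|F x| `^ m | <= B `^ m.
  rewrite ger0_norm ?powR_ge0 //; apply: ler_powR2 => //; exact: le_trans ler01 m1.
have iP := integrable_bounded_mul mP PB ieta.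
have h : A `^ m <= 2 `^ m * \int[mu]_h (`|F h| `^ m * eta h).
  set l := A / 2; have l0 : 0 <= l by rewrite divr_ge0.
  have El : A = 2 * l by rewrite /l mulrC divfK.
  have il := integrableZl measurableT (l `^ (m - 1)) iA.
  have ie := integrableZl measurableT (l `^ m) ieta.
  have : l `^ (m - 1) * A - l `^ m <= \int[mu]_h (`|F h| `^ m * eta h).
    have E1 : l `^ m = l `^ m * \int[mu]_x eta x by rewrite eta1 mulr1.
    rewrite [X in _ - X]E1 /A -!RintegralZl // -RintegralB //.
    apply: le_Rintegral => //; first exact: (integrableB measurableT il ie).
    move=> x _; rewrite mulrA -mulrBl; apply: ler_wpM2r => //.
    have m0 : 0 <= m - 1 by rewrite subr_ge0.
    by have := powR_cut m0 (normr_ge0 (F x)) l0; rewrite subrK.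
  rewrite El; set I := \int[mu]_h _ => hI.
  rewrite powRM // ler_wpM2l ?powR_ge0 //; apply: le_trans hI.
  rewrite mulrCA [_ * l]mulrC mulr_powRB1 ?(lt_le_trans ltr01 m1) //.
  by rewrite mulr_natl mulr2n addrK.
apply: (@le_trans _ _ (A `^ m)%:E).
  rewrite lee_fin; apply: ler_powR2 => //; first exact: le_trans ler01 m1.
  apply: (le_trans (le_normr_Rintegral measurableT iF)).
  rewrite le_eqVlt; apply/orP; left; apply/eqP; apply: eq_Rintegral => x _.
  by rewrite normrM (ger0_norm (eta0 x)).
apply: (le_trans (y := (2 `^ m * \int[mu]_h (`|F h| `^ m * eta h))%:E)).
  by rewrite lee_fin.
rewrite EFinM lee_wpmul2l ?lee_fin ?powR_ge0 // /Rintegral fineK.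
  by rewrite le_eqVlt; apply/orP; left; apply/eqP; apply: eq_integral => x _; rewrite mulrC.
exact: integrable_fin_num.
Qed.

End averaging.

Section mollifier.
Context {R : realType} {n : nat}.
Local Notation V := 'rV[R]_n.
Local Notation mu := (lebesgue_rV R n).
Local Notation mol0 := (@mol R n (fun=> 0%N)).

Lemma mol0_uniform : exists2 B : R, 0 <= B & forall e x, mol0 e x <= B.
Proof.
have [b b0 Hb] := @dbump_bounded R 0.
exists (b ^+ n); first exact: exprn_ge0.
move=> e x; rewrite -[n in b ^+ n]card_ord -prodr_const.
apply: ler_prod => i _; rewrite bump_ge0 /=.
exact: le_trans (ler_norm _) (Hb _).
Qed.

Lemma mol0_integrable e : 0 < e -> mu.-integrable setT (EFin \o mol0 e).
Proof.
move=> e0; have [B _ HB] := mol0_uniform.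
apply: (@integrable_bounded R n _ B (spread (R := R) (n := n) * e)).
- exact: measurable_mol.
- by move=> x; exact: mol0_ge0.
- by move=> x; exact: HB.
- by move=> x; exact: mol_out.
Qed.

Definition mass e : R := \int[mu]_x mol0 e x.

(** The bump stays above half of its central value on ]-d, d[, so the product
    bump is bounded below on a cube of side 2 d e. *)
Lemma mass_lower : exists2 c : R, 0 < c & forall e, 0 < e -> c * e ^+ n <= mass e.
Proof.
have b0 := @bump0_gt0 R.
have [d d0 Hd] : exists2 d : R, 0 < d & forall t, `|t| < d -> bump 0 / 2 <= bump t :> R.
  have := @dbump_continuous R 0 0.
  move=> /cvgrPdist_le /(_ (bump 0 / 2)) H.
  have {}H := H _; have : 0 < bump 0 / 2 :> R by rewrite divr_gt0.
  move=> /H /nbhs_normP [d d0 hd]; exists d => // t td.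
  have := hd t; rewrite /= sub0r normrN => /(_ td).
  rewrite /dbump /= ler_norml; lra.
exists ((bump 0 * d) ^+ n); first by rewrite exprn_gt0 // mulr_gt0.
move=> e e0.
have de0 : 0 <= d * e by rewrite mulr_ge0 ?ltW.
rewrite -lee_fin /mass /Rintegral fineK; last exact: integrable_fin_num (mol0_integrable e0).
set Q := [set x : V | forall i : 'I_n, `](- (d * e))%R, (d * e)[%classic (x ord0 i)].
have mQ : measurable Q by exact: (measurable_rV_box (measurable_itv `](- (d * e))%R, (d * e)[)).
apply: (@le_trans _ _ (\int[mu]_(x in Q) ((bump 0 / 2) ^+ n)%:E)%E).
  have muQ : mu Q = ((2 * (d * e)) ^+ n)%:E by exact: lebesgue_rV_cube.
  apply: (@le_trans _ _ (((bump 0 / 2) ^+ n)%:E * ((2 * (d * e)) ^+ n)%:E)%E); last first.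
    by rewrite integral_cst // -muQ; exact: lexx.
  rewrite -EFinM lee_fin.
  rewrite -!exprMn (_ : bump 0 / 2 * (2 * (d * e)) = bump 0 * d * e) //.
  by rewrite mulrA divfK // mulrA.
rewrite [leLHS]integral_mkcond; apply: ge0_le_integral => //.
- by move=> x _; rewrite patchE; case: ifP => // _; rewrite lee_fin exprn_ge0 // divr_ge0 // ltW.
- by apply/(measurable_restrictT _ mQ).
- by apply/measurable_EFinP; exact: measurable_mol.
- move=> x _; rewrite patchE; case: ifPn => [|_]; last by rewrite lee_fin mol0_ge0.
  rewrite inE => Qx; rewrite lee_fin -[n in _ ^+ n]card_ord -prodr_const.
  apply: ler_prod => i _; rewrite divr_ge0 ?bump_ge0 //=; apply: Hd.
  rewrite normrM (ger0_norm (_ : 0 <= e^-1)) ?invr_ge0 ?(ltW e0) // ltr_pdivrMr //.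
  by have := Qx i; rewrite /= in_itv /= -ltr_norml.
Qed.

Lemma mass_gt0 e : 0 < e -> 0 < mass e.
Proof.
move=> e0; have [c c0 H] := mass_lower.
by apply: lt_le_trans (H e e0); rewrite mulr_gt0 ?exprn_gt0.
Qed.

Definition eta e (x : V) : R := mol0 e x / mass e.

Lemma measurable_eta e : measurable_fun setT (eta e).
Proof. by apply: measurable_funM => //; exact: measurable_mol. Qed.

Lemma eta_ge0 e x : 0 < e -> 0 <= eta e x.
Proof. by move=> e0; rewrite divr_ge0 ?mol0_ge0 // ltW // mass_gt0. Qed.

Lemma eta_integrable e : 0 < e -> mu.-integrable setT (EFin \o eta e).
Proof.
move=> e0; have := integrableZl measurableT (mass e)^-1 (mol0_integrable e0).
by apply: eq_integrable => // x _; rewrite /= /eta mulrC.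
Qed.

Lemma eta_mass e : 0 < e -> \int[mu]_x eta e x = 1.
Proof.
move=> e0; rewrite /eta RintegralZr //; last exact: mol0_integrable.
by rewrite -/(mass e) divff // gt_eqF // mass_gt0.
Qed.

(** The mollifier at scale e is at most a multiple of e^-n and vanishes unless
    |h| is at most a multiple of e, where e^t |h|^(-n-t) is at least a multiple
    of e^-n. *)
Lemma eta_ker t : 0 < t -> exists2 C : R, 0 <= C & forall e (h : V), 0 < e -> 0 < enorm h ->
  eta e h <= C * e `^ t * ker (n%:R + t) h.
Proof.
move=> t0; have [B B0 HB] := mol0_uniform; have [c c0 Hc] := mass_lower.
set E := n%:R + t; have E0 : 0 <= E by rewrite addr_ge0 // ltW.
pose L := spread (R := R) (n := n).
have L0 : 0 < L by exact: spread_gt0.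
exists (B / c * L `^ E); first by rewrite mulr_ge0 ?powR_ge0 // divr_ge0 // ltW.
move=> e h e0 h0; have [hL|hL] := leP (L * e) (enorm h).
  rewrite /eta mol_out // mul0r !mulr_ge0 ?powR_ge0 ?ker_ge0 // invr_ge0; exact: ltW.
apply: (@le_trans _ _ (B / (c * e ^+ n))).
  rewrite /eta; apply: ler_pM; rewrite ?mol0_ge0 ?invr_ge0 ?(ltW (mass_gt0 e0)) //.
  by rewrite lef_pV2 ?posrE ?mass_gt0 ?mulr_gt0 ?exprn_gt0 // Hc.
have := ker_ge E0 h0 (ltW hL).
set k := ker E h => hk.
have -> : B / (c * e ^+ n) = B / c * L `^ E * e `^ t * (L * e) `^ (- E).
  rewrite powRM ?(ltW L0) ?(ltW e0) //.
  rewrite (_ : e ^+ n = e `^ E * e `^ (- t)); last first.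
    by rewrite -powR_add // /E addrK powR_mulrn // ltW.
  rewrite !powRN; field.
  by rewrite !gt_eqF ?powR_gt0.
by rewrite -[leRHS]mulrA -[leLHS]mulrA; rewrite !mulrA; apply: ler_wpM2l => //;
  rewrite !mulr_ge0 ?powR_ge0 // invr_ge0 ltW.
Qed.

End mollifier.

Section tonelli3.
Local Open Scope ereal_scope.
Context d (T : measurableType d) (R : realType).
Variable m : {sigma_finite_measure set T -> \bar R}.
Variable f : (T * T) * T -> \bar R.
Hypotheses (mf : measurable_fun setT f) (f0 : forall w, 0 <= f w).

Lemma tonelli_pair :
  \int[m \x m]_z \int[m]_h f (z, h) = \int[m]_h \int[m \x m]_z f (z, h).
Proof.
have mF := @measurable_fun_fubini_tonelli_F _ _ _ _ _ m f mf f0.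
rewrite (@fubini_tonelli1 _ _ _ _ _ m m (fun z => \int[m]_h f (z, h)) mF); last first.
  by move=> z; exact: integral_ge0.
have mx x : measurable_fun setT (fun w : T * T => f ((x, w.1), w.2)).
  by apply: (measurableT_comp mf); apply: measurable_fun_pair => //; exact: measurable_fun_pair.
have mg : measurable_fun setT (fun w : (T * T) * T => f ((w.1.1, w.2), w.1.2)).
  apply: (measurableT_comp mf); apply: measurable_fun_pair; last exact: measurableT_comp.
  by apply: measurable_fun_pair => //; exact: measurableT_comp.
have mG := @measurable_fun_fubini_tonelli_F _ _ _ _ _ m _ mg (fun w => f0 _).
transitivity (\int[m]_x \int[m]_h \int[m]_y f ((x, y), h)).
  apply: eq_integral => x _.
  exact: (@fubini_tonelli _ _ _ _ _ m m (fun w => f ((x, w.1), w.2)) (mx x) (fun w => f0 _)).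
rewrite (@fubini_tonelli _ _ _ _ _ m m (fun w => \int[m]_y f ((w.1, y), w.2)) mG); last first.
  by move=> z; exact: integral_ge0.
apply: eq_integral => h _.
have mh : measurable_fun setT (fun z : T * T => f (z, h)).
  by apply: (measurableT_comp mf); exact: measurable_fun_pair.
exact: (esym (@fubini_tonelli1 _ _ _ _ _ m m (fun z => f (z, h)) mh (fun z => f0 _))).
Qed.

End tonelli3.

(** * Mollification and energy *)

Section mollify.
Context {R : realType} {n : nat}.
Local Notation V := 'rV[R]_n.
Local Notation mu := (lebesgue_rV R n).
Variables (phi : V -> R) (Bphi a : R).
Hypotheses (mphi : measurable_fun setT phi) (phi0 : forall x, 0 <= phi x).
Hypothesis phiB : forall x, phi x <= Bphi.
Hypothesis phia : forall x, a <= enorm x -> phi x = 0.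

Definition mollify e : V -> R := conv (fun y => phi y / mass (n := n) e) (fun=> 0%N) e.

Let mphih (h : V) : measurable_fun setT (fun x : V => phi (x + h)).
Proof. by apply: (measurableT_comp mphi); exact: measurable_rV_add. Qed.

Let mphix (x : V) : measurable_fun setT (fun h : V => phi (x + h)).
Proof. by under eq_fun do rewrite addrC; exact: mphih. Qed.

Lemma mollifyE e x : mollify e x = \int[mu]_h (phi (x + h) * eta e h).
Proof.
rewrite /mollify /conv /Rintegral; congr fine.
pose G (y : V) := (mol (fun=> 0%N) e (x - y) * (phi y / mass (n := n) e))%:E.
have mG : measurable_fun setT G.
  apply/measurable_EFinP; apply: measurable_funM; last exact: measurable_funM.
  apply: (measurableT_comp (measurable_mol (fun=> 0%N) e)).
  exact: measurable_rV_fun_sub.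
rewrite -(integral_rV_translate_signed x mG); apply: eq_integral => h _.
rewrite /G /eta (_ : x - (h + x) = - h); last by rewrite opprD addrCA subrr addr0.
by rewrite mol0N [h + x]addrC; congr EFin; ring.
Qed.

Lemma integrable_mollify e x : 0 < e ->
  mu.-integrable setT (fun h : V => (phi (x + h) * eta e h)%:E).
Proof.
move=> e0; apply: (integrable_bounded_mul (mphix x) _ (eta_integrable e0)) => h.
by rewrite ger0_norm //; exact: phiB.
Qed.

Lemma mollify_sub_self e x : 0 < e ->
  mollify e x - phi x = \int[mu]_h ((phi (x + h) - phi x) * eta e h).
Proof.
move=> e0; rewrite mollifyE -[phi x in LHS]mulr1 -(@eta_mass R n e e0).
have ie := eta_integrable (n := n) e0.
rewrite -RintegralZl // -RintegralB //.
- by apply: eq_Rintegral => h _; rewrite mulrBl.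
- exact: integrable_mollify.
- exact: (integrableZl measurableT (phi x) ie).
Qed.

Lemma mollify_sub e x y : 0 < e ->
  mollify e x - mollify e y = \int[mu]_h ((phi (x + h) - phi (y + h)) * eta e h).
Proof.
move=> e0; rewrite !mollifyE -RintegralB //; [|exact: integrable_mollify..].
by apply: eq_Rintegral => h _; rewrite mulrBl.
Qed.

Let phi_diff x y : `|phi x - phi y| <= Bphi.
Proof.
by have := phi0 x; have := phi0 y; have := phiB x; have := phiB y; rewrite ler_norml; lra.
Qed.

Lemma smooth_mollify e b : 0 < e -> a + spread (R := R) (n := n) * e < b ->
  Cc_infty (eball b) (mollify e).
Proof.
move=> e0; apply: (@Cc_infty_conv R n _ (Bphi / mass (n := n) e) a) => //.
- exact: measurable_funM.
- by move=> x; rewrite mulr_ge0 // invr_ge0 ltW // mass_gt0.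
- by move=> x; rewrite ler_wpM2r // invr_ge0 ltW // mass_gt0.
- by move=> x xa; rewrite phia // mul0r.
Qed.

Lemma measurable_mollify e : 0 < e -> measurable_fun setT (mollify e).
Proof.
move=> e0.
have mF : measurable_fun setT (fun z : V * V => (phi (z.1 + z.2) * eta e z.2)%:E).
  apply/measurable_EFinP; apply: measurable_funM.
    by apply: (measurableT_comp mphi); exact: measurable_rV_fun_add.
  by apply: measurableT_comp => //; exact: measurable_eta.
have mFF := measurable_fun_fubini_tonelli_F (m2 := mu) _ mF.
rewrite (_ : mollify e = fine \o (fun x => \int[mu]_h (phi (x + h) * eta e h)%:E)%E).
  apply: measurableT_comp => //; apply: mFF => z.
  by rewrite lee_fin mulr_ge0 // eta_ge0.
by apply/funext => x; rewrite mollifyE.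
Qed.

Section rates.
Variables (s m : R).
Hypotheses (s0 : 0 < s) (s1 : s < 1) (m2 : 2 <= m).
Local Open Scope ereal_scope.

Let m1 : (1 <= m)%R. Proof. by apply: le_trans m2; rewrite ler1n. Qed.
Let m0 : (0 < m)%R. Proof. exact: lt_le_trans ltr01 m1. Qed.

(** By [average_powR_le] the m-th power of the error at x is at most 2^m times
    the average of |phi (x + h) - phi x|^m over the mollifier, which [eta_ker]
    replaces by the kernel of the energy. *)
Lemma mollify_Lm_rate : exists2 C : R, (0 <= C)%R & forall e, (0 < e)%R ->
  \int[mu]_x (`|mollify e x - phi x| `^ m)%:E <= (C * e `^ (s * m))%:E * energy s m phi.
Proof.
have [C C0 HC] := @eta_ker R n (s * m)%R (mulr_gt0 s0 m0).
exists (2 `^ m * C)%R; first by rewrite mulr_ge0 ?powR_ge0.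
move=> e e0.
pose D z := (energy_density s m phi z)%:E.
have mD : measurable_fun setT D.
  by apply/measurable_EFinP; exact: measurable_energy_density.
have D0 z : 0 <= D z by rewrite lee_fin energy_density_ge0.
pose Ds (z : V * V) := D (z.1, z.1 + z.2)%R.
have mDs : measurable_fun setT Ds.
  apply: (measurableT_comp mD); apply: measurable_fun_pair => //.
  exact: measurable_rV_fun_add.
have Ds0 z : 0 <= Ds z by rewrite lee_fin energy_density_ge0.
have -> : energy s m phi = \int[mu]_x \int[mu]_h Ds (x, h).
  rewrite -(fubini_tonelli1 Ds mDs Ds0).
  exact: (esym (integral_diff_variable mD D0)).
have mF := measurable_fun_fubini_tonelli_F (m2 := mu) _ mDs Ds0.
rewrite -ge0_integralZl //; last 2 first.
- by move=> x _; apply: integral_ge0 => h _; exact: Ds0.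
- by rewrite lee_fin !mulr_ge0 ?powR_ge0.
apply: ge0_le_integral => //.
- apply/measurable_EFinP; apply: (measurableT_comp (@measurable_powR R m)).
  apply: measurableT_comp => //; apply: measurable_funB => //.
  exact: measurable_mollify.
- apply: emeasurable_funM => //; exact: mF.
move=> x _; rewrite mollify_sub_self //.
have mdx : measurable_fun setT (fun h : V => (phi (x + h) - phi x)%R).
  exact: measurable_funB.
have HA := @average_powR_le R n (eta e) (fun h => phi (x + h) - phi x)%R Bphi m
  m1 mdx (fun h => @eta_ge0 R n e h e0)
  (@eta_integrable R n e e0) (@eta_mass R n e e0) (fun h => phi_diff _ _).
apply: (le_trans HA).
rewrite (_ : (2 `^ m * C * e `^ (s * m))%:E = (2 `^ m)%:E * (C * e `^ (s * m))%:E); last first.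
  by rewrite -EFinM mulrA.
have mD1 : measurable_fun setT (fun h : V => Ds (x, h)).
  exact: (measurableT_comp mDs (measurable_pair1 x)).
have K0 : 0 <= (C * e `^ (s * m))%:E by rewrite lee_fin mulr_ge0 ?powR_ge0.
rewrite -muleA; apply: lee_wpmul2l; first by rewrite lee_fin powR_ge0.
rewrite -(@ge0_integralZl _ _ R mu setT measurableT _ mD1 _ (fun h _ => Ds0 (x, h)) K0).
apply: ge0_le_integral.
- exact: measurableT.
- by move=> h _; rewrite lee_fin mulr_ge0 ?powR_ge0 ?eta_ge0.
- apply/measurable_EFinP; apply: measurable_funM; first exact: measurable_eta.
  by apply: (measurableT_comp (@measurable_powR R m)); apply: measurableT_comp.
- exact: (emeasurable_funM (measurable_cst _) mD1).
move=> h _; rewrite /Ds /D -EFinM lee_fin /energy_density /=.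
rewrite (_ : x - (x + h) = - h)%R; last by rewrite opprD addrA subrr add0r.
rewrite kerN [`|phi x - _|%R]distrC.
have [h0|h0] := eqVneq (enorm h) 0%R.
  rewrite (enorm_eq0 h0) addr0 subrr normr0 powR0 ?gt_eqF //.
  by rewrite !(mul0r, mulr0).
have hp : (0 < enorm h)%R by rewrite lt_def h0 enorm_ge0.
rewrite [leRHS]mulrCA mulrC; apply: ler_wpM2l; first exact: powR_ge0.
exact: HC.
Qed.

Definition near_energy d : \bar R :=
  \int[mu \x mu]_z (energy_density s m phi z * ballind d (z.1 - z.2))%:E.

Let N d (z : V * V) := (energy_density s m phi z * ballind d (z.1 - z.2))%:E.

Let N0 d z : 0 <= N d z.
Proof. by rewrite lee_fin mulr_ge0 ?energy_density_ge0 ?ballind_ge0. Qed.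

Let mballd d : measurable_fun setT (fun z : V * V => ballind d (z.1 - z.2)%R).
Proof.
by apply: (measurableT_comp (measurable_ballind d)); exact: measurable_rV_fun_sub.
Qed.

Let mN d : measurable_fun setT (N d).
Proof.
by apply/measurable_EFinP; apply: measurable_funM => //; exact: measurable_energy_density.
Qed.

(** Mollification averages translates, each of which has the same energy at
    short range as phi; the power of the average is again bounded by
    [average_powR_le]. *)
Lemma mollify_near_energy d e : (0 < e)%R ->
  \int[mu \x mu]_z (energy_density s m (mollify e) z * ballind d (z.1 - z.2))%:E <=
  (2 `^ m)%:E * near_energy d.
Proof.
move=> e0.
pose H (w : (V * V) * V) : \bar R :=
  (eta e w.2)%:E * N d (w.1.1 + w.2, w.1.2 + w.2)%R.
have mH : measurable_fun setT H.
  apply: emeasurable_funM.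
    by apply/measurable_EFinP; apply: (measurableT_comp (measurable_eta e)).
  apply: (measurableT_comp (mN d)); apply: measurable_fun_pair;
    by apply: measurable_rV_fun_add => //; exact: measurableT_comp.
have H0 w : 0 <= H w by rewrite mule_ge0 // lee_fin eta_ge0.
have E1 : \int[mu \x mu]_z \int[mu]_h H (z, h) = near_energy d.
  rewrite (tonelli_pair mu mH H0).
  transitivity (\int[mu]_h ((eta e h)%:E * near_energy d)).
    apply: eq_integral => h _; rewrite /H /=.
    have mNh : measurable_fun setT (fun z : V * V => N d (z.1 + h, z.2 + h)%R).
      by apply: (measurableT_comp (mN d)); apply: measurable_fun_pair;
        apply: measurable_rV_fun_add.
    have e0h : 0 <= (eta e h)%:E by rewrite lee_fin eta_ge0.
    rewrite (@ge0_integralZl _ _ R (mu \x mu)%E setT measurableT _ mNh _ (fun z _ => N0 d _) e0h).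
    by congr (_ * _); exact: (integral_diag_translate h (mN d) (N0 d)).
  rewrite ge0_integralZr //.
  - have -> : \int[mu]_h (eta e h)%:E = 1.
      rewrite -(@fineK _ (\int[mu]_h (eta e h)%:E)).
        by rewrite -/(Rintegral mu setT (eta e)) eta_mass.
      by apply: integrable_fin_num => //; exact: eta_integrable.
    by rewrite mul1e.
  - by apply/measurable_EFinP; exact: measurable_eta.
  - by move=> h _; rewrite lee_fin eta_ge0.
  - by apply: integral_ge0 => z _; exact: N0.
have mFH := @measurable_fun_fubini_tonelli_F _ _ _ _ _ mu H mH H0.
have FH0 z : 0 <= \int[mu]_h H (z, h) by exact: integral_ge0.
have K0 : 0 <= (2 `^ m)%:E by rewrite lee_fin powR_ge0.
rewrite -E1 -(@ge0_integralZl _ _ R (mu \x mu)%E setT measurableT _ mFH _ (fun z _ => FH0 z) K0).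
apply: ge0_le_integral.
- exact: measurableT.
- by move=> z _; rewrite lee_fin mulr_ge0 ?energy_density_ge0 ?ballind_ge0.
- apply/measurable_EFinP; apply: measurable_funM => //.
  by apply: measurable_energy_density; exact: measurable_mollify.
- exact: (emeasurable_funM (measurable_cst _) mFH).
move=> [x y] _ /=.
pose c := (ker (n%:R + s * m) (x - y) * ballind d (x - y))%R.
have c0 : (0 <= c)%R by rewrite mulr_ge0 ?ker_ge0 ?ballind_ge0.
have mdx : measurable_fun setT (fun h : V => (phi (x + h) - phi (y + h))%R).
  exact: measurable_funB.
have := @average_powR_le R n (eta e) (fun h => phi (x + h) - phi (y + h))%R Bphi m
  m1 mdx (fun h => @eta_ge0 R n e h e0)
  (@eta_integrable R n e e0) (@eta_mass R n e e0) (fun h => phi_diff _ _).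
rewrite -mollify_sub // => HA.
rewrite /energy_density /= -mulrA -/c EFinM muleC.
apply: (@le_trans _ _ (c%:E * ((2 `^ m)%:E *
   \int[mu]_h (eta e h * `|phi (x + h) - phi (y + h)| `^ m)%:E))).
  by apply: lee_wpmul2l; rewrite ?lee_fin.
rewrite muleCA; apply: lee_wpmul2l; first by rewrite lee_fin powR_ge0.
rewrite -ge0_integralZl //; last 2 first.
- apply/measurable_EFinP; apply: measurable_funM; first exact: measurable_eta.
  by apply: (measurableT_comp (@measurable_powR R m)); apply: measurableT_comp.
- by move=> h _; rewrite lee_fin mulr_ge0 ?powR_ge0 ?eta_ge0.
rewrite le_eqVlt; apply/orP; left; apply/eqP; apply: eq_integral => h _.
rewrite /H /N /= -!EFinM; congr EFin; rewrite /energy_density /= /c.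
rewrite (_ : x + h - (y + h) = x - y)%R; last by rewrite opprD addrACA subrr addr0.
by ring.
Qed.

End rates.
End mollify.

(** * Bounded functions of finite energy *)

Lemma powR_cvg0_seq {R : realType} (u : nat -> R) (r : R) : 0 < r ->
  (forall k, 0 <= u k) -> u k @[k --> \oo] --> 0 -> (u k `^ r) @[k --> \oo] --> 0.
Proof.
move=> r0 u0 cu; apply/cvgrPdist_le => e e0.
have er : 0 < e `^ r^-1 by exact: powR_gt0.
move/cvgrPdist_le : cu => /(_ _ er) H.
near=> k.
have : `|0 - u k| <= e `^ r^-1 by near: k; exact: H.
rewrite !sub0r !normrN (ger0_norm (u0 k)) ger0_norm ?powR_ge0 // => uk.
apply: (@le_trans _ _ ((e `^ r^-1) `^ r)).
  by apply: ler_powR2 => //; exact: ltW.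
by rewrite -powRrM mulVf ?gt_eqF // powRr1 // ltW.
Unshelve. all: by end_near. Qed.

Lemma subr_subACA (V : zmodType) (a b c d : V) : a - c - (b - d) = (a - b) + (- (c - d)).
Proof.
by rewrite !opprB -!addrA; congr (a + _); rewrite [LHS]addrCA [RHS]addrCA [- c - b]addrC.
Qed.

Lemma le_poweR2 {R : realType} (x y : \bar R) (r : R) :
  0 <= r -> (0 <= x)%E -> (x <= y)%E -> (x `^ r <= y `^ r)%E.
Proof.
move=> r0 x0 xy; apply: gt0_ler_poweR => //; rewrite in_itv /= leey andbT //.
exact: le_trans xy.
Qed.


Section W0_membership.
Context {R : realType} {n : nat}.
Local Notation V := 'rV[R]_n.
Local Notation mu := (lebesgue_rV R n).
Variables (phi : V -> R) (Bphi a : R).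
Hypotheses (mphi : measurable_fun setT phi) (phi0 : forall x, 0 <= phi x).
Hypothesis phiB : forall x, phi x <= Bphi.
Hypothesis phia : forall x, a <= enorm x -> phi x = 0.
Variables (s m : R).
Hypotheses (s0 : 0 < s) (s1 : s < 1) (m2 : 2 <= m).
Hypothesis Efin : (energy s m phi < +oo)%E.
Local Open Scope ereal_scope.

Let m1 : (1 <= m)%R. Proof. by apply: le_trans m2; rewrite ler1n. Qed.
Let m0 : (0 < m)%R. Proof. exact: lt_le_trans ltr01 m1. Qed.

Local Notation err e := (fun x : V => mollify phi e x - phi x)%R.

Let mballd d : measurable_fun setT (fun z : V * V => ballind d (z.1 - z.2)%R).
Proof.
by apply: (measurableT_comp (measurable_ballind d)); exact: measurable_rV_fun_sub.
Qed.

(** For pairs closer than d the error is bounded by mollify phi and phi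
    separately.  For the others the kernel is integrable, with integral of order
    d^(-sm), and the L^m norm of the error suffices. *)
Lemma energy_mollify_error : exists A1 A2 : R, [/\ (0 <= A1)%R, (0 <= A2)%R &
  forall d e, (0 < d)%R -> (0 < e)%R ->
  energy s m (err e) <= A1%:E * near_energy phi s m d +
     (A2 * (d `^ (- (s * m)) * e `^ (s * m)))%:E * energy s m phi].
Proof.
have [C C0 HC] := mollify_Lm_rate mphi phi0 phiB s0 m2.
have [K [K0 HK]] := @ker_integral R n m (s * m)%R (mulr_gt0 s0 m0)
   (ltac:(by rewrite gtr_pMl)).
have P0 : (0 <= 2 `^ m :> R)%R by exact: powR_ge0.
exists (2 `^ m * (2 `^ m + 1))%R, (2 `^ m * 2 * K * C)%R; split.
- by rewrite mulr_ge0 // addr_ge0.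
- by rewrite !mulr_ge0 // ltW.
move=> d e d0 e0.
have mf := measurable_mollify mphi phi0 e0.
have mD : measurable_fun setT (err e) by exact: measurable_funB.
pose k (h : V) := (kmin m d h * ker (n%:R + s * m) h)%R : R.
have k0 h : (0 <= k h)%R by rewrite mulr_ge0 ?kmin_ge0 ?ker_ge0.
have mk : measurable_fun setT k.
  by apply: measurable_funM; [exact: measurable_kmin|exact: measurable_ker].
have kN h : k (- h)%R = k h by rewrite /k kminN kerN.
pose w (x : V) := (`|mollify phi e x - phi x| `^ m)%R : R.
have w0 x : (0 <= w x)%R by exact: powR_ge0.
have mw : measurable_fun setT w.
  by apply: (measurableT_comp (@measurable_powR R m)); exact: measurableT_comp.
pose T1 (z : V * V) := (energy_density s m (mollify phi e) z * ballind d (z.1 - z.2))%R.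
pose T2 (z : V * V) := (energy_density s m phi z * ballind d (z.1 - z.2))%R.
pose T3 (z : V * V) := (w z.1 * k (z.1 - z.2))%R.
pose T4 (z : V * V) := (w z.2 * k (z.1 - z.2))%R.
have T10 z : (0 <= T1 z)%R by rewrite mulr_ge0 ?energy_density_ge0 ?ballind_ge0.
have T20 z : (0 <= T2 z)%R by rewrite mulr_ge0 ?energy_density_ge0 ?ballind_ge0.
have T30 z : (0 <= T3 z)%R by exact: mulr_ge0.
have T40 z : (0 <= T4 z)%R by exact: mulr_ge0.
have mT1 : measurable_fun setT T1.
  by apply: measurable_funM => //; exact: measurable_energy_density.
have mT2 : measurable_fun setT T2.
  by apply: measurable_funM => //; exact: measurable_energy_density.
have mT3 : measurable_fun setT T3.
  apply: measurable_funM; first exact: measurableT_comp.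
  exact: measurable_fun_diff.
have mT4 : measurable_fun setT T4.
  apply: measurable_funM; first exact: measurableT_comp.
  exact: measurable_fun_diff.
have pw z : (energy_density s m (err e) z <= 2 `^ m * ((T1 z + T2 z) + (T3 z + T4 z)))%R.
  case: z => x y; have [xy|xy] := ltP (enorm (x - y)) d.
    apply: (@le_trans _ _ (2 `^ m * (T1 (x, y) + T2 (x, y)))%R); last first.
      by apply: ler_wpM2l => //; rewrite lerDl addr_ge0.
    rewrite /T1 /T2 /= (ballind_in xy) !mulr1 /energy_density /= -mulrDl mulrA.
    apply: ler_wpM2r; first exact: ker_ge0.
    rewrite subr_subACA.
    rewrite -(normrN (phi x - phi y)%R); exact: (powR_sum_le _ _ (ltW m0)).
  apply: (@le_trans _ _ (2 `^ m * (T3 (x, y) + T4 (x, y)))%R); last first.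
    by apply: ler_wpM2l => //; rewrite lerDr addr_ge0.
  have km : kmin m d (x - y) = 1%R.
    rewrite /kmin; apply/min_idPr; rewrite -[leLHS](powRr0 (enorm (x - y) / d)).
    by apply: ler_powR; [rewrite ler_pdivlMr // mul1r|exact: ltW].
  rewrite /T3 /T4 /= -mulrDl /k km mul1r mulrA /energy_density /=.
  apply: ler_wpM2r; first exact: ker_ge0.
  rewrite /w -[in leRHS](normrN (mollify phi e y - phi y)%R).
  exact: (powR_sum_le _ _ (ltW m0)).
have mS : measurable_fun setT (fun z => ((T1 z + T2 z) + (T3 z + T4 z))%R).
  by apply: measurable_funD; exact: measurable_funD.
apply: (@le_trans _ _ (\int[mu \x mu]_z ((2 `^ m)%:E * ((T1 z + T2 z) + (T3 z + T4 z))%:E))).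
  apply: ge0_le_integral.
  - exact: measurableT.
  - by move=> z _; rewrite lee_fin energy_density_ge0.
  - by apply/measurable_EFinP; exact: measurable_energy_density.
  - by apply/measurable_EFinP; exact: measurable_funM.
  - by move=> z _; rewrite -EFinM lee_fin.
have mE (T : V * V -> R) : measurable_fun setT T -> measurable_fun setT (EFin \o T).
  by move=> ?; exact/measurable_EFinP.
have gE (T : V * V -> R) : (forall z, 0 <= T z)%R -> forall z, setT z -> 0 <= (T z)%:E.
  by move=> T0 z _; rewrite lee_fin.
have S0 z : (0 <= (T1 z + T2 z) + (T3 z + T4 z))%R by rewrite !addr_ge0.
rewrite (@ge0_integralZl_EFin _ _ R (mu \x mu)%E setT measurableT
  (EFin \o (fun z => (T1 z + T2 z) + (T3 z + T4 z))%R) (gE _ S0) (mE _ mS) _ P0).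
have S12 z : (0 <= T1 z + T2 z)%R by rewrite addr_ge0.
have S34 z : (0 <= T3 z + T4 z)%R by rewrite addr_ge0.
have mS12 : measurable_fun setT (fun z => T1 z + T2 z)%R by exact: measurable_funD.
have mS34 : measurable_fun setT (fun z => T3 z + T4 z)%R by exact: measurable_funD.
have -> : \int[mu \x mu]_z (EFin \o (fun z => (T1 z + T2 z) + (T3 z + T4 z))%R) z =
  \int[mu \x mu]_z (T1 z)%:E + \int[mu \x mu]_z (T2 z)%:E +
  (\int[mu \x mu]_z (T3 z)%:E + \int[mu \x mu]_z (T4 z)%:E).
  rewrite -(@ge0_integralD _ _ R (mu \x mu)%E setT measurableT _ _ (gE _ T10) (mE _ mT1) (gE _ T20) (mE _ mT2)).
  rewrite -(@ge0_integralD _ _ R (mu \x mu)%E setT measurableT _ _ (gE _ T30) (mE _ mT3) (gE _ T40) (mE _ mT4)).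
  exact: (@ge0_integralD _ _ R (mu \x mu)%E setT measurableT _ _ (gE _ S12) (mE _ mS12) (gE _ S34) (mE _ mS34)).
have H1 : \int[mu \x mu]_z (T1 z)%:E <= (2 `^ m)%:E * near_energy phi s m d.
  exact: (mollify_near_energy mphi phi0 phiB s m2 d e0).
have Ek : \int[mu]_x (k x)%:E <= (K * d `^ (- (s * m)))%:E by exact: HK.
have Ew : \int[mu]_x (w x)%:E <= (C * e `^ (s * m))%:E * energy s m phi by exact: HC.
have E0 : 0 <= energy s m phi.
  by apply: integral_ge0 => z _; rewrite lee_fin energy_density_ge0.
have Ekw : (\int[mu]_x (k x)%:E) * (\int[mu]_x (w x)%:E) <=
  (K * d `^ (- (s * m)))%:E * ((C * e `^ (s * m))%:E * energy s m phi).
  apply: lee_pmul => //; apply: integral_ge0 => x _; by rewrite lee_fin.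
have H3 : \int[mu \x mu]_z (T3 z)%:E <=
  (K * d `^ (- (s * m)))%:E * ((C * e `^ (s * m))%:E * energy s m phi).
  by rewrite (integral_kernel_fst mw mk w0 k0 kN).
have H4 : \int[mu \x mu]_z (T4 z)%:E <=
  (K * d `^ (- (s * m)))%:E * ((C * e `^ (s * m))%:E * energy s m phi).
  by rewrite (integral_kernel_snd mw mk w0 k0).
apply: (@le_trans _ _ ((2 `^ m)%:E * ((2 `^ m)%:E * near_energy phi s m d + near_energy phi s m d +
   ((K * d `^ (- (s * m)))%:E * ((C * e `^ (s * m))%:E * energy s m phi) +
    (K * d `^ (- (s * m)))%:E * ((C * e `^ (s * m))%:E * energy s m phi))))).
  apply: lee_wpmul2l; first by rewrite lee_fin.
  exact: (leeD (leeD H1 (lexx _)) (leeD H3 H4)).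
have EE : energy s m phi \is a fin_num by rewrite ge0_fin_numE.
have NN0 : 0 <= near_energy phi s m d.
  by apply: integral_ge0 => z _; rewrite lee_fin mulr_ge0 ?energy_density_ge0 ?ballind_ge0.
have NN : near_energy phi s m d \is a fin_num.
  rewrite ge0_fin_numE //; apply: le_lt_trans Efin; apply: ge0_le_integral.
  - exact: measurableT.
  - exact: gE.
  - exact: mE.
  - by apply: mE; exact: measurable_energy_density.
  - move=> z _; rewrite lee_fin ler_piMr ?energy_density_ge0 //; exact: ballind_le1.
rewrite -(fineK EE) -(fineK NN) -!(EFinM, EFinD) lee_fin.
by rewrite le_eqVlt; apply/orP; left; apply/eqP; ring.
Qed.

(** Dominated convergence: off the diagonal the indicator of the short range is
    eventually 0, and on the diagonal the density itself is 0. *)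
Lemma near_energy_cvg0 (d : nat -> R) : d k @[k --> \oo] --> 0%R ->
  (fine (near_energy phi s m (d k))) @[k --> \oo] --> 0%R.
Proof.
move=> d0.
pose f_ k (z : V * V) := (energy_density s m phi z * ballind (d k) (z.1 - z.2))%:E.
have mf_ k : measurable_fun setT (f_ k).
  by apply/measurable_EFinP; apply: measurable_funM => //; exact: measurable_energy_density.
pose g (z : V * V) := (energy_density s m phi z)%:E.
have mg : measurable_fun setT g.
  by apply/measurable_EFinP; exact: measurable_energy_density.
have ig : (mu \x mu).-integrable setT g.
  apply/integrableP; split => //.
  rewrite (eq_integral g) // => z _.
  by rewrite gee0_abs // lee_fin energy_density_ge0.
have cf : {ae (mu \x mu), forall z, setT z -> f_ ^~ z @ \oo --> (cst 0 : V * V -> \bar R) z}.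
  apply/aeW => z _ /=; apply: cvg_near_cst.
  have [z0|z0] := eqVneq (enorm (z.1 - z.2)%R) 0%R.
    apply: nearW => k; rewrite /f_ /energy_density (_ : z.1 = z.2).
      by rewrite subrr normr0 powR0 ?gt_eqF // !mul0r.
    by apply/eqP; rewrite -subr_eq0; apply/eqP; exact: enorm_eq0.
  have zp : (0 < enorm (z.1 - z.2))%R by rewrite lt_def z0 enorm_ge0.
  move/cvgrPdist_le : d0 => /(_ _ zp) H; near=> k.
  rewrite /f_ ballind_out ?mulr0 //.
  have : (`|0 - d k| <= enorm (z.1 - z.2)%R)%R by near: k; exact: H.
  by rewrite sub0r normrN; apply: le_trans; exact: ler_norm.
have dom : {ae (mu \x mu), forall z k, setT z -> `|f_ k z| <= g z}.
  apply/aeW => z k _; rewrite gee0_abs.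
    by rewrite lee_fin ler_piMr ?energy_density_ge0 // ballind_le1.
  by rewrite lee_fin mulr_ge0 ?energy_density_ge0 ?ballind_ge0.
have mc : measurable_fun setT (cst 0 : V * V -> \bar R) by exact: measurable_cst.
have [_ _] := @dominated_convergence _ _ R (mu \x mu)%E setT measurableT f_ (cst 0) g mf_ mc cf ig dom.
rewrite (_ : \int[mu \x mu]_z cst 0 z = 0%:E); last by rewrite integral0.
by move=> /fine_cvgP [_].
Unshelve. all: by end_near. Qed.


(** The approximating functions are the mollifications of phi at scales so small
    that their supports stay inside the ball of radius b. *)
Lemma W0_bounded b : (a < b)%R -> W0 s m (eball b) phi.
Proof.
move=> ab; split => //.
have L0 := @spread_gt0 R n; set L := spread in L0.
pose c := ((b - a) / (2 * L))%R.
have c0 : (0 < c)%R by rewrite divr_gt0 ?subr_gt0 // mulr_gt0.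
pose e (k : nat) : R := (c * harmonic k)%R.
have h0 k : (0 < harmonic k :> R)%R by rewrite /harmonic /= invr_gt0.
have h1 k : (harmonic k <= 1 :> R)%R by rewrite /harmonic /= invf_le1 // ler1n.
have e0 k : (0 < e k)%R by rewrite mulr_gt0.
have eb k : (a + L * e k < b)%R.
  apply: (@le_lt_trans _ _ (a + (b - a) / 2)%R); last by have := ab; lra.
  rewrite lerD2l (_ : L * e k = (b - a) / 2 * harmonic k)%R; last first.
    by rewrite /e /c; field; rewrite gt_eqF.
  by rewrite ler_piMr // divr_ge0 // subr_ge0 ltW.
exists (fun k => mollify phi (e k)); split.
  by move=> k; apply: (smooth_mollify mphi phi0 phiB phia (e0 k) (eb k)).
have ce : e k @[k --> \oo] --> 0%R.
  rewrite -[X in _ --> X](mulr0 c); apply: cvgM; first exact: cvg_cst.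
  exact: cvg_harmonic.
(* with this range d the factor d^(-sm) e^(sm) of the long range still tends to 0 *)
pose d k : R := (e k `^ 2^-1)%R.
have d0 k : (0 < d k)%R by exact: powR_gt0.
have cd : d k @[k --> \oo] --> 0%R.
  by apply: powR_cvg0_seq => // k; exact: ltW.
have [A1 [A2 [A10 A20 HA]]] := energy_mollify_error.
have [C C0 HC] := mollify_Lm_rate mphi phi0 phiB s0 m2.
have E0 : 0 <= energy s m phi.
  by apply: integral_ge0 => z _; rewrite lee_fin energy_density_ge0.
have EE : energy s m phi \is a fin_num by rewrite ge0_fin_numE.
have sm0 : (0 < s * m)%R by exact: mulr_gt0.
pose x k : R := (C * e k `^ (s * m) * fine (energy s m phi))%R.
pose y k : R := (A1 * fine (near_energy phi s m (d k)) +
                 A2 * e k `^ (s * m / 2) * fine (energy s m phi))%R.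
have N0 k : 0 <= near_energy phi s m (d k).
  by apply: integral_ge0 => z _; rewrite lee_fin mulr_ge0 ?energy_density_ge0 ?ballind_ge0.
have NN k : near_energy phi s m (d k) \is a fin_num.
  rewrite ge0_fin_numE //; apply: le_lt_trans Efin; apply: ge0_le_integral.
  - exact: measurableT.
  - by move=> z _; rewrite lee_fin mulr_ge0 ?energy_density_ge0 ?ballind_ge0.
  - by apply/measurable_EFinP; apply: measurable_funM => //; exact: measurable_energy_density.
  - by apply/measurable_EFinP; exact: measurable_energy_density.
  - move=> z _; rewrite lee_fin ler_piMr ?energy_density_ge0 //; exact: ballind_le1.
have x0 k : (0 <= x k)%R by rewrite !mulr_ge0 ?powR_ge0 ?fine_ge0.
have y0 k : (0 <= y k)%R by rewrite addr_ge0 // !mulr_ge0 ?powR_ge0 ?fine_ge0.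
have cp r : (0 < r)%R -> (e k `^ r)%R @[k --> \oo] --> 0%R.
  by move=> r0; apply: powR_cvg0_seq => // k; exact: ltW.
have cx : x k @[k --> \oo] --> 0%R.
  rewrite (_ : 0%R = C * 0 * fine (energy s m phi))%R; last by rewrite mulr0 mul0r.
  apply: cvgM; last exact: cvg_cst.
  by apply: cvgM; [exact: cvg_cst|exact: cp].
have cy : y k @[k --> \oo] --> 0%R.
  rewrite (_ : 0%R = A1 * 0 + A2 * 0 * fine (energy s m phi))%R; last first.
    by rewrite !mulr0 mul0r addr0.
  apply: cvgD.
    apply: cvgM; [exact: cvg_cst|exact: near_energy_cvg0].
  apply: cvgM; last exact: cvg_cst.
  by apply: cvgM; [exact: cvg_cst|apply: cp; rewrite divr_gt0].
have im0 : (0 < m^-1)%R by rewrite invr_gt0.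
apply: (@squeeze_cvge _ _ _ _ (cst 0) _ (fun k => (x k `^ m^-1 + y k `^ m^-1)%:E)).
- apply: nearW => k; rewrite /sobolev_norm /gagliardo; apply/andP; split.
    by rewrite adde_ge0 ?poweR_ge0.
  rewrite EFinD -!poweR_EFin; apply: leeD.
  + apply: le_poweR2; first exact: ltW.
      by apply: integral_ge0 => z _; rewrite lee_fin powR_ge0.
    by apply: (le_trans (HC _ (e0 k))); rewrite -[X in _ * X](fineK EE) -EFinM.
  + apply: le_poweR2; first exact: ltW.
      by apply: integral_ge0 => z _; rewrite lee_fin divr_ge0 ?powR_ge0.
    rewrite setXTT (eq_integral (fun z => (energy_density s m (err (e k)) z)%:E)) => [|z _]; last first.
      by rewrite /energy_density /= kerE.
    apply: (le_trans (HA _ _ (d0 k) (e0 k))).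
    rewrite -[X in _ + _ * X](fineK EE) -[X in _ * X + _](fineK (NN k)).
    rewrite -!EFinM -EFinD lee_fin /y lerD2l.
    rewrite (_ : d k `^ (- (s * m)) * e k `^ (s * m) = e k `^ (s * m / 2))%R //.
    rewrite /d -powRrM -powR_add //; congr powR.
    by move: (s * m)%R => t; lra.
- exact: cvg_cst.
- apply/fine_cvgP; split; first by apply: nearW.
  rewrite -[X in _ --> X](addr0 (0%R : R)); apply: cvgD; exact: powR_cvg0_seq.
Qed.

End W0_membership.

(** * The test function *)

(** The integral of a nonnegative function is a supremum over simple functions,
    so the domains can be arbitrary; the larger one will be an open set, whose
    measurability for the product sigma-algebra is a separate question. *)
Lemma ge0_integral_subset d (T : measurableType d) (R : realType)
    (mu : {measure set T -> \bar R}) (A B : set T) (f : T -> \bar R) :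
  (forall x, (0 <= f x)%E) -> A `<=` B ->
  (\int[mu]_(x in A) f x <= \int[mu]_(x in B) f x)%E.
Proof.
move=> f0 AB; rewrite !ge0_integralE //.
apply: le_ereal_sup => _ [h hf <-]; exists h => // x.
apply: le_trans (hf x) _; rewrite !patchE.
case: ifPn => xA; last by case: ifP.
by rewrite (mem_set (AB _ (set_mem xA))).
Qed.

Lemma integral_scale_lty d (T : measurableType d) (R : realType)
    (mu : {measure set T -> \bar R}) (c : R) (f : T -> R) :
  0 <= c -> measurable_fun setT f -> (forall x, 0 <= f x) ->
  (\int[mu]_x (f x)%:E < +oo)%E -> (\int[mu]_x (c * f x)%:E < +oo)%E.
Proof.
move=> c0 mf f0 fi.
have g0 x : setT x -> (0 <= (f x)%:E)%E by rewrite lee_fin.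
have mEf : measurable_fun setT (EFin \o f) by exact/measurable_EFinP.
rewrite (_ : (\int[mu]_x (c * f x)%:E = c%:E * \int[mu]_x (f x)%:E)%E).
  by apply: lte_mul_pinfty => //; rewrite lee_fin.
exact: (ge0_integralZl_EFin mu measurableT g0 mEf c0).
Qed.

Lemma max0_contraction (R : realDomainType) (a b : R) :
  `|Num.max 0 a - Num.max 0 b| <= `|a - b|.
Proof.
wlog ab : a b / a <= b.
  move=> H; case: (leP a b) => [|/ltW] h; first exact: H.
  by rewrite distrC (distrC a); exact: H.
have m1 : Num.max 0 a <= Num.max 0 b by rewrite ge_max !le_max lexx ab orbT.
rewrite distrC (distrC a) !ger0_norm ?subr_ge0 //.
rewrite lerBlDr ge_max; apply/andP; split.
  by rewrite addr_ge0 ?subr_ge0 // le_max lexx.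
by rewrite -{1}(subrK a b) lerD2l le_max lexx orbT.
Qed.

Section test_function.
Context {R : realType} {n : nat}.
Local Notation V := 'rV[R]_n.
Local Notation mu := (lebesgue_rV R n).
Variables (u : V -> R) (r M : R).
Hypotheses (mu_ : measurable_fun setT u) (u0 : forall x, 0 <= u x).
Hypotheses (r0 : 0 < r) (M0 : 0 <= M).

Definition excess (x : V) : R := Num.max 0 (M * barrier r x - u x).

Let v (x : V) := M * barrier r x.

Let mv : measurable_fun setT v.
Proof. by apply: measurable_funM => //; exact: measurable_barrier. Qed.

Lemma measurable_excess : measurable_fun setT excess.
Proof. by apply: measurable_maxr => //; exact: measurable_funB. Qed.

Lemma excess_ge0 x : 0 <= excess x.
Proof. by rewrite /excess le_max lexx. Qed.

Lemma excess_le x : excess x <= M.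
Proof.
rewrite /excess ge_max M0 /=; have h : M * barrier r x <= M.
  by apply: ler_piMr => //; exact: barrier_le1.
by rewrite lerBlDr (le_trans h) // lerDl.
Qed.

Lemma excess_gt0 x : 0 < excess x -> u x < M * barrier r x.
Proof. by rewrite /excess lt_max ltxx /= subr_gt0. Qed.

Lemma excess_barrier x : 0 < excess x -> 0 < barrier r x.
Proof.
move=> /excess_gt0 h; have := le_lt_trans (u0 x) h.
have := barrier_ge0 r x; rewrite le_eqVlt => /predU1P[<-|//].
by rewrite mulr0 ltxx.
Qed.

Lemma excess_out x : 8 / 25 * r <= enorm x -> excess x = 0.
Proof.
move=> h; rewrite /excess barrier_eq0 // mulr0 sub0r.
by apply/max_idPl; rewrite oppr_le0.
Qed.

Lemma excess_increment x y :
  `|excess x - excess y| <= `|v x - v y| + `|u x - u y|.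
Proof.
apply: (le_trans (max0_contraction _ _)).
rewrite -/(v x) -/(v y) (_ : _ - _ = (v x - v y) - (u x - u y)); last by ring.
exact: ler_normB.
Qed.

Let near_ball (x : V) := ballind (8 / 25 * r) x.

(** The function u has finite energy on the ball of radius r / 3 only.  Inside it
    the increments of the test function are controlled by those of u and of the
    barrier.  A pair that leaves it contributes only if the other point lies
    within radius 8 r / 25, hence at distance at least r / 75, where boundedness
    of the test function suffices. *)
Lemma energy_excess s m : 0 < s -> s < 1 -> 2 <= m ->
  (\int[mu \x mu]_(z in eball (r / 3) `*` eball (r / 3)) (energy_density s m u z)%:E < +oo)%E ->
  (energy s m excess < +oo)%E.
Proof.
move=> s0 s1 m2 Eu.
have m0 : 0 < m by exact: lt_le_trans m2.
(* 1 / 75 = 1 / 3 - 8 / 25 *)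
have d0 : 0 < r / 75 by exact: divr_gt0.
pose Q := @eball R n (r / 3) `*` @eball R n (r / 3).
have mQ : measurable Q by apply: measurableX; exact: measurable_eball.
pose I1 (z : V * V) := 2 `^ m * energy_density s m v z.
pose I2 (z : V * V) := 2 `^ m * (energy_density s m u z * \1_Q z).
pose I3 (z : V * V) := M `^ m * ((near_ball z.1 + near_ball z.2) *
  (kmin m (r / 75) (z.1 - z.2) * ker (n%:R + s * m) (z.1 - z.2))).
have P2 : 0 <= 2 `^ m :> R by exact: powR_ge0.
have I10 z : 0 <= I1 z by rewrite mulr_ge0 ?energy_density_ge0.
have d1 z : 0 <= energy_density s m u z * \1_Q z.
  by apply: mulr_ge0; [exact: energy_density_ge0|exact: ler0n].
have I20 z : 0 <= I2 z by exact: mulr_ge0.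
have I30 z : 0 <= I3 z.
  by rewrite !mulr_ge0 ?addr_ge0 ?ballind_ge0 ?kmin_ge0 ?ker_ge0 ?powR_ge0.
have mden (f : V -> R) : measurable_fun setT f -> measurable_fun setT (energy_density s m f).
  by move=> ?; exact: measurable_energy_density.
have mI1 : measurable_fun setT (EFin \o I1).
  by apply/measurable_EFinP; apply: measurable_funM => //; exact: mden.
have mI2' : measurable_fun setT (fun z => energy_density s m u z * \1_Q z).
  by apply: measurable_funM; [exact: mden|exact: measurable_indic].
have mI2 : measurable_fun setT (EFin \o I2).
  by apply/measurable_EFinP; apply: measurable_funM.
have mI3' : measurable_fun setT (fun z : V * V => (near_ball z.1 + near_ball z.2) *
  (kmin m (r / 75) (z.1 - z.2) * ker (n%:R + s * m) (z.1 - z.2))).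
  apply: measurable_funM.
    by apply: measurable_funD; apply: measurableT_comp => //; exact: measurable_ballind.
  apply: measurable_funM; last exact: measurable_ker_diff.
  by apply: measurable_kmin; exact: measurable_rV_fun_sub.
have mI3 : measurable_fun setT (EFin \o I3).
  by apply/measurable_EFinP; apply: measurable_funM.
have F1 : (\int[mu \x mu]_z (I1 z)%:E < +oo)%E.
  have d1' z : 0 <= energy_density s m v z by exact: energy_density_ge0.
  apply: (@integral_scale_lty _ _ R (mu \x mu)%E _ _ P2 (mden _ mv) d1').
  exact: energy_barrier.
have F2 : (\int[mu \x mu]_z (I2 z)%:E < +oo)%E.
  apply: (@integral_scale_lty _ _ R (mu \x mu)%E _ _ P2 mI2' d1).
  have -> : (\int[mu \x mu]_z (energy_density s m u z * \1_Q z)%:E =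
             \int[mu \x mu]_(z in Q) (energy_density s m u z)%:E)%E.
    rewrite [RHS]integral_mkcond; apply: eq_integral => z _.
    by rewrite patchE indicE; case: ifP => _; rewrite ?mulr1 ?mulr0.
  exact: Eu.
have F3 : (\int[mu \x mu]_z (I3 z)%:E < +oo)%E.
  apply: integral_scale_lty => //; first exact: powR_ge0.
    by move=> z; rewrite !mulr_ge0 ?addr_ge0 ?ballind_ge0 ?kmin_ge0 ?ker_ge0.
  apply: (@integral_kmin_ball _ _ _ _ _ (8 / 25 * r)) => //.
  - exact: measurable_ballind.
  - exact: ballind_ge0.
  - exact: ballind_out.
  - exact: ballind_le1.
have pw z : energy_density s m excess z <= I1 z + I2 z + I3 z.
  case: z => x y; rewrite /I1 /I2 /I3 /energy_density /=.
  set k := ker _ _; have k0 : 0 <= k by exact: ker_ge0.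
  rewrite indicE; have [hQ|hQ] := boolP ((x, y) \in Q).
    rewrite mulr1.
    rewrite -mulrDr -mulrDl.
    apply: (@le_trans _ _ (2 `^ m * ((`|v x - v y| `^ m + `|u x - u y| `^ m) * k))); last first.
      rewrite lerDl !mulr_ge0 ?powR_ge0 ?addr_ge0 ?ballind_ge0 ?kmin_ge0 //.
    rewrite mulrA; apply: ler_wpM2r => //.
    apply: (@le_trans _ _ (`| `|v x - v y| + `|u x - u y| | `^ m)).
      apply: ler_powR2 => //; first exact: ltW.
      by apply: (le_trans (excess_increment x y)); exact: ler_norm.
    have := powR_sum_le `|v x - v y| `|u x - u y| (ltW m0).
    by rewrite !normr_id.
  rewrite !mulr0 addr0.
  apply: (@le_trans _ _ (M `^ m * ((near_ball x + near_ball y) * (kmin m (r / 75) (x - y) * k)))); last first.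
    by rewrite lerDr !mulr_ge0 ?powR_ge0.
  rewrite !mulrA; apply: ler_wpM2r => //.
  have far (a b : V) : enorm a < 8 / 25 * r -> r / 3 <= enorm b -> kmin m (r / 75) (a - b) = 1.
    move=> ha hb; rewrite /kmin; apply/min_idPr.
    rewrite -[leLHS](powRr0 (enorm (a - b) / (r / 75))); apply: ler_powR; last exact: ltW.
    rewrite ler_pdivlMr // mul1r.
    have := enorm_triangleC a b; lra.
  have cap a b : `|excess a - excess b| `^ m <= M `^ m.
    apply: ler_powR2 => //; first exact: ltW.
    have := excess_ge0 a; have := excess_ge0 b; have := excess_le a; have := excess_le b.
    by rewrite ler_norml; lra.
  have zero : 0 <= M `^ m * (near_ball x + near_ball y) * kmin m (r / 75) (x - y).
    by rewrite !mulr_ge0 ?powR_ge0 ?addr_ge0 ?ballind_ge0 ?kmin_ge0.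
  have [hx|hx] := ltP (enorm x) (8 / 25 * r).
    have hy : r / 3 <= enorm y.
      rewrite leNgt; apply/negP => hy; move/negP: hQ; apply; rewrite inE; split => //=.
      rewrite /eball /=; lra.
    rewrite (far x y hx hy) mulr1; apply: (le_trans (cap x y)).
    by rewrite ler_peMr ?powR_ge0 // /near_ball ballind_in // lerDl ballind_ge0.
  have [hy|hy] := ltP (enorm y) (8 / 25 * r).
    have hx' : r / 3 <= enorm x.
      rewrite leNgt; apply/negP => hx'; move/negP: hQ; apply; rewrite inE; split => //=.
      rewrite /eball /=; lra.
    rewrite -(kminN m _ (x - y)) opprB (far y x hy hx') mulr1; apply: (le_trans (cap x y)).
    by rewrite ler_peMr ?powR_ge0 // /near_ball (ballind_in hy) lerDr ballind_ge0.
  by rewrite !excess_out // subrr normr0 powR0 // gt_eqF.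
apply: (@le_lt_trans _ _ (\int[mu \x mu]_z ((I1 z)%:E + (I2 z)%:E + (I3 z)%:E))%E).
  apply: ge0_le_integral.
  - exact: measurableT.
  - by move=> z _; rewrite lee_fin energy_density_ge0.
  - by apply/measurable_EFinP; apply: mden; exact: measurable_excess.
  - by apply: emeasurable_funD => //; exact: emeasurable_funD.
  - by move=> z _; rewrite -!EFinD lee_fin.
have g1 z : setT z -> (0 <= (I1 z)%:E)%E by rewrite lee_fin.
have g2 z : setT z -> (0 <= (I2 z)%:E)%E by rewrite lee_fin.
have g3 z : setT z -> (0 <= (I3 z)%:E)%E by rewrite lee_fin.
have g12 z : setT z -> (0 <= (I1 z)%:E + (I2 z)%:E)%E by move=> _; rewrite -EFinD lee_fin addr_ge0.
have mI12 := emeasurable_funD mI1 mI2.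
rewrite (@ge0_integralD _ _ R (mu \x mu)%E setT measurableT _ _ g12 mI12 g3 mI3).
rewrite (@ge0_integralD _ _ R (mu \x mu)%E setT measurableT _ _ g1 mI1 g2 mI2).
exact: (lte_add_pinfty (lte_add_pinfty F1 F2) F3).
Qed.

End test_function.

(** * Comparison with the barrier and gain on the annulus *)

Section form_upper.
Context {R : realType} {n : nat}.
Local Notation V := 'rV[R]_n.
Local Notation mu := (lebesgue_rV R n).

Definition annulus (r : R) : set V := eball r `\` eball (r / 2).

Lemma measurable_annulus r : measurable (annulus r).
Proof. by apply: measurableD; exact: measurable_eball. Qed.

Lemma annulusP r x : annulus r x -> r / 2 <= enorm x /\ enorm x < r.
Proof. by case; rewrite /eball /= => h1 /negP; rewrite -leNgt. Qed.

Section excess_form.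
Variables (u : V -> R) (r M s m : R).
Hypotheses (mu_ : measurable_fun setT u) (u0 : forall x, 0 <= u x).
Hypotheses (r0 : 0 < r) (M0 : 0 <= M) (s0 : 0 < s) (m2 : 2 <= m).

Local Notation phi := (excess u r M).
Local Notation v := (fun x : V => M * barrier r x).

Definition shell_power (y : V) : R := u y `^ (m - 1) * \1_(annulus r) y.

(** A lower bound for the kernel between the support of the test function and the
    annulus, at mutual distance at most 2 r, with the factor lost in
    [spow_sub]. *)
Definition coupling : R := 2^-1 `^ (m - 1) * (2 * r) `^ (- (n%:R + s * m)).

Lemma coupling_gt0 : 0 < coupling.
Proof. by rewrite mulr_gt0 ?powR_gt0 ?invr_gt0 ?mulr_gt0. Qed.

Lemma shell_power_ge0 y : 0 <= shell_power y.
Proof. by rewrite mulr_ge0 ?powR_ge0 // indicE. Qed.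

(** The increment of u minus that of M times the barrier has the sign opposite to
    the increment of the test function, and the signed power is monotone; this
    is the bound when z.2 is not in the annulus.  If z.2 is in the annulus, the barrier and the test function
    vanish there, and [spow_sub] extracts the power of u z.2. *)
Lemma form_density_excess_le z :
  form_density s m u phi z <= form_density s m v phi z - coupling * (phi z.1 * shell_power z.2).
Proof.
case: z => x y; rewrite /form_density /=.
set k := ker _ _; have k0 : 0 <= k by exact: ker_ge0.
have e0 : 0 <= n%:R + s * m.
  by rewrite addr_ge0 // mulr_ge0 ?(ltW s0) //; apply: le_trans m2.
have [hy|hy] := pselect (annulus r y); last first.
  rewrite /shell_power indicE memNset // !mulr0 subr0.
  apply: ler_wpM2r => //; rewrite -subr_le0 -mulrBl.
  have [h|h|h] := ltgtP (phi x) (phi y).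
  - apply: mulr_ge0_le0; last by rewrite subr_le0 ltW.
    rewrite subr_ge0; apply: spow_mono => //.
    have : M * barrier r x - u x <= M * barrier r y - u y.
      rewrite leNgt; apply/negP => h'; move: h; rewrite ltNge => /negP; apply.
      by rewrite /excess ge_max !le_max lexx /= (ltW h') orbT.
    lra.
  - apply: mulr_le0_ge0; last by rewrite subr_ge0 ltW.
    rewrite subr_le0; apply: spow_mono => //.
    have : M * barrier r y - u y <= M * barrier r x - u x.
      rewrite leNgt; apply/negP => h'; move: h; rewrite ltNge => /negP; apply.
      by rewrite /excess ge_max !le_max lexx /= (ltW h') orbT.
    lra.
  - by rewrite h subrr mulr0.
have [y1 y2] := annulusP hy.
have y3 : 8 / 25 * r <= enorm y by lra.
rewrite (excess_out M u0 r0 y3) (barrier_eq0 r0 y3) mulr0 !subr0.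
have := excess_ge0 u r M x; rewrite le_eqVlt => /predU1P[<-|ex].
  by rewrite !(mulr0, mul0r) subr0.
have ux := excess_gt0 ex.
have x1 : enorm x < 8 / 25 * r.
  by rewrite ltNge; apply/negP => /(excess_out M u0 r0) h; move: ex; rewrite h ltxx.
have vx : 0 <= M * barrier r x by rewrite mulr_ge0 ?barrier_ge0.
have h1 : spow m (u x - u y) <= spow m (M * barrier r x) - (u y / 2) `^ (m - 1).
  apply: le_trans (spow_sub m2 vx (u0 y)); apply: spow_mono => //; lra.
apply: (@le_trans _ _ ((spow m (M * barrier r x) - (u y / 2) `^ (m - 1)) * phi x * k)).
  by apply: ler_wpM2r => //; apply: ler_wpM2r => //; exact: ltW.
rewrite !mulrBl lerD2l lerN2 /shell_power indicE mem_set // mulr1 /coupling.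
have hk : (2 * r) `^ (- (n%:R + s * m)) <= k.
  apply: ker_ge => //.
    have := enorm_triangleC x y; lra.
  by apply: (le_trans (enormB x y)); lra.
rewrite [(u y / 2) `^ _]powRM ?invr_ge0 //.
set a := u y `^ _; set b := 2^-1 `^ _.
have a0 : 0 <= a by exact: powR_ge0.
have b0 : 0 <= b by exact: powR_ge0.
rewrite (_ : b * (2 * r) `^ (- (n%:R + s * m)) * (phi x * a) =
  a * b * phi x * (2 * r) `^ (- (n%:R + s * m))); last by ring.
by apply: ler_wpM2l => //; rewrite !mulr_ge0 // ltW.
Qed.

Hypothesis s1 : s < 1.
Hypothesis Eu : (\int[mu \x mu]_(z in eball (r / 3) `*` eball (r / 3))
  (energy_density s m u z)%:E < +oo)%E.
Hypothesis Tu : (\int[mu]_(x in annulus r) (u x `^ (m - 1))%:E < +oo)%E.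

Let I := \int[mu]_x phi x.
Let T := fine (\int[mu]_(x in annulus r) (u x `^ (m - 1))%:E).

Lemma excess_integrable : mu.-integrable setT (EFin \o phi).
Proof.
apply: (@integrable_bounded _ _ _ M (8 / 25 * r)).
- exact: measurable_excess.
- exact: excess_ge0.
- exact: excess_le.
- by move=> x; exact: excess_out.
Qed.

Lemma frac_form_excess_le C :
  (\int[mu \x mu]_z (form_density s m v phi z)%:E <=
    (C * M `^ (m - 1) * r `^ (- (s * m)))%:E * \int[mu]_x (phi x)%:E)%E ->
  (frac_form s m u phi <=
    ((C * M `^ (m - 1) * r `^ (- (s * m)) - coupling * T) * I)%:E)%E.
Proof.
move=> HC; rewrite frac_formE.
have mphi : measurable_fun setT phi by exact: measurable_excess.
have mv : measurable_fun setT v.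
  by apply: measurable_funM => //; exact: measurable_barrier.
have m0 : 0 < m by exact: lt_le_trans m2.
have mW : measurable_fun setT shell_power.
  apply: measurable_funM; last exact: measurable_indic (measurable_annulus r).
  exact: (measurableT_comp (@measurable_powR R (m - 1)) mu_).
have EW : (\int[mu]_y (shell_power y)%:E = T%:E)%E.
  rewrite /T fineK; last first.
    by rewrite ge0_fin_numE //; apply: integral_ge0 => x _; rewrite lee_fin powR_ge0.
  rewrite [RHS]integral_mkcond; apply: eq_integral => y _.
  by rewrite patchE /shell_power indicE; case: ifP => _; rewrite ?mulr1 ?mulr0.
have Iphi : (\int[mu]_x (phi x)%:E = I%:E)%E.
  by rewrite /I /Rintegral fineK //; apply: integrable_fin_num => //; exact: excess_integrable.
pose G (z : V * V) := coupling * (phi z.1 * shell_power z.2).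
have G0 z : 0 <= G z.
  apply: mulr_ge0; first exact: ltW coupling_gt0.
  by apply: mulr_ge0; [exact: excess_ge0|exact: shell_power_ge0].
have mG' : measurable_fun setT (fun z : V * V => phi z.1 * shell_power z.2).
  by apply: measurable_funM; exact: measurableT_comp.
have mG : measurable_fun setT (EFin \o G).
  by apply/measurable_EFinP; apply: measurable_funM.
have IG : (\int[mu \x mu]_z (G z)%:E = (coupling * (T * I))%:E)%E.
  rewrite (fubini_tonelli1 (EFin \o G) mG) => [|z]; last by rewrite lee_fin.
  transitivity (\int[mu]_x ((coupling * T)%:E * (phi x)%:E))%E.
    apply: eq_integral => x _; rewrite /fubini_F /=.
    transitivity (\int[mu]_y ((coupling * phi x)%:E * (shell_power y)%:E))%E.
      by apply: eq_integral => y _; rewrite -EFinM /G /= mulrA.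
    rewrite ge0_integralZl_EFin //.
    - by rewrite EW -!EFinM; congr EFin; ring.
    - by move=> y _; rewrite lee_fin shell_power_ge0.
    - exact/measurable_EFinP.
    - by apply: mulr_ge0; [exact: ltW coupling_gt0|exact: excess_ge0].
  rewrite ge0_integralZl_EFin //.
  - by rewrite Iphi -EFinM mulrA.
  - by move=> y _; rewrite lee_fin excess_ge0.
  - exact/measurable_EFinP.
  - apply: mulr_ge0; first exact: ltW coupling_gt0.
    by apply: fine_ge0; apply: integral_ge0 => x _; rewrite lee_fin powR_ge0.
have iG : (mu \x mu)%E.-integrable setT (EFin \o G).
  apply/integrableP; split => //.
  rewrite (eq_integral (EFin \o G)) => [|z _]; first by rewrite IG ltry.
  by rewrite /= ger0_norm.
have iv : (mu \x mu)%E.-integrable setT (EFin \o form_density s m v phi).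
  apply: (integrable_form_density m2 mv mphi).
    exact: energy_barrier.
  exact: (energy_excess mu_ u0 r0 M0 s0 s1 m2 Eu).
apply: (@le_trans _ _ (\int[mu \x mu]_z ((form_density s m v phi z)%:E - (G z)%:E))%E).
  apply: le_integral_signed.
  - by apply/measurable_EFinP; exact: measurable_form_density.
  - exact: measurable_int (integrableB measurableT iv iG).
  - by move=> z; rewrite -EFinB lee_fin form_density_excess_le.
rewrite (integralB measurableT iv iG) [X in (_ - X <= _)%E]IG.
rewrite mulrBl EFinB mulrA; apply: leeB => //.
by rewrite EFinM -Iphi.
Qed.

End excess_form.
End form_upper.

(** * Averages over the annulus *)

Section averages.
Context {R : realType} {n : nat}.
Local Notation V := 'rV[R]_n.
Local Notation mu := (lebesgue_rV R n).

Lemma enorm_ge_min (x : V) (c : R) : 0 <= c -> (forall i, c <= `|x ord0 i|) ->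
  Num.sqrt n%:R * c <= enorm x.
Proof.
move=> c0 xc.
rewrite -{1}(ger0_norm c0) -sqrtr_sqr -sqrtrM //.
rewrite ler_sqrt; last by apply: sumr_ge0 => i _; exact: sqr_ge0.
rewrite -[n in leLHS]card_ord -sum1_card natr_sum mulr_suml.
apply: ler_sum => i _; rewrite mul1r -[leRHS]real_normK ?num_real //.
by rewrite ler_pXn2r ?nnegrE.
Qed.

(** The annulus contains the cube of the points whose coordinates all lie between
    lo and hi, because the Euclidean norm is then between sqrt n times these
    bounds. *)
Lemma annulus_volume_lower : (0 < n)%N -> exists2 a : R, 0 < a &
  forall r, 0 < r -> ((a * r ^+ n)%:E <= mu (annulus r))%E.
Proof.
move=> n0; pose q : R := Num.sqrt n%:R.
have q0 : 0 < q by rewrite sqrtr_gt0 ltr0n.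
exists ((4 * q)^-1 ^+ n); first by rewrite exprn_gt0 // invr_gt0 mulr_gt0.
move=> r r0.
pose lo := r / (2 * q); pose hi := 3 * r / (4 * q).
have lohi : lo < hi.
  rewrite /lo /hi (_ : r / (2 * q) = 2 * r / (4 * q)); last by field; rewrite gt_eqF.
  by rewrite ltr_pM2r ?invr_gt0 ?mulr_gt0 // ltr_pM2r // ltr_nat.
have lo0 : 0 <= lo by rewrite divr_ge0 ?mulr_ge0 ?(ltW r0) ?(ltW q0).
pose Q := [set x : V | forall i : 'I_n, `]lo, hi[%classic (x ord0 i)].
have mQ : measurable Q by exact: (measurable_rV_box (measurable_itv `]lo, hi[)).
have -> : ((4 * q)^-1 ^+ n * r ^+ n)%:E = mu Q.
  rewrite (@lebesgue_rV_box R n (fun=> `]lo, hi[%classic)) //.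
  rewrite (eq_bigr (fun=> ((4 * q)^-1 * r)%:E)) => [|i _].
    by rewrite prodEFin; congr EFin; rewrite prodr_const card_ord exprMn.
  rewrite lebesgue_measure_itv /= lte_fin lohi -EFinD; congr EFin.
  by rewrite /lo /hi; field; rewrite gt_eqF.
apply: le_measure; rewrite ?inE //; first exact: measurable_annulus.
have Es : q * lo = r / 2 by rewrite /lo; field; rewrite gt_eqF.
have Eh : q * hi = 3 / 4 * r by rewrite /hi; field; rewrite gt_eqF.
move=> x Qx; rewrite /annulus /eball; split => /=.
  apply: (@le_lt_trans _ _ (q * hi)); last by rewrite Eh; lra.
  apply: enorm_le_max => [|i]; first lra.
  have := Qx i; rewrite /= in_itv /= => /andP[h1 h2]; rewrite ger0_norm; lra.
apply/negP; rewrite -leNgt -Es; apply: enorm_ge_min => // i.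
have := Qx i; rewrite /= in_itv /= => /andP[h1 h2]; rewrite ger0_norm; lra.
Qed.

Lemma annulus_volume_fin (r : R) : 0 < r -> mu (annulus r) \is a fin_num.
Proof.
move=> r0; rewrite ge0_fin_numE //; apply: (@le_lt_trans _ _ ((2 * r) ^+ n)%:E); last by rewrite ltry.
apply: le_trans (lebesgue_rV_eball (ltW r0)); apply: le_measure.
- by rewrite inE; exact: measurable_annulus.
- by rewrite inE; exact: measurable_eball.
- by move=> x [].
Qed.

(** Above the level l the factor t^(m-q) is at least l^(m-q); below it the
    left-hand side is nonpositive. *)
Lemma powR_level_cut (t l q m : R) : 0 <= t -> 0 <= l -> 1 < q -> q <= m ->
  l `^ (m - q) * t `^ (q - 1) - l `^ (m - 1) <= t `^ (m - 1).
Proof.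
move=> t0 l0 q1 qm.
have m1 : 0 < m - 1 by lra.
have Em : m - q + (q - 1) = m - 1 by ring.
have E x : x `^ (m - 1) = x `^ (m - q) * x `^ (q - 1).
  by rewrite -powRD Em // (gt_eqF m1).
have [lt|lt] := leP l t.
  apply: (@le_trans _ _ (l `^ (m - q) * t `^ (q - 1))).
    by rewrite gerBl powR_ge0.
  rewrite E; apply: ler_wpM2r; first exact: powR_ge0.
  by apply: ler_powR2 => //; rewrite subr_ge0.
apply: (@le_trans _ _ 0); last exact: powR_ge0.
rewrite subr_le0 E; apply: ler_wpM2l; first exact: powR_ge0.
apply: ler_powR2; rewrite ?(ltW lt) //; lra.
Qed.

(** A substitute for the comparison of power means: [powR_level_cut] at the level
    l = L / 2, integrated over the annulus.  The factor 2^-m comes from keeping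
    half of the first term, which is possible as q >= 2. *)
Lemma moment_lower (u : V -> R) (r q m L : R) :
  measurable_fun setT u -> (forall x, 0 <= u x) -> 0 < r -> 2 <= q -> q <= m ->
  0 <= L ->
  (\int[mu]_(x in annulus r) (u x `^ (q - 1))%:E = (L `^ (q - 1))%:E * mu (annulus r))%E ->
  ((2 `^ (- m) * L `^ (m - 1))%:E * mu (annulus r) <=
    \int[mu]_(x in annulus r) (u x `^ (m - 1))%:E)%E.
Proof.
move=> mu_ u0 r0 q2 qm L0 HL.
have mA := @measurable_annulus R n r.
have q1 : 1 < q by lra.
set A := annulus r in mA HL *.
have fA : mu A \is a fin_num by exact: annulus_volume_fin.
have IC (c : R) : (\int[mu]_(x in A) (cst c%:E) x = c%:E * mu A)%E by exact: integral_cst.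
pose l := L / 2; have l0 : 0 <= l by rewrite divr_ge0.
have mq (e : R) : measurable_fun A (fun x => (u x `^ e)%:E).
  apply/measurable_EFinP; apply: measurable_funTS.
  exact: (measurableT_comp (@measurable_powR R e) mu_).
have Iq : mu.-integrable A (fun x => (u x `^ (q - 1))%:E).
  apply/integrableP; split => //.
  rewrite (eq_integral (fun x => (u x `^ (q - 1))%:E)) => [|x _].
    by rewrite HL -(fineK fA) -EFinM ltry.
  by rewrite gee0_abs // lee_fin powR_ge0.
have Ic : mu.-integrable A (fun=> (l `^ (m - 1))%:E).
  apply/integrableP; split => //.
  rewrite (eq_integral (cst (l `^ (m - 1))%:E)) => [|x _].
    by rewrite IC -(fineK fA) -EFinM ltry.
  by rewrite gee0_abs // lee_fin powR_ge0.
have Iq' := integrableZl mA (l `^ (m - q)) Iq.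
have H : (\int[mu]_(x in A) ((l `^ (m - q))%:E * (u x `^ (q - 1))%:E - (l `^ (m - 1))%:E) <=
   \int[mu]_(x in A) (u x `^ (m - 1))%:E)%E.
  rewrite integral_mkcond [leRHS]integral_mkcond; apply: le_integral_signed.
  - apply/(measurable_restrictT _ mA).
    exact: measurable_int (integrableB mA Iq' Ic).
  - by apply/(measurable_restrictT _ mA).
  - move=> x; rewrite !patchE; case: ifP => // _.
    by rewrite -EFinM -EFinB lee_fin; exact: powR_level_cut.
apply: le_trans H; rewrite (integralB mA Iq' Ic) integralZl //.
rewrite IC HL -(fineK fA) -!EFinM -EFinB lee_fin.
have f0 : 0 <= fine (mu A) by rewrite fine_ge0.
rewrite mulrA -mulrBl; apply: ler_wpM2r => //.
have m1 : 0 < m - 1 by lra.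
have Em : m - q + (q - 1) = m - 1 by ring.
have E x : 0 <= x -> x `^ (m - 1) = x `^ (m - q) * x `^ (q - 1).
  by move=> x0; rewrite -powRD Em // (gt_eqF m1).
have half : l `^ (q - 1) <= L `^ (q - 1) * 2^-1.
  rewrite /l powRM ?invr_ge0 //; apply: ler_wpM2l; first exact: powR_ge0.
  by rewrite -[leRHS]powRr1 ?invr_ge0 //; apply: ger_powR; lra.
have hm : 2 `^ (- m) * L `^ (m - q) <= 2^-1 * l `^ (m - q).
  rewrite /l powRM ?invr_ge0 // [_ * 2^-1 `^ _]mulrC mulrA.
  apply: ler_wpM2r; first exact: powR_ge0.
  have E2 : 2^-1 = 2 `^ (-1) :> R by rewrite powR_inv1.
  by rewrite E2 -powRrM -powR_add //; apply: ler_powR; lra.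
rewrite (E _ L0) (E _ l0) -mulrBr mulrA.
apply: (@le_trans _ _ (2^-1 * l `^ (m - q) * L `^ (q - 1))).
  by apply: ler_wpM2r => //; exact: powR_ge0.
rewrite [2^-1 * _]mulrC -mulrA; apply: ler_wpM2l; first exact: powR_ge0.
lra.
Qed.

End averages.

(** * Absorption of the barrier term *)

Section gain.
Context {R : realType} {n : nat}.
Local Notation V := 'rV[R]_n.
Local Notation mu := (lebesgue_rV R n).

(** The barrier term is homogeneous of degree m - 1 in sigma L and the gain is
    homogeneous of the same degree in L, with the same power of r.  A small sigma
    therefore leaves half of the gain, whatever r, L and u are. *)
Lemma frac_form_gain (s q m : R) : (0 < n)%N -> 0 < s -> s < 1 -> 2 <= q -> q <= m ->
  exists C k : R, [/\ 0 < C, 0 < k & forall (sigma r L : R) (u : V -> R),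
  0 < sigma -> C * sigma `^ (m - 1) <= k -> 0 < r -> 0 <= L ->
  measurable_fun setT u -> (forall x, 0 <= u x) ->
  (\int[mu \x mu]_(z in eball (r / 3) `*` eball (r / 3)) (energy_density s m u z)%:E < +oo)%E ->
  (\int[mu]_(x in annulus r) (u x `^ (m - 1))%:E < +oo)%E ->
  (\int[mu]_(x in annulus r) (u x `^ (q - 1))%:E = (L `^ (q - 1))%:E * mu (annulus r))%E ->
  (frac_form s m u (excess u r (sigma * L)) <=
    (- (k * r `^ (- (s * m)) * L `^ (m - 1)) * \int[mu]_x excess u r (sigma * L) x)%:E)%E].
Proof.
move=> n0 s0 s1 q2 qm; have m2 : 2 <= m by exact: le_trans qm.
have [C [C0 HC]] := @form_barrier_le R n s m m2 s0 s1.
have [a a0 Ha] := @annulus_volume_lower R n n0.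
pose k := 2^-1 `^ (m - 1) * 2 `^ (- (n%:R + s * m)) * (2 `^ (- m) * a) : R.
have k0 : 0 < k by rewrite !mulr_gt0 ?powR_gt0 ?invr_gt0.
exists C, (k / 2); split; [by []|by rewrite divr_gt0|].
move=> sigma r L u sig0 Csig r0 L0 mu_ u0 Eu Tu HL.
have M0 : 0 <= sigma * L by rewrite mulr_ge0 // ltW.
have mphi := measurable_excess r (sigma * L) mu_.
have H := @frac_form_excess_le R n u r (sigma * L) s m mu_ u0 r0 M0 s0 m2 s1 Eu Tu C
  (HC r (sigma * L) _ (sigma * L) r0 M0 mphi (excess_ge0 u r _)
    (excess_le r u0 M0) (excess_barrier u0)
    (energy_excess mu_ u0 r0 M0 s0 s1 m2 Eu)).
apply: (le_trans H); rewrite lee_fin; apply: ler_wpM2r.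
  by apply: Rintegral_ge0 => x _; exact: excess_ge0.
set T := fine _.
have fA : mu (annulus r) \is a fin_num by exact: annulus_volume_fin.
have T1 : 2 `^ (- m) * L `^ (m - 1) * (a * r ^+ n) <= T.
  have fT : (\int[mu]_(x in annulus r) (u x `^ (m - 1))%:E)%E \is a fin_num.
    by rewrite ge0_fin_numE //; apply: integral_ge0 => x _; rewrite lee_fin powR_ge0.
  rewrite -lee_fin /T fineK //.
  apply: le_trans (moment_lower mu_ u0 r0 q2 qm L0 HL).
  by rewrite EFinM; apply: lee_wpmul2l; [rewrite lee_fin mulr_ge0 ?powR_ge0|exact: Ha].
have r1 := powR_ge0 r (- (s * m)); have L1 := powR_ge0 L (m - 1).
have cT : k * r `^ (- (s * m)) * L `^ (m - 1) <= coupling (n := n) r s m * T.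
  apply: (@le_trans _ _ (coupling (n := n) r s m * (2 `^ (- m) * L `^ (m - 1) * (a * r ^+ n)))); last first.
    by apply: ler_wpM2l => //; exact: ltW (coupling_gt0 s m r0).
  rewrite /coupling /k powRM ?(ltW r0) // -(powR_expn_cancel n (s * m) r0).
  by rewrite le_eqVlt; apply/orP; left; apply/eqP; ring.
have cM : C * (sigma * L) `^ (m - 1) * r `^ (- (s * m)) <= k / 2 * r `^ (- (s * m)) * L `^ (m - 1).
  rewrite powRM ?(ltW sig0) //.
  rewrite (_ : _ * _ * _ = C * sigma `^ (m - 1) * (r `^ (- (s * m)) * L `^ (m - 1))); last by ring.
  rewrite -[leRHS]mulrA; apply: ler_wpM2r => //; exact: mulr_ge0.
set X := r `^ _ in cT cM r1 *; set Y := L `^ _ in cT cM L1 *.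
have : k / 2 * X * Y = k * X * Y / 2 by ring.
move: cM cT; set Z1 := _ * X; set Z2 := coupling _ _ _ * T.
move=> cM cT E; rewrite lerBlDr.
lra.
Qed.

Lemma small_power (C k e : R) : 0 < C -> 0 < k -> 1 <= e ->
  exists2 d : R, 0 < d <= 1 & forall t, 0 <= t -> t <= d -> C * t `^ e <= k.
Proof.
move=> C0 k0 e1; exists (Num.min 1 (k / C)).
  by rewrite lt_min ltr01 divr_gt0 //= ge_min lexx.
move=> t t0; rewrite le_min => /andP[t1 tk].
have h : t `^ e <= t.
  move: t0; rewrite le_eqVlt => /predU1P[<-|t0].
    by rewrite powR0 // gt_eqF // (lt_le_trans ltr01).
  by apply: ge1r_powR => //; rewrite t0.
apply: (@le_trans _ _ (C * t)); first by rewrite ler_wpM2l // ltW.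
by rewrite mulrC -ler_pdivlMr.
Qed.

End gain.

(** * Reduction to nonnegative functions *)

Section reduction.
Context {R : realType} {n : nat}.
Local Notation V := 'rV[R]_n.
Local Notation mu := (lebesgue_rV R n).
Implicit Types (u : V -> R) (s m r : R).

(** A nonnegative representative of u, which lets the rest of the argument assume
    u >= 0 everywhere. *)
Definition pos_part u (x : V) : R := Num.max 0 (u x).

Lemma pos_part_ge0 u x : 0 <= pos_part u x.
Proof. by rewrite /pos_part le_max lexx. Qed.

Lemma pos_part_le_norm u x : pos_part u x <= `|u x|.
Proof. by rewrite /pos_part ge_max normr_ge0 ler_norm. Qed.

Lemma measurable_pos_part u : measurable_fun setT u -> measurable_fun setT (pos_part u).
Proof. by move=> mu_; exact: measurable_maxr. Qed.

Lemma pos_part_increment u x y : `|pos_part u x - pos_part u y| <= `|u x - u y|.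
Proof. exact: max0_contraction. Qed.

Lemma pos_part_ae u : {ae mu, forall x, 0 <= u x} -> {ae mu, forall x, pos_part u x = u x}.
Proof.
by apply: filterS => x u0; rewrite /pos_part; apply/max_idPr.
Qed.

Lemma tildeW_energy s m r u : 0 < r -> 2 <= m ->
  tildeW s m (eball (r / 3)) u ->
  (\int[mu \x mu]_(z in eball (r / 3) `*` eball (r / 3))
    (energy_density s m u z)%:E < +oo)%E.
Proof.
move=> r0 m2 [[mu_ _] [U [_ _ BU h]]].
have m0 : 0 < m by exact: lt_le_trans m2.
set B := eball (r / 3) in BU *.
have tail0 : (0 <= \int[mu]_x (`|u x| `^ (m - 1) / (1 + enorm x) `^ (n%:R + s * m))%:E)%E.
  by apply: integral_ge0 => x _; rewrite lee_fin divr_ge0 ?powR_ge0.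
have L0 : (0 <= (\int[mu]_(x in U) (`|u x| `^ m)%:E) `^ m^-1)%E by exact: poweR_ge0.
have G : (gagliardo s m U u < +oo)%E.
  apply: le_lt_trans h; apply: (@le_trans _ _ (sobolev_norm s m U u)); last exact: leeDl.
  exact: leeDr.
apply: (@le_lt_trans _ _ (\int[mu \x mu]_(z in U `*` U) (energy_density s m u z)%:E)%E).
  apply: ge0_integral_subset.
    by move=> z; rewrite lee_fin energy_density_ge0.
  move=> [x y] [/= xB yB]; split; apply: BU; exact: subset_closure.
have E : (\int[mu \x mu]_(z in U `*` U) (energy_density s m u z)%:E =
  \int[mu \x mu]_(z in U `*` U)
    (`|u z.1 - u z.2| `^ m / enorm (z.1 - z.2) `^ (n%:R + s * m))%:E)%E.
  by apply: eq_integral => z _; rewrite /energy_density kerE.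
rewrite E; move: G; rewrite /gagliardo.
set J := (X in (X `^ _)%E) => G.
suff : (J < +oo)%E by [].
rewrite ltey; apply/eqP => Joo; move: G; rewrite Joo poweRyr ?ltxx //.
by rewrite invr_eq0 gt_eqF.
Qed.

(** The weight of the tail integral is bounded below on the annulus. *)
Lemma tildeW_moment s m r u (Omega : set V) : 0 < r -> 0 < s -> 2 <= m ->
  tildeW s m Omega u ->
  (\int[mu]_(x in annulus r) (`|u x| `^ (m - 1))%:E < +oo)%E.
Proof.
move=> r0 s0 m2 [[mu_ _] [U [_ _ _ h]]].
have m0 : 0 < m by exact: lt_le_trans m2.
set e := n%:R + s * m; have e0 : 0 <= e by rewrite addr_ge0 // mulr_ge0 // ltW.
pose g (x : V) := `|u x| `^ (m - 1) / (1 + enorm x) `^ e.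
have g0 x : 0 <= g x by rewrite divr_ge0 ?powR_ge0.
have mp : measurable_fun setT (fun x => `|u x| `^ (m - 1)).
  by apply: (measurableT_comp (@measurable_powR R (m - 1))); exact: measurableT_comp.
have mg : measurable_fun setT g.
  apply: measurable_funM => //.
  rewrite (_ : (fun x => _) = (fun x => (1 + enorm x) `^ (- e))); last first.
    by apply/funext => x; rewrite powRN.
  apply: (measurableT_comp (@measurable_powR R (- e))).
  by apply: measurable_funD => //; exact: measurable_enorm.
have tail : (\int[mu]_x (g x)%:E < +oo)%E.
  apply: le_lt_trans h; apply: leeDr.
  by rewrite /sobolev_norm adde_ge0 // poweR_ge0.
have mA := @measurable_annulus R n r.
have c0 : 0 <= (1 + r) `^ e by exact: powR_ge0.
apply: (@le_lt_trans _ _ (\int[mu]_x ((1 + r) `^ e * g x)%:E)%E); last first.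
  by apply: (@integral_scale_lty _ _ R mu _ _ c0 mg g0).
rewrite integral_mkcond; apply: ge0_le_integral.
- exact: measurableT.
- by move=> x _; rewrite patchE; case: ifP => _; rewrite ?lee_fin ?powR_ge0.
- apply/(measurable_restrictT _ mA); apply/measurable_EFinP; exact: measurable_funTS.
- by apply/measurable_EFinP; apply: measurable_funM.
- move=> x _; rewrite patchE; case: ifPn => [|_]; last by rewrite lee_fin mulr_ge0.
  rewrite inE => /annulusP [_ xr]; rewrite lee_fin /g mulrCA ler_peMr ?powR_ge0 //.
  have x1 : 0 < 1 + enorm x by rewrite ltr_pwDl // enorm_ge0.
  rewrite ler_pdivlMr ?powR_gt0 // mul1r; apply: ler_powR2 => //; [exact: ltW|lra].
Qed.

(** Pairs with a point in a null set form a null set of pairs. *)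
Lemma frac_form_pos_part s m u phi : measurable_fun setT u -> measurable_fun setT phi ->
  {ae mu, forall x, 0 <= u x} -> frac_form s m (pos_part u) phi = frac_form s m u phi.
Proof.
move=> mu_ mphi u0; rewrite !frac_formE.
have mup := measurable_pos_part mu_.
pose N := [set x : V | u x < 0].
have mN : measurable N.
  rewrite (_ : N = u @^-1` `]-oo, 0[%classic); last by apply/seteqP; split => x /=; rewrite in_itv.
  by rewrite -[X in measurable X]setTI; exact: mu_.
have N0 : mu N = 0%E.
  apply/(negligibleP _ mN).1; move: u0; apply: negligibleS => x /=.
  by rewrite /N /= => ux u0; move: (lt_le_trans ux u0); rewrite ltxx.
apply: ae_eq_integral.
- exact: measurableT.
- by apply/measurable_EFinP; exact: measurable_form_density.
- by apply/measurable_EFinP; exact: measurable_form_density.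
exists ((N `*` setT) `|` (setT `*` N)); split.
- by apply: measurableU; exact: measurableX.
- apply: null_set_setU; [exact: measurableX|exact: measurableX| |].
  + by transitivity (mu N * mu setT)%E; [exact: product_measure1E|rewrite N0 mul0e].
  + by transitivity (mu setT * mu N)%E; [exact: product_measure1E|rewrite N0 mule0].
move=> [x y] /= H; apply: contrapT => hN; apply: H => _.
have pE (z : V) : ~ N z -> pos_part u z = u z.
  by move=> /negP; rewrite -leNgt => h; rewrite /pos_part; apply/max_idPr.
rewrite /form_density /= !pE //.
- by move=> Ny; apply: hN; right.
- by move=> Nx; apply: hN; left.
Qed.

End reduction.

(** * The weak Harnack inequality *)

Section main.
Context {R : realType} {n : nat}.
Local Notation V := 'rV[R]_n.
Local Notation mu := (lebesgue_rV R n).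

Lemma integral0_ae_eq0 (f : V -> R) : measurable_fun setT f -> (forall x, 0 <= f x) ->
  (\int[mu]_x (f x)%:E = 0)%E -> {ae mu, forall x, f x = 0}.
Proof.
move=> mf f0 h.
have mE : measurable_fun setT (EFin \o f) by exact/measurable_EFinP.
have H : (\int[mu]_x `|(EFin \o f) x| = 0)%E.
  by rewrite -h; apply: eq_integral => x _; rewrite /= ger0_norm.
have := (ae_eq_integral_abs mu measurableT mE).1 H.
by apply: filterS => x /= /(_ I) [].
Qed.

(** The constant sigma is 3 / 8 times the smallness parameter tau allowed by both
    forms, and C1 is chosen to make the lower bound nonpositive when
    k L^(p-1) r^(-s1 p) <= K. *)
Lemma weak_harnack_nonneg (s1 s2 p q beta : R) : (0 < n)%N ->
  0 < s2 -> s2 < 1 -> 0 < s1 -> s1 < 1 -> 0 < beta -> 2 <= q -> q <= p ->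
  exists sigma C1 : R, [/\ 0 < sigma, sigma < 1, 0 < C1 &
  forall (r K L : R) (u : V -> R), 0 < r -> 0 < K -> 0 <= L ->
  measurable_fun setT u -> (forall x, 0 <= u x) ->
  (\int[mu \x mu]_(z in eball (r / 3) `*` eball (r / 3)) (energy_density s1 p u z)%:E < +oo)%E ->
  (\int[mu \x mu]_(z in eball (r / 3) `*` eball (r / 3)) (energy_density s2 q u z)%:E < +oo)%E ->
  (\int[mu]_(x in annulus r) (u x `^ (p - 1))%:E < +oo)%E ->
  (\int[mu]_(x in annulus r) (u x `^ (q - 1))%:E = (L `^ (q - 1))%:E * mu (annulus r))%E ->
  weak_supersol s1 p s2 q beta K (eball (r / 3)) u ->
  {ae mu, forall x, eball (r / 4) x ->
     sigma * L - C1 * (K * r `^ (p * s1)) `^ (p - 1)^-1 <= u x}].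
Proof.
move=> n0 hs2 hs21 hs1 hs11 hb q2 qp.
have p2 : 2 <= p by exact: le_trans qp.
have [Cp [kp [Cp0 kp0 Hp]]] := @frac_form_gain R n s1 q p n0 hs1 hs11 q2 qp.
have [Cq [kq [Cq0 kq0 Hq]]] := @frac_form_gain R n s2 q q n0 hs2 hs21 q2 (lexx q).
have [dp /andP[dp0 dp1] Hdp] := @small_power R Cp kp (p - 1) Cp0 kp0 (ltac:(lra)).
have [dq /andP[dq0 dq1] Hdq] := @small_power R Cq kq (q - 1) Cq0 kq0 (ltac:(lra)).
pose tau := Num.min dp dq.
have tau0 : 0 < tau by rewrite lt_min dp0.
have taup : tau <= dp by rewrite ge_min lexx.
have tauq : tau <= dq by rewrite ge_min lexx orbT.
have ip0 : 0 < (p - 1)^-1 by rewrite invr_gt0; lra.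
pose sigma := 3 / 8 * tau.
exists sigma, (sigma * kp^-1 `^ (p - 1)^-1); split.
- by rewrite mulr_gt0.
- rewrite /sigma; lra.
- by rewrite mulr_gt0 ?powR_gt0 ?invr_gt0 // mulr_gt0.
move=> r K L u r0 K0 L0 mu_ u0 Ep Eq Tp HL hw.
have sig0 : 0 < sigma by rewrite mulr_gt0.
pose X := kp * r `^ (- (s1 * p)) * L `^ (p - 1).
have [XK|KX] := leP X K.
  apply: aeW => x _; apply: le_trans (u0 x); rewrite subr_le0.
  rewrite [leRHS](_ : _ = sigma * (kp^-1 `^ (p - 1)^-1 * (K * r `^ (p * s1)) `^ (p - 1)^-1)); last by ring.
  apply: ler_wpM2l; first exact: ltW.
  have rp : 0 < r `^ (s1 * p) by exact: powR_gt0.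
  have LK : L `^ (p - 1) <= kp^-1 * (K * r `^ (p * s1)).
    rewrite [p * s1]mulrC ler_pdivlMl // -ler_pdivrMr //; apply: le_trans XK.
    by rewrite /X powRN le_eqVlt; apply/orP; left; apply/eqP; ring.
  rewrite -powRM ?invr_ge0 ?mulr_ge0 ?powR_ge0 ?(ltW kp0) ?(ltW K0) //.
  have -> : L = (L `^ (p - 1)) `^ (p - 1)^-1.
    by rewrite -powRrM mulfV ?powRr1 // gt_eqF //; lra.
  by apply: ler_powR2; rewrite ?powR_ge0 // ltW.
pose M := tau * L; have M0 : 0 <= M by rewrite mulr_ge0 // ltW.
pose phi := excess u r M.
have mphi : measurable_fun setT phi by exact: measurable_excess.
have phi0 x : 0 <= phi x by exact: excess_ge0.
have phiM x : phi x <= M by exact: excess_le.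
have phiout x : 8 / 25 * r <= enorm x -> phi x = 0 by exact: excess_out.
have rr : 8 / 25 * r < r / 3 by lra.
have Wp : W0 s1 p (eball (r / 3)) phi.
  apply: (W0_bounded mphi phi0 phiM phiout hs1 hs11 p2 _ rr).
  exact: (energy_excess mu_ u0 r0 M0 hs1 hs11 p2 Ep).
have Wq : W0 s2 q (eball (r / 3)) phi.
  apply: (W0_bounded mphi phi0 phiM phiout hs2 hs21 q2 _ rr).
  exact: (energy_excess mu_ u0 r0 M0 hs2 hs21 q2 Eq).
have Tq : (\int[mu]_(x in annulus r) (u x `^ (q - 1))%:E < +oo)%E.
  by rewrite HL -(fineK (annulus_volume_fin r0)) -EFinM ltry.
have Fp := Hp tau r L u tau0 (Hdp _ (ltW tau0) taup) r0 L0 mu_ u0 Ep Tp HL.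
have Fq := Hq tau r L u tau0 (Hdq _ (ltW tau0) tauq) r0 L0 mu_ u0 Eq Tq HL.
have ip : mu.-integrable setT (EFin \o phi) by exact: excess_integrable.
set I := \int[mu]_x excess u r (tau * L) x in Fp Fq.
have I0 : 0 <= I by apply: Rintegral_ge0 => x _; exact: phi0.
have EI : (\int[mu]_x (phi x)%:E = I%:E)%E.
  by rewrite /I /Rintegral fineK //; exact: integrable_fin_num ip.
have EB : (\int[mu]_(x in eball (r / 3)) (phi x)%:E = I%:E)%E.
  rewrite -EI integral_mkcond; apply: eq_integral => x _; rewrite patchE.
  case: ifPn => //; rewrite notin_setE /eball /= => /negP; rewrite -leNgt => xr.
  by rewrite phiout //; apply: le_trans xr; exact: ltW.
have := hw phi Wp Wq (aeW _ (fun x _ => phi0 x)); rewrite EB => hK.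
have Fq0 : (frac_form s2 q u phi <= 0%:E)%E.
  apply: le_trans Fq _; rewrite lee_fin mulNr oppr_le0.
  by rewrite !mulr_ge0 ?powR_ge0 // ltW.
have hfin : (- K%:E * I%:E <= (- X * I)%:E)%E.
  apply: (le_trans hK); rewrite -[leRHS]adde0; apply: leeD; first exact: Fp.
  by apply: mule_ge0_le0 => //; rewrite lee_fin ltW.
have Iz : I = 0.
  apply/eqP; rewrite eq_le I0 andbT leNgt; apply/negP => Ip.
  move: hfin; rewrite -EFinN -EFinM lee_fin !mulNr lerN2 ler_pM2r //.
  by rewrite leNgt KX.
have := integral0_ae_eq0 mphi phi0 (etrans EI (congr1 EFin Iz)).
apply: filterS => x px xr.
have vx : M * barrier r x <= u x.
  have : M * barrier r x - u x <= phi x by rewrite /phi /excess le_max lexx orbT.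
  by rewrite px subr_le0.
apply: (@le_trans _ _ (sigma * L)).
  by rewrite gerBl !mulr_ge0 ?powR_ge0 // ltW.
apply: le_trans vx.
rewrite (_ : sigma * L = M * (3 / 8)); last by rewrite /M /sigma; ring.
by apply: ler_wpM2l => //; exact: barrier_lower.
Qed.

End main.

Theorem lemma2p7 (R : realType) (n : nat) (s1 s2 p q beta : R)
    (hs2 : 0 < s2) (hs21 : s2 < s1) (hs1 : s1 < 1) (hn : p * s1 < n%:R)
    (hbeta : 0 < beta) (hq : 2 <= q) (hqp : q <= p) :
  exists sigma C1 : R, [/\ 0 < sigma, sigma < 1, 0 < C1 &
    forall r : R, 0 < r ->
    forall (u : 'rV[R]_n -> R) (K : R), 0 < K ->
    tildeW s1 p (eball (r / 3)) u ->
    tildeW s2 q (eball (r / 3)) u ->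
    weak_supersol s1 p s2 q beta K (eball (r / 3)) u ->
    {ae lebesgue_rV R n, forall x, 0 <= u x} ->
    let A := eball r `\` eball (r / 2) in
    (sigma%:E * ((lebesgue_rV R n A)^-1 *
        \int[lebesgue_rV R n]_(x in A) (u x `^ (q - 1))%:E) `^ (q - 1)^-1
      - (C1 * (K * r `^ (p * s1)) `^ (p - 1)^-1)%:E
    <= ess_inf (mrestr (lebesgue_rV R n) (measurable_eball (r / 4)))
         (EFin \o u))%E ].
Proof.
have s10 : 0 < s1 by exact: lt_trans hs21.
have s21 : s2 < 1 by exact: lt_trans hs21 hs1.
have p2 : 2 <= p by exact: le_trans hqp.
have n0 : (0 < n)%N.
  by rewrite -(ltr0n R); apply: lt_trans hn; rewrite mulr_gt0 //; lra.
have [sigma [C1 [sig0 sig1 C10 H]]] :=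
  @weak_harnack_nonneg R n s1 s2 p q beta n0 hs2 s21 s10 hs1 hbeta hq hqp.
exists sigma, C1; split => // r r0 u K K0 Wp Wq hw u0; cbv zeta; set A := _ `\` _.
pose mu := lebesgue_rV R n.
have mu_ : measurable_fun setT u by have [[]] := Wp.
pose w := pos_part u.
have mw : measurable_fun setT w by exact: measurable_pos_part.
have wu : {ae mu, forall x, w x = u x} by exact: pos_part_ae.
have den s m (hm : 2 <= m) (T : tildeW s m (eball (r / 3)) u) :
  (\int[mu \x mu]_(z in eball (r / 3) `*` eball (r / 3)) (energy_density s m w z)%:E < +oo)%E.
  apply: le_lt_trans (tildeW_energy r0 hm T).
  have mQ : measurable (@eball R n (r / 3) `*` @eball R n (r / 3)).
    by apply: measurableX; exact: measurable_eball.
  apply: ge0_le_integral => //.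
  - by move=> z _; rewrite lee_fin energy_density_ge0.
  - by apply/measurable_EFinP; apply: measurable_funTS; exact: measurable_energy_density.
  - by apply/measurable_EFinP; apply: measurable_funTS; exact: measurable_energy_density.
  - move=> z _; rewrite lee_fin; apply: ler_wpM2r; first exact: ker_ge0.
    by apply: ler_powR2; rewrite ?pos_part_increment //; lra.
have mA : measurable A by exact: measurable_annulus.
have mom s m (hs : 0 < s) (hm : 2 <= m) (T : tildeW s m (eball (r / 3)) u) :
  (\int[mu]_(x in annulus r) (w x `^ (m - 1))%:E < +oo)%E.
  apply: le_lt_trans (tildeW_moment r0 hs hm T).
  have mp (f : 'rV[R]_n -> R) : measurable_fun setT f -> measurable_fun A (fun x => (f x `^ (m - 1))%:E).
    move=> mf; apply/measurable_EFinP; apply: measurable_funTS.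
    exact: (measurableT_comp (@measurable_powR R (m - 1)) mf).
  apply: ge0_le_integral => //.
  - by move=> x _; rewrite lee_fin powR_ge0.
  - exact: mp.
  - by apply: mp; exact: measurableT_comp.
  - move=> x _; rewrite lee_fin; apply: ler_powR2; first lra.
      exact: pos_part_ge0.
    exact: pos_part_le_norm.
have fA : mu A \is a fin_num by exact: annulus_volume_fin.
have A0 : 0 < fine (mu A).
  have [a a0 Ha] := @annulus_volume_lower R n n0.
  rewrite -lte_fin fineK //; apply: lt_le_trans (Ha r r0).
  by rewrite lte_fin mulr_gt0 // exprn_gt0.
have q1 : 0 < q - 1 by lra.
have Tq := mom _ _ hs2 hq Wq.
have fT : (\int[mu]_(x in annulus r) (w x `^ (q - 1))%:E)%E \is a fin_num.
  by rewrite ge0_fin_numE //; apply: integral_ge0 => x _; rewrite lee_fin powR_ge0.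
set T := fine (\int[mu]_(x in annulus r) (w x `^ (q - 1))%:E)%E.
have T0 : 0 <= T by apply: fine_ge0; apply: integral_ge0 => x _; rewrite lee_fin powR_ge0.
pose L := ((fine (mu A))^-1 * T) `^ (q - 1)^-1.
have L0 : 0 <= L by exact: powR_ge0.
have HL : (\int[mu]_(x in annulus r) (w x `^ (q - 1))%:E = (L `^ (q - 1))%:E * mu (annulus r))%E.
  rewrite -(fineK fT) -/T -[mu (annulus r)](fineK fA) -EFinM; congr EFin.
  rewrite /L -powRrM mulVf ?gt_eqF // powRr1; last by rewrite mulr_ge0 // invr_ge0 ltW.
  by field; rewrite gt_eqF.
have hw' : weak_supersol s1 p s2 q beta K (eball (r / 3)) w.
  move=> phi W1 W2 phi0; have mphi : measurable_fun setT phi by have [] := W1.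
  by rewrite !frac_form_pos_part //; exact: hw.
have := H r K L w r0 K0 L0 mw (pos_part_ge0 u) (den _ _ p2 Wp) (den _ _ hq Wq)
  (mom _ _ s10 p2 Wp) HL hw'.
move=> lower.
have EL : (((mu A)^-1 * \int[mu]_(x in A) (u x `^ (q - 1))%:E) `^ (q - 1)^-1 = L%:E)%E.
  have -> : (\int[mu]_(x in A) (u x `^ (q - 1))%:E = T%:E)%E.
    rewrite /T fineK //; apply: ae_eq_integral => //.
    - apply/measurable_EFinP; apply: measurable_funTS.
      exact: (measurableT_comp (@measurable_powR R (q - 1)) mu_).
    - apply/measurable_EFinP; apply: measurable_funTS.
      exact: (measurableT_comp (@measurable_powR R (q - 1)) mw).
    - by move: wu; apply: filterS => x wx _; rewrite wx.
  rewrite -(fineK fA) inver gt_eqF // -EFinM poweR_EFin //.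
rewrite EL -EFinM -EFinB; apply/ess_infP.
have [N [mN N0 sN]] := lower; have [N' [mN' N0' sN']] := wu.
have mB : measurable (@eball R n (r / 4)) by exact: measurable_eball.
(* the essential infimum is taken for the measure restricted to the small ball,
   which does not charge the complement of the ball *)
exists (N `|` N' `|` ~` eball (r / 4)); split.
- by apply: measurableU; [exact: measurableU|exact: measurableC].
- rewrite /mrestr; apply: (@subset_measure0 _ _ _ mu _ (N `|` N')) => //.
  + by apply: measurableI => //; apply: measurableU; [exact: measurableU|exact: measurableC].
  + exact: measurableU.
  + by move=> x [[//|nB] B].
  + exact: etrans (measureU0 mN mN' N0') N0.
- move=> x /= hx; apply: contrapT => hn'; apply: hx.
  have nN : ~ N x by move=> Nx; apply: hn'; left; left.
  have nN' : ~ N' x by move=> Nx; apply: hn'; left; right.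
  have Bx : eball (r / 4) x by apply: contrapT => nB; apply: hn'; right.
  have wx : w x = u x by apply: contrapT => h; apply: nN'; exact: sN'.
  have lx : sigma * L - C1 * (K * r `^ (p * s1)) `^ (p - 1)^-1 <= w x.
    by apply: contrapT => h; apply: nN; apply: sN => /= h'; exact: h (h' Bx).
  by rewrite lee_fin -wx.
Qed.
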